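(* Let $\pi$ be an irreducible representation of the $C^*$-algebra $A_2(0)$ on a Hilbert space $\mathcal H$. Then there exist $\lambda,\mu\in S^1$ and a reduced word $\omega\in\{\mathrm{id},s_1,s_2,s_1s_2,s_2s_1,s_1s_2s_1\}$ in $\mathscr S_3$ (where $s_1=(1,2)$, $s_2=(2,3)$) such that $\pi$ is (unitarily) equivalent to $\psi_{(\lambda,\mu),\omega}$.
   Context: **The $C^*$-algebra $A_2(0)$.** It is the universal unital $C^*$-algebra generated by $z_{i,j}$, $1\le i,j\le 3$, subject to the relations: $z_{i,j}z_{i,l}=0$ if $j<l$; $z_{i,j}z_{k,j}=0$ if $i<k$; $z_{i,l}z_{k,j}=z_{k,j}z_{i,l}$ if $i<k$, $j<l$; $z_{i,l}z_{k,j}=0$ if $i<k$, $j<l$, $\max\{i,j\}\ge\min\{k,l\}$; $z_{i,j}z_{k,l}=z_{k,l}z_{i,j}$ if $i<k$, $j<l$, $\max\{i,j\}+1<\min\{k,l\}$; $z_{i,j}z_{k,l}-z_{k,l}z_{i,j}=z_{i,l}z_{k,j}$ if $i<k$, $j<l$, $\max\{i,j\}+1=\min\{k,l\}$; $z_{1,1}z_{2,2}z_{3,3}=1$; $z_{1,1}^*=z_{2,2}z_{3,3}$, $z_{2,2}^*=z_{1,1}z_{3,3}$, $z_{3,3}^*=z_{1,1}z_{2,2}$, $z_{2,1}^*=z_{1,2}z_{3,3}$, $z_{3,2}^*=z_{1,1}z_{2,3}$, $z_{3,1}^*=z_{1,2}z_{2,3}$, $z_{1,2}^*=z_{2,1}z_{3,3}$,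 $z_{2,3}^*=z_{1,1}z_{3,2}$, $z_{1,3}^*=z_{2,1}z_{3,2}$; $z_{i,j}^*z_{r,s}=z_{r,s}z_{i,j}^*$ if $i\ne r$, $j\ne s$. **The representations $\psi_{(\lambda,\mu),\omega}$.** Let $\mathbb N=\{0,1,2,\dots\}$ and let $(e_m)_{m\ge0}$ be the standard basis of $\ell^2(\mathbb N)$; let $Se_m=e_{m-1}$ for $m\ge1$, $Se_0=0$, and $Ne_m=me_m$. For $q\in(0,1)$ and $k\in\{1,2\}$ put $$\psi_{s_k}^{(q)}(u_{i,j}(q))=\begin{cases}S\sqrt{I-q^{2N}}& i=j=k,\\ \sqrt{I-q^{2N}}\,S^*& i=j=k+1,\\ -q^{N+1}& i=k,\ j=k+1,\\ q^N& i=k+1,\ j=k,\\ \delta_{i,j}I&\text{otherwise}\end{cases}$$ (here $u_{i,j}(q)$, $1\le i,j\le3$, are the canonical generators of $A_2(q)=C(SU_q(3))$). For a word $\omega=s_{i_1}\cdots s_{i_k}$ set $$\psi_\omega^{(q)}(u_{i,j}(q))=\sum_{m_1,\dots,m_{k-1}=1}^{3}\psi_{s_{i_1}}^{(q)}(u_{i,m_1}(q))\otimes\psi_{s_{i_2}}^{(q)}(u_{m_1,m_2}(q))\otimes\cdots\otimes\psi_{s_{i_k}}^{(q)}(u_{m_{k-1},j}(q))$$ on $\ell^2(\mathbb N)^{\otimes k}$, and $\psi_{\mathrm{id}}^{(q)}(u_{i,j}(q))=\delta_{i,j}$ on $\mathbb C$. For $(\lambda,\mu)\in(S^1)^2$ set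 $\psi_{(\lambda,\mu),\omega}^{(q)}(u_{i,j}(q))=c_i\,\psi_\omega^{(q)}(u_{i,j}(q))$ with $c_1=\lambda$, $c_2=\bar\lambda\mu$, $c_3=\bar\mu$. The norm limits $$\psi_{(\lambda,\mu),\omega}(z_{i,j})=\lim_{q\to0+}(-q)^{\min\{i-j,0\}}\,\psi^{(q)}_{(\lambda,\mu),\omega}(u_{i,j}(q))$$ exist and satisfy the defining relations of $A_2(0)$, and $\psi_{(\lambda,\mu),\omega}$ denotes the resulting representation of $A_2(0)$ on $\ell^2(\mathbb N)^{\otimes\ell(\omega)}$, where $\ell(\omega)$ is the length of $\omega$. *)

(* Defs.v *)
From HB Require Import structures.
From mathcomp Require Import all_boot all_order all_algebra sesquilinear.
From mathcomp Require Import finmap ring lra.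
From mathcomp Require Import boolp classical_sets functions cardinality fsbigop.
From mathcomp Require Import reals ereal topology normedtype esum complex.
Set Implicit Arguments. Unset Strict Implicit. Unset Printing Implicit Defensive.
Import Order.TTheory GRing.Theory Num.Theory.
Import numFieldNormedType.Exports.
Local Open Scope classical_set_scope.
Local Open Scope complex_scope.
Local Open Scope ring_scope.

Section RealSum.
Variables (R : realType) (I : choiceType).
Implicit Types a b p n : I -> R.

(* Sum of an absolutely summable real family (a junk value otherwise). *)
Definition rsum a : R :=
  fine (\esum_(i in setT) (Num.max (a i) 0)%:E) -
  fine (\esum_(i in setT) (Num.max (- a i) 0)%:E).

Definition rsummable a := summable setT (EFin \o a).

Lemma esum_fin_le a b : (forall i, 0 <= a i <= b i) ->
  (\esum_(i in setT) (b i)%:E < +oo)%E ->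
  \esum_(i in setT) (a i)%:E \is a fin_num.
Proof.
move=> ab bfin; rewrite ge0_fin_numE; last first.
  by apply: esum_ge0 => i _; rewrite lee_fin; case/andP: (ab i).
apply: le_lt_trans bfin; apply: le_esum => i _.
by rewrite lee_fin; case/andP: (ab i).
Qed.

Lemma rsummable_le a b : (forall i, `|a i| <= b i) ->
  (\esum_(i in setT) (b i)%:E < +oo)%E -> rsummable a.
Proof.
move=> ab bfin; apply: le_lt_trans bfin.
by apply: le_esum => i _; rewrite /= lee_fin.
Qed.

Lemma rsummable_pos a : rsummable a ->
  \esum_(i in setT) (Num.max (a i) 0)%:E \is a fin_num.
Proof.
move=> sa; apply: (@esum_fin_le _ (fun i => `|a i|)) => // i.
by rewrite le_max lexx orbT ge_max ler_norm normr_ge0.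
Qed.

Lemma rsummable_neg a : rsummable a ->
  \esum_(i in setT) (Num.max (- a i) 0)%:E \is a fin_num.
Proof.
move=> sa; apply: (@esum_fin_le _ (fun i => `|a i|)) => // i.
by rewrite le_max lexx orbT ge_max -normrN ler_norm normr_ge0.
Qed.

Lemma rsum_decomp a p n : rsummable a ->
  (forall i, 0 <= p i) -> (forall i, 0 <= n i) ->
  \esum_(i in setT) (p i)%:E \is a fin_num ->
  \esum_(i in setT) (n i)%:E \is a fin_num ->
  (forall i, a i = p i - n i) ->
  rsum a = fine (\esum_(i in setT) (p i)%:E) - fine (\esum_(i in setT) (n i)%:E).
Proof.
move=> sa p0 n0 fp fn apn.
have fP := rsummable_pos sa; have fN := rsummable_neg sa.
suff : (\esum_(i in setT) (Num.max (a i) 0)%:E + \esum_(i in setT) (n i)%:E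
   = \esum_(i in setT) (p i)%:E + \esum_(i in setT) (Num.max (- a i) 0)%:E)%E.
  move/(congr1 fine); rewrite !fineD// /rsum => E.
  by apply/eqP; rewrite subr_eq addrAC eq_sym subr_eq E.
rewrite -!esumD; try by move=> i _; rewrite lee_fin ?le_max ?lexx ?orbT.
apply: eq_esum => i _; rewrite -!EFinD; congr EFin; rewrite apn.
by rewrite /Num.max; case: ltrP => ?; case: ltrP => ?; lra.
Qed.

Lemma rsummableD a b : rsummable a -> rsummable b ->
  rsummable (fun i => a i + b i).
Proof. by move=> sa sb; apply: (summableD sa sb). Qed.

Lemma rsummableN a : rsummable a -> rsummable (fun i => - a i).
Proof. by move=> sa; rewrite /rsummable (_ : _ \o _ = \- (EFin \o a))%E// -summableN. Qed.

Lemma esumZ a (c : R) : 0 <= c ->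
  (\esum_(i in setT) (c * a i)%:E = c%:E * \esum_(i in setT) (a i)%:E)%E.
Proof.
move=> c0; rewrite /esum -ereal_supZl//; last first.
  by apply/set0P; exists (\sum_(x \in set0) (a x)%:E)%E; exists set0 => //; exact: fsets_set0.
congr ereal_sup; rewrite image_comp; apply: eq_imagel => J [finJ _] /=.
rewrite !fsbig_finite//= !sumEFin -EFinM; congr EFin.
by rewrite mulr_sumr.
Qed.

Lemma rsummableZ a c : rsummable a -> rsummable (fun i => c * a i).
Proof.
move=> sa; apply: (@rsummable_le _ (fun i => `|c| * `|a i|)).
  by move=> i; rewrite normrM.
rewrite esumZ//; rewrite lte_mul_pinfty//.
Qed.

Lemma rsumD a b : rsummable a -> rsummable b ->
  rsum (fun i => a i + b i) = rsum a + rsum b.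
Proof.
move=> sa sb; have [aP bP] := (rsummable_pos sa, rsummable_pos sb).
have [aN bN] := (rsummable_neg sa, rsummable_neg sb).
have mx0 (x : R) : 0 <= Num.max x 0 by rewrite le_max lexx orbT.
have D (x y : I -> R) : (\esum_(i in setT) (Num.max (x i) 0 + Num.max (y i) 0)%:E =
  \esum_(i in setT) (Num.max (x i) 0)%:E + \esum_(i in setT) (Num.max (y i) 0)%:E)%E.
  rewrite -esumD; [by apply: eq_esum => i _; rewrite EFinD | |];
  by move=> i _; rewrite lee_fin.
rewrite (rsum_decomp (p := fun i => Num.max (a i) 0 + Num.max (b i) 0)
  (n := fun i => Num.max (- a i) 0 + Num.max (- b i) 0)).
- by rewrite !D !fineD// /rsum; lra.
- exact: rsummableD.
- by move=> i; rewrite addr_ge0.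
- by move=> i; rewrite addr_ge0.
- by rewrite D fin_numD aP.
- by rewrite D fin_numD aN.
- by move=> i; rewrite /Num.max; case: ltrP => ?; case: ltrP => ?; case: ltrP => ?; case: ltrP => ?; lra.
Qed.

Lemma rsumN a : rsum (fun i => - a i) = - rsum a.
Proof.
rewrite /rsum opprB; congr (_ - fine _).
by apply: eq_esum => i _; rewrite opprK.
Qed.

Lemma rsumZ a c : rsummable a -> rsum (fun i => c * a i) = c * rsum a.
Proof.
move=> sa; wlog c0 : c / 0 <= c.
  move=> W; have [c0|/ltW c0] := leP 0 c; first by apply: W.
  rewrite -[c]opprK (_ : (fun i => _) = (fun i => - (- c * a i))); last first.
    by apply/funext => i; rewrite !mulNr.
  by rewrite rsumN W ?oppr_ge0// !mulNr.
have [aP aN] := (rsummable_pos sa, rsummable_neg sa).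
rewrite (rsum_decomp (p := fun i => c * Num.max (a i) 0)
  (n := fun i => c * Num.max (- a i) 0)).
- by rewrite !esumZ// !fineM// /rsum mulrBr.
- exact: rsummableZ.
- by move=> i; rewrite mulr_ge0// le_max lexx orbT.
- by move=> i; rewrite mulr_ge0// le_max lexx orbT.
- by rewrite esumZ// fin_numM.
- by rewrite esumZ// fin_numM.
- move=> i; rewrite -mulrBr; congr (_ * _).
  by rewrite /Num.max; case: ltrP => ?; case: ltrP => ?; lra.
Qed.

Lemma rsum_ge0E a : (forall i, 0 <= a i) ->
  rsum a = fine (\esum_(i in setT) (a i)%:E).
Proof.
move=> a0; rewrite /rsum [X in _ - fine X]esum1 ?subr0; last first.
  by move=> i _; congr EFin; apply/max_idPr; rewrite oppr_le0.
by congr fine; apply: eq_esum => i _; congr EFin; apply/max_idPl.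
Qed.

End RealSum.

Section ComplexSum.
Variables (R : realType) (I : choiceType).
Local Notation C := R[i].
Implicit Types f g : I -> C.

Definition csum f : C :=
  rsum (fun i => complex.Re (f i)) +i* rsum (fun i => complex.Im (f i)).

Definition csummable f :=
  rsummable (fun i => complex.Re (f i)) /\ rsummable (fun i => complex.Im (f i)).

Lemma csumD f g : csummable f -> csummable g ->
  csum (fun i => f i + g i) = csum f + csum g.
Proof.
case=> f1 f2 [g1 g2]; rewrite /csum -[RHS]/(_ +i* _) -!rsumD//.
by congr Complex; congr rsum; apply/funext => i; case: (f i); case: (g i).
Qed.

Lemma csummableZ c f : csummable f -> csummable (fun i => c * f i).
Proof.
case: c => x y [f1 f2]; split.
  have := rsummableD (rsummableZ x f1) (rsummableZ (- y) f2); congr rsummable.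
  by apply/funext => i; case: (f i) => u v /=; rewrite mulNr.
have := rsummableD (rsummableZ x f2) (rsummableZ y f1); congr rsummable.
by apply/funext => i; case: (f i).
Qed.

Lemma csumZ c f : csummable f -> csum (fun i => c * f i) = c * csum f.
Proof.
case: c => x y [f1 f2]; rewrite /csum -[RHS]/(_ +i* _) -!mulNr -!rsumZ//.
rewrite -!rsumD ?rsumZ//; try exact: rsummableZ.
congr Complex; congr rsum; apply/funext => i; case: (f i) => //= u v.
by rewrite mulNr.
Qed.

Lemma csumJ f : csum (fun i => (f i)^*%C) = (csum f)^*%C.
Proof.
rewrite /csum /= -rsumN.
by congr Complex; congr rsum; apply/funext => i; case: (f i).
Qed.

End ComplexSum.

Section DotNorm.
Variables (C : numClosedFieldType) (U : lmodType C) (form : {dot U for Num.conj}).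
Local Notation "''[' u , v ]" := (form u v).
Local Notation "''[' u ]" := (form u u).

Lemma dot_CauchySchwarz u v : `|'[u, v]| <= sqrtC '[u] * sqrtC '[v].
Proof.
have [->|v0] := eqVneq v 0.
  by rewrite linear0r normr0 mulr_ge0 ?sqrtC_ge0 ?dnorm_ge0.
have vv0 : 0 < '[v] by rewrite dnorm_gt0.
rewrite -(@ler_pXn2r _ 2)// ?nnegrE ?normr_ge0 ?mulr_ge0 ?sqrtC_ge0 ?dnorm_ge0//.
rewrite exprMn !sqrtCK -ler_pdivrMr//.
pose a := '[u, v] / '[v].
have ou : '[u - a *: v, v] = 0.
  by rewrite linearBl/= linearZl_LR/= divfK ?subrr// gt_eqF.
have -> : '[u] = '[u - a *: v] + `|a| ^+ 2 * '[v].
  rewrite -dnormZ -hnormDd ?subrK//.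
  by rewrite linearZr_LR/= ou mulr0.
rewrite normrM normfV (gtr0_norm vv0) exprMn exprVn.
rewrite (_ : _ * '[v] ^- 2 * '[v] = `|'[u, v]| ^+ 2 / '[v]); last first.
  by rewrite expr2 invfM -mulrA mulrVK// unitfE gt_eqF.
by rewrite lerDr dnorm_ge0.
Qed.

Lemma dot_normD u v :
  sqrtC '[u + v] <= sqrtC '[u] + sqrtC '[v].
Proof.
rewrite -(@ler_pXn2r _ 2)// ?nnegrE ?addr_ge0 ?sqrtC_ge0 ?dnorm_ge0//.
rewrite sqrrD !sqrtCK dnormD [leRHS]addrAC lerD2l.
have -> : '[u, v] + ('[u, v])^* = 2 * 'Re '[u, v].
  by rewrite ReE mulrC divfK// pnatr_eq0.
rewrite -[leRHS]mulr_natl ler_pM2l//.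
apply: le_trans (dot_CauchySchwarz u v).
by case: (leif_Re_Creal '[u, v]).
Qed.

Lemma dot_normZ a u : sqrtC '[a *: u] = `|a| * sqrtC '[u].
Proof.
by rewrite dnormZ sqrtCM ?nnegrE ?exprn_ge0 ?dnorm_ge0// sqrCK.
Qed.

Lemma dot_norm_eq0 u : sqrtC '[u] = 0 -> u = 0.
Proof. by move=> /eqP; rewrite sqrtC_eq0 dnorm_eq0 => /eqP. Qed.

End DotNorm.

Section L2.
Variables (R : realType) (I : choiceType).
Local Notation C := R[i].

(* `|x|^2, as an element of R. *)
Definition csq (x : C) : R := complex.Re x ^+ 2 + complex.Im x ^+ 2.

Lemma csq_ge0 x : 0 <= csq x. Proof. by rewrite addr_ge0 ?sqr_ge0. Qed.

Definition sqsummable : {pred I -> C} :=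
  fun f => `[< (\esum_(i in [set: I]) (csq (f i))%:E < +oo)%E >].

Lemma sqsummable_submod : submod_closed sqsummable.
Proof.
split.
  apply/asboolP; rewrite esum1// => i _.
  by rewrite /csq /= expr0n /= addr0.
move=> c f g /asboolP f2 /asboolP g2; apply/asboolP.
apply: (@le_lt_trans _ _ (\esum_(i in [set: I]) ((2 * csq c) * csq (f i) + 2 * csq (g i))%:E)).
  apply: le_esum => i _; rewrite lee_fin fctE /csq.
  rewrite -[(_ *: f) i]/(c * f i).
  case: c (f i) (g i) => [c1 c2] [x1 x2] [y1 y2] /=.
  have := sqr_ge0 (c1 * x1 - c2 * x2 - y1).
  by have := sqr_ge0 (c1 * x2 + c2 * x1 - y2); nra.
rewrite (_ : esum _ _ = (2 * csq c)%:E * (\esum_(i in [set: I]) (csq (f i))%:E)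
  + 2%:E * (\esum_(i in [set: I]) (csq (g i))%:E))%E.
  by rewrite lte_add_pinfty// lte_mul_pinfty// lee_fin ?mulr_ge0 ?csq_ge0.
rewrite -!esumZ ?mulr_ge0 ?csq_ge0// -esumD.
- by apply: eq_esum => i _; rewrite EFinD.
- by move=> i _; rewrite lee_fin !mulr_ge0// csq_ge0.
- by move=> i _; rewrite lee_fin !mulr_ge0// csq_ge0.
Qed.

HB.instance Definition _ :=
  GRing.isSubmodClosed.Build C (I -> C) sqsummable sqsummable_submod.

(* l^2(I). *)
Record l2 := MkL2 { l2_fun :> I -> C; l2_funP : l2_fun \in sqsummable }.
HB.instance Definition _ := [isSub for l2_fun].
HB.instance Definition _ := [Choice of l2 by <:].
HB.instance Definition _ := [SubChoice_isSubLmodule of l2 by <:].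

Lemma l2D (f g : l2) i : (f + g) i = f i + g i. Proof. by []. Qed.
Lemma l2Z (c : C) (f : l2) i : (c *: f) i = c * f i. Proof. by []. Qed.

Lemma l2_sqfin (f : l2) : (\esum_(i in [set: I]) (csq (f i))%:E < +oo)%E.
Proof. by case: f => f fP /=; move/asboolP: fP. Qed.

Lemma l2_sqfin2 (f g : l2) :
  (\esum_(i in [set: I]) (csq (f i) + csq (g i))%:E < +oo)%E.
Proof.
rewrite (_ : esum _ _ = \esum_(i in [set: I]) (csq (f i))%:E
   + \esum_(i in [set: I]) (csq (g i))%:E)%E ?lte_add_pinfty ?l2_sqfin//.
by rewrite -esumD => [|i _|i _]; rewrite ?lee_fin ?csq_ge0.
Qed.

Lemma l2_csummable (f g : l2) : csummable (fun i => f i * (g i)^*%C).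
Proof.
split; apply: rsummable_le (l2_sqfin2 f g) => i;
  rewrite /csq; case: (f i) (g i) => [x1 x2] [y1 y2] /=.
  have := (sqr_ge0 (x1 + y1), sqr_ge0 (x1 - y1)).
  have := (sqr_ge0 (x2 + y2), sqr_ge0 (x2 - y2)).
  by move=> [a1 a2] [a3 a4]; rewrite ler_norml; apply/andP; split; nra.
have := (sqr_ge0 (x1 + y2), sqr_ge0 (x1 - y2)).
have := (sqr_ge0 (x2 + y1), sqr_ge0 (x2 - y1)).
by move=> [a1 a2] [a3 a4]; rewrite ler_norml; apply/andP; split; nra.
Qed.

(* Linear in the first variable. *)
Definition l2_dot (f g : l2) : C := csum (fun i => f i * (g i)^*%C).

Lemma l2_dot_bilinear :
  bilinear_for *%R (Num.conj \; *%R) l2_dot.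
Proof.
have fg := l2_csummable; split=> u c f g.
  rewrite /= /l2_dot -csumZ // -csumD //; last exact: csummableZ.
  by congr csum; apply/funext => i; rewrite l2D l2Z mulrDl mulrA.
rewrite /= /l2_dot -csumZ // -csumD //; last exact: csummableZ.
congr csum; apply/funext => i; rewrite l2D l2Z rmorphD rmorphM mulrDr.
by rewrite mulrCA.
Qed.
HB.instance Definition _ := bilinear_isBilinear.Build C l2 l2 C *%R
  (Num.conj \; *%R) l2_dot l2_dot_bilinear.

Lemma l2_dot_herm (f g : l2) : l2_dot f g = (-1) ^+ false * (l2_dot g f)^*.
Proof.
rewrite expr0 mul1r; apply: etrans (csumJ _).
congr csum; apply/funext => i.
by rewrite rmorphM /= conjcK mulrC.
Qed.
HB.instance Definition _ := isHermitianSesquilinear.Build C l2 false Num.conj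
  l2_dot l2_dot_herm.

Lemma l2_dotE (f : l2) :
  l2_dot f f = (fine (\esum_(i in [set: I]) (csq (f i))%:E))%:C%C.
Proof.
rewrite /l2_dot /csum -rsum_ge0E; last by move=> i; exact: csq_ge0.
congr Complex.
  congr rsum; apply/funext => i; rewrite /csq; case: (f i) => x y /=.
  by rewrite mulrN opprK !expr2.
rewrite rsum_ge0E; last by move=> i; case: (f i) => x y /=; lra.
rewrite esum1// => i _; congr EFin; case: (f i) => x y /=; lra.
Qed.

Lemma l2_sum_le (f : l2) (J : set I) : finite_set J ->
  \sum_(i \in J) csq (f i) <= fine (\esum_(i in [set: I]) (csq (f i))%:E).
Proof.
move=> finJ; rewrite -lee_fin fineK; last first.
  rewrite ge0_fin_numE ?l2_sqfin//.
  by apply: esum_ge0 => i _; rewrite lee_fin csq_ge0.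
apply: esum_ge; exists J => //.
by rewrite !fsbig_finite//= sumEFin.
Qed.

Lemma l2_coord_le (f : l2) i :
  csq (f i) <= fine (\esum_(i in [set: I]) (csq (f i))%:E).
Proof.
by have := @l2_sum_le f [set i] (finite_set1 i); rewrite fsbig_set1.
Qed.

Lemma l2_dot_def (f : l2) : f != 0 -> 0 < l2_dot f f.
Proof.
move=> f0; rewrite l2_dotE ltcR lt_neqAle fine_ge0; last first.
  by apply: esum_ge0 => i _; rewrite lee_fin csq_ge0.
rewrite andbT eq_sym; apply: contra f0 => /eqP sf0.
apply/eqP/val_inj/funext => i /=.
have := l2_coord_le f i; rewrite sf0 /csq; case: (f i) => x y /= xy.
by congr Complex; nra.
Qed.
HB.instance Definition _ := isDotProduct.Build C l2 l2_dot l2_dot_def.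

Definition l2_norm (f : l2) : C := sqrtC (l2_dot f f).

HB.instance Definition _ := Lmodule_isNormed.Build C l2
  (@dot_normD C l2 l2_dot) (@dot_normZ C l2 l2_dot) (@dot_norm_eq0 C l2 l2_dot).

Definition l2_sq (f : l2) : R := fine (\esum_(i in [set: I]) (csq (f i))%:E).

Lemma l2_normE (f : l2) : `|f| ^+ 2 = (l2_sq f)%:C%C :> C.
Proof. by rewrite -l2_dotE -[RHS]sqrtCK. Qed.

Lemma l2_norm_le (f : l2) (e : R) : 0 <= e ->
  (`|f| <= e%:C%C :> C) = (l2_sq f <= e ^+ 2).
Proof.
move=> e0; rewrite -(@ler_pXn2r _ 2)// ?nnegrE ?normr_ge0 ?ler0c//.
by rewrite l2_normE -rmorphXn lecR.
Qed.

Lemma l2_complete (F : set_system l2) : ProperFilter F -> cauchy F -> cvg F.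
Proof.
move=> FF /(cauchyP _) Fc.
have ballF (e : R) : 0 < e ->
    exists f0 : l2, F [set h : l2 | l2_sq (f0 - h) <= e ^+ 2].
  move=> e0; have [|f0 Ff0] := Fc e%:C%C; first by rewrite ltcR.
  exists f0; apply: filterS Ff0 => h; rewrite -ball_normE /= => /ltW.
  by rewrite l2_norm_le// ltW.
have sq_ge (f : l2) i : csq (f i) <= l2_sq f by exact: l2_coord_le.
have coord (p : C -> R) : (forall x y, p (x - y) = p x - p y) ->
    (forall x, p x ^+ 2 <= csq x) ->
    forall i, cvg ((fun h : l2 => p (h i)) @ F).
  move=> pB psq i; apply: R_complete; apply/cauchyP => e e0.
  have [f0 Ff0] := ballF (e / 2) ltac:(by rewrite divr_gt0).
  exists (p (f0 i)); apply: (@filterS _ F _ _ _ _ Ff0) => h hf.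
  rewrite /= -ball_normE /= -pB.
  apply: (@le_lt_trans _ _ (e / 2)); last by rewrite ltr_pdivrMr// ltr_pMr// ltr1n.
  rewrite -(@ler_pXn2r _ 2)// ?nnegrE ?divr_ge0 ?(ltW e0)//.
  rewrite real_normK ?num_real//; apply: le_trans (psq _) _.
  by apply: le_trans (sq_ge (f0 - h) i) _.
have Rcvg i : cvg ((fun h : l2 => complex.Re (h i)) @ F).
  apply: (coord (@complex.Re R)) => [[a b] [c d]//|x].
  by rewrite /csq lerDl sqr_ge0.
have Icvg i : cvg ((fun h : l2 => complex.Im (h i)) @ F).
  apply: (coord (@complex.Im R)) => [[a b] [c d]//|x].
  by rewrite /csq lerDr sqr_ge0.
pose g i : C := lim ((fun h : l2 => complex.Re (h i)) @ F) +i*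
                lim ((fun h : l2 => complex.Im (h i)) @ F).
have partial (f0 : l2) (e : R) : F [set h : l2 | l2_sq (f0 - h) <= e ^+ 2] ->
    (\esum_(i in [set: I]) (csq (f0 i - g i))%:E <= (e ^+ 2)%:E)%E.
  move=> Ff0; apply: ge_ereal_sup => _ [J [finJ _] <-].
  rewrite fsbig_finite//= sumEFin lee_fin.
  have c_cvg : (fun h : l2 => \sum_(i <- fset_set J) csq (f0 i - h i)) @ F -->
      \sum_(i <- fset_set J) csq (f0 i - g i).
    apply: (cvg_big (fun x => add_continuous x)) => i _.
    have E (z w : C) : csq (z - w) = (complex.Re z - complex.Re w) ^+ 2 +
        (complex.Im z - complex.Im w) ^+ 2 by case: z w => [? ?] [? ?].
    under eq_fun do rewrite E.
    rewrite E; apply: cvgD; rewrite expr2; under eq_fun do rewrite expr2.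
      by apply: cvgM; apply: cvgB; [exact: cvg_cst| exact: Rcvg
        |exact: cvg_cst| exact: Rcvg].
    by apply: cvgM; apply: cvgB; [exact: cvg_cst| exact: Icvg
      |exact: cvg_cst| exact: Icvg].
  apply: (closed_cvg _ (@closed_le _ (e ^+ 2))) c_cvg.
  apply: filterS Ff0 => h; apply: le_trans.
  by have := @l2_sum_le (f0 - h) J finJ; rewrite fsbig_finite.
have gP : g \in sqsummable.
  have [f0 Ff0] := ballF 1 ltr01; have := partial _ _ Ff0 => fg.
  have : (fun i => f0 i - g i) \in sqsummable.
    by apply/asboolP; apply: le_lt_trans fg _; rewrite ltry.
  move=> fgP; rewrite (_ : g = (f0 : I -> C) - (fun i => f0 i - g i)).
    by rewrite rpredB// l2_funP.
  by apply/funext => i; rewrite fctE subKr.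
apply/cvg_ex; exists (MkL2 gP); apply/cvgrPdist_le => e e0.
have eE : e = (complex.Re e)%:C%C 
  by move: e0; rewrite ltcE; case: (e) => x y /= /andP[/eqP ->].
have re0 : 0 < complex.Re e by rewrite -ltcR -eE.
have [|f0 Ff0] := ballF (complex.Re e / 2); first by rewrite divr_gt0.
have f0g : `|f0 - MkL2 gP| <= (complex.Re e / 2)%:C%C :> C.
  rewrite l2_norm_le ?divr_ge0 ?(ltW re0)//.
  have := partial _ _ Ff0; rewrite -lee_fin /l2_sq fineK//.
  rewrite ge0_fin_numE ?l2_sqfin//.
  by apply: esum_ge0 => i _; rewrite lee_fin csq_ge0.
near=> h.
rewrite -(subrKA f0) (le_trans (ler_normD _ _))// distrC.
rewrite eE [leRHS](_ : _ = (complex.Re e / 2)%:C%C + (complex.Re e / 2)%:C%C); last first.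
  by rewrite -rmorphD -splitr.
rewrite lerD// l2_norm_le ?divr_ge0 ?(ltW re0)//.
by near: h.
Unshelve. all: by end_near.
Qed.
HB.instance Definition _ := Uniform_isComplete.Build l2 l2_complete.

End L2.

Record hilbertSpace (R : realType) := HilbertSpace {
  hcarrier :> completeNormedModType R[i];
  hdot : {dot hcarrier for Num.conj};
  hnormE : forall x, `|x| ^+ 2 = hdot x x }.

Lemma l2_norm_dot (R : realType) (I : choiceType) (f : l2 R I) :
  `|f| ^+ 2 = l2_dot f f.
Proof. exact: sqrtCK. Qed.

(* With I = N^k this is l^2(N)^{(x)k}: the basis vector
   e_{m_1} (x) ... (x) e_{m_k} is the indicator of the tuple (m_1, ..., m_k). *)
Definition ell2 (R : realType) (I : choiceType) : hilbertSpace R :=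
  HilbertSpace (@l2_norm_dot R I).

Record cstarAlgebra (R : realType) := CstarAlgebra {
  ca_carrier :> completeNormedModType R[i];
  ca_mul : {bilinear ca_carrier -> ca_carrier -> ca_carrier};
  ca_one : ca_carrier;
  ca_star : ca_carrier -> ca_carrier;
  ca_mulA : associative ca_mul;
  ca_mul1l : left_id ca_one ca_mul;
  ca_mul1r : right_id ca_one ca_mul;
  ca_starP : forall (c : R[i]) x y,
    ca_star (c *: x + y) = Num.conj c *: ca_star x + ca_star y;
  ca_starM : forall x y, ca_star (ca_mul x y) = ca_mul (ca_star y) (ca_star x);
  ca_starK : involutive ca_star;
  ca_normM : forall x y, `|ca_mul x y| <= `|x| * `|y|;
  ca_normC : forall x, `|ca_mul (ca_star x) x| = `|x| ^+ 2 }.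

Declare Scope cstar_scope.
Delimit Scope cstar_scope with cstar.
Notation "x ** y" := (ca_mul _ x y)
  (at level 40, left associativity) : cstar_scope.
Notation "1" := (ca_one _) : cstar_scope.
(* The involution; ^* is taken by complex conjugation. *)
Notation "x ^#" := (ca_star x) (at level 2, format "x ^#") : cstar_scope.

Record star_hom (R : realType) (A B : cstarAlgebra R) (phi : {linear A -> B}) :
    Prop := {
  star_hom1 : phi 1%cstar = 1%cstar;
  star_homM : forall x y, phi (x ** y)%cstar = (phi x ** phi y)%cstar;
  star_hom_star : forall x, phi (x^#)%cstar = ((phi x)^#)%cstar }.

Definition generates (R : realType) (A : cstarAlgebra R) (X : set A) : Prop :=
  forall D : set A, closed D -> X `<=` D -> D 1%cstar ->
    (forall (c : R[i]) x y, D x -> D y -> D (c *: x + y)) ->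
    (forall x y, D x -> D y -> D (x ** y)%cstar) ->
    (forall x, D x -> D (x^#)%cstar) ->
  D = setT.

(* Throughout, the indices 1, 2, 3 of the generators are the elements o1, o2, o3
   of 'I_3, whose values are 0, 1, 2; all side conditions of the relations are
   invariant under this shift. *)
Definition o1 : 'I_3 := @Ordinal 3 0 isT.
Definition o2 : 'I_3 := @Ordinal 3 1 isT.
Definition o3 : 'I_3 := @Ordinal 3 2 isT.

Local Open Scope cstar_scope.

Record A2_0_relations (R : realType) (A : cstarAlgebra R)
    (z : 'I_3 -> 'I_3 -> A) : Prop := {
  rel_row : forall i j l : 'I_3, (j < l)%N -> z i j ** z i l = 0%R;
  rel_col : forall i j k : 'I_3, (i < k)%N -> z i j ** z k j = 0%R;
  rel_anti : forall i j k l : 'I_3, (i < k)%N -> (j < l)%N ->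
    z i l ** z k j = z k j ** z i l;
  rel_anti0 : forall i j k l : 'I_3, (i < k)%N -> (j < l)%N ->
    (maxn i j >= minn k l)%N -> z i l ** z k j = 0%R;
  rel_diag : forall i j k l : 'I_3, (i < k)%N -> (j < l)%N ->
    ((maxn i j).+1 < minn k l)%N -> z i j ** z k l = z k l ** z i j;
  rel_diag1 : forall i j k l : 'I_3, (i < k)%N -> (j < l)%N ->
    (maxn i j).+1 = minn k l ->
    (z i j ** z k l - z k l ** z i j)%R = z i l ** z k j;
  rel_det : z o1 o1 ** z o2 o2 ** z o3 o3 = 1;
  rel_star11 : (z o1 o1)^# = z o2 o2 ** z o3 o3;
  rel_star22 : (z o2 o2)^# = z o1 o1 ** z o3 o3;
  rel_star33 : (z o3 o3)^# = z o1 o1 ** z o2 o2;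
  rel_star21 : (z o2 o1)^# = z o1 o2 ** z o3 o3;
  rel_star32 : (z o3 o2)^# = z o1 o1 ** z o2 o3;
  rel_star31 : (z o3 o1)^# = z o1 o2 ** z o2 o3;
  rel_star12 : (z o1 o2)^# = z o2 o1 ** z o3 o3;
  rel_star23 : (z o2 o3)^# = z o1 o1 ** z o3 o2;
  rel_star13 : (z o1 o3)^# = z o2 o1 ** z o3 o2;
  rel_star_comm : forall i j r s : 'I_3, i != r -> j != s ->
    (z i j)^# ** z r s = z r s ** (z i j)^# }.

(* (A, z) is the universal unital C^*-algebra on these generators and relations;
   this determines (A, z) up to isomorphism.  The homomorphism in the universal
   property is unique because A is generated by the z i j. *)
Record is_A2_0 (R : realType) (A : cstarAlgebra R) (z : 'I_3 -> 'I_3 -> A) :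
    Prop := {
  A2_0_rel : A2_0_relations z;
  A2_0_gen : generates [set x | exists i j, x = z i j];
  A2_0_univ : forall (B : cstarAlgebra R) (w : 'I_3 -> 'I_3 -> B),
    A2_0_relations w ->
    exists phi : {linear A -> B}, star_hom phi /\ forall i j, phi (z i j) = w i j }.

(* Representations of a unital C^*-algebra are unital.  Each pi a is required to
   be bounded; continuity in a is not assumed. *)
Record is_representation (R : realType) (A : cstarAlgebra R)
    (H : hilbertSpace R) (pi : A -> {linear H -> H}) : Prop := {
  rep_bounded : forall a, continuous (pi a);
  rep_linear : forall (c : R[i]) a b x,
    pi (c *: a + b)%R x = (c *: pi a x + pi b x)%R;
  rep1 : forall x, pi 1 x = x;
  repM : forall a b x, pi (a ** b) x = pi a (pi b x);
  rep_star : forall a x y, hdot H (pi (a^#) x) y = hdot H x (pi a y) }.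

Local Close Scope cstar_scope.

Definition irreducible (R : realType) (A : cstarAlgebra R)
    (H : hilbertSpace R) (pi : A -> {linear H -> H}) : Prop :=
  (exists x : H, x != 0) /\
  forall K : set H, closed K -> K 0 ->
    (forall (c : R[i]) x y, K x -> K y -> K (c *: x + y)) ->
    (forall a x, K x -> K (pi a x)) ->
  K = [set 0] \/ K = setT.

Definition unitarily_equivalent (R : realType) (A : cstarAlgebra R)
    (H K : hilbertSpace R) (pi : A -> {linear H -> H})
    (rho : A -> {linear K -> K}) : Prop :=
  exists U : {linear H -> K},
    [/\ forall y, exists x, U x = y,
        forall x y, hdot K (U x) (U y) = hdot H x y &
        forall a x, U (pi a x) = rho a (U x)].

Section Psi.
Variable R : realType.
Local Notation C := R[i].

(* Operators on l^2(N^k) are given by formulas on coordinate functions N^k -> C,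
   which make sense on all functions; is_psi_q below requires them to define
   bounded operators on l^2(N^k).  In coordinates, S is uni_shift, S^* is uni_shift_adj
   and a(N), for a : nat -> R, is diag a. *)
Definition uni_shift (f : nat -> C) : nat -> C := fun m => f m.+1.

Definition uni_shift_adj (f : nat -> C) : nat -> C :=
  fun m => if m is p.+1 then f p else 0.

Definition diag (a : nat -> R) (f : nat -> C) : nat -> C :=
  fun m => (a m)%:C%C * f m.

(* psi_letter q k is psi_{s_{k+1}}^{(q)}, consistently with the shift of the
   matrix indices. *)
Definition psi_letter (q : R) (k : 'I_2) (i j : 'I_3) (f : nat -> C) :
    nat -> C :=
  let sqN := fun m : nat => Num.sqrt (1 - q ^+ (2 * m)) in
  if (i == k :> nat) && (j == k :> nat) then uni_shift (diag sqN f)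
  else if (i == k.+1 :> nat) && (j == k.+1 :> nat) then diag sqN (uni_shift_adj f)
  else if (i == k :> nat) && (j == k.+1 :> nat) then
    diag (fun m => - q ^+ m.+1) f
  else if (i == k.+1 :> nat) && (j == k :> nat) then diag (fun m => q ^+ m) f
  else if i == j then f else fun=> 0.

(* (T (x) T') f, where T acts on the first variable and T' on the others. *)
Definition tensor n (T : (nat -> C) -> nat -> C)
    (T' : (n.-tuple nat -> C) -> n.-tuple nat -> C)
    (f : n.+1.-tuple nat -> C) : n.+1.-tuple nat -> C :=
  fun m => T (fun a => T' (fun t => f [tuple of a :: t]) [tuple of behead m])
             (thead m).

(* psi_w^{(q)}(u_ij).  The sum over m_1, ..., m_{k-1} is organised recursively:
     psi_{s_k w'}(u_ij) = sum_l psi_{s_k}(u_il) (x) psi_{w'}(u_lj),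
   starting from the empty word, which acts on C = l^2(N^0) by delta_ij. *)
Fixpoint psi_word (q : R) (w : seq 'I_2) (i j : 'I_3) :
    ((size w).-tuple nat -> C) -> (size w).-tuple nat -> C :=
  match w with
  | [::] => fun f m => (i == j)%:R * f m
  | k :: w' => fun f m =>
      \sum_(l < 3) tensor (psi_letter q k i l) (@psi_word q w' l j) f m
  end.
#[global] Arguments psi_word : clear implicits.

Definition phase (lambda mu : C) (i : 'I_3) : C :=
  nth 0 [:: lambda; Num.conj lambda * mu; Num.conj mu] i.

Definition ell2N (k : nat) : hilbertSpace R :=
  ell2 R (k.-tuple nat : choiceType).

Definition is_psi_q (q : R) (lambda mu : C) (w : seq 'I_2)
    (u : 'I_3 -> 'I_3 -> {linear ell2N (size w) -> ell2N (size w)}) : Prop :=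
  forall i j, continuous (u i j) /\
    forall (f : ell2N (size w)) m,
      (u i j f : l2 _ _) m =
      phase lambda mu i * psi_word q w i j (f : l2 _ _) m.

(* T q --> L in operator norm as q --> 0+. *)
Definition norm_limit0 (H : hilbertSpace R) (T : R -> H -> H) (L : H -> H) :
    Prop :=
  forall e : R, 0 < e ->
    \forall q \near 0^'+, forall x, `|T q x - L x| <= e%:C%C * `|x|.

(* psi is the representation psi_{(lambda, mu), w} of A_2(0); it is unique, since
   its values on the generators of A are prescribed. *)
Definition is_psi (A : cstarAlgebra R) (z : 'I_3 -> 'I_3 -> A)
    (lambda mu : C) (w : seq 'I_2)
    (psi : A -> {linear ell2N (size w) -> ell2N (size w)}) : Prop :=
  is_representation psi /\
  exists2 u : R -> 'I_3 -> 'I_3 -> {linear ell2N (size w) -> ell2N (size w)},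
    forall q, 0 < q < 1 -> is_psi_q q lambda mu (u q) &
    forall i j : 'I_3, norm_limit0
      (fun q f => ((- q) ^ Num.min (i%:Z - j%:Z) 0)%:C%C *: u q i j f)
      (psi (z i j)).

End Psi.

(* The letters s_1 = (1,2) and s_2 = (2,3) of words in S_3. *)
Definition s1 : 'I_2 := @Ordinal 2 0 isT.
Definition s2 : 'I_2 := @Ordinal 2 1 isT.

(* Main.v *)
From HB Require Import structures.
From mathcomp Require Import all_boot all_order all_algebra sesquilinear.
From mathcomp Require Import finmap zify ring lra.
From mathcomp Require Import boolp classical_sets functions cardinality fsbigop.
From mathcomp Require Import reals ereal topology normedtype sequences esum complex.
Require Import Defs.
Set Implicit Arguments. Unset Strict Implicit. Unset Printing Implicit Defensive.
Import Order.TTheory GRing.Theory Num.Theory.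
Import numFieldNormedType.Exports.
Local Open Scope classical_set_scope.
Local Open Scope complex_scope.
Local Open Scope ring_scope.

(** Write V, X, Y, W for the images of z33, z23, z32 and of the adjoint of z11.
   The relations make V and W isometries, and show that X and Y vanish on the
   range of V and act on G = ker V^* as isometries that commute with each other
   and with each other's adjoints.  On G all generators are expressed through X,
   Y, z13, z31 and adjoints ([W_G], [z11_G], [z12_G], [z21_G]), and z13, z31 are
   normal there with supports 1 - X X^* and 1 - Y Y^* ([z13z13s], [z31z31s]).
   Hence the whole action on a vector V^b X^a Y^c x, with x in G, is known once
   the action of X^*, Y^*, z13, z31 and of the adjoints of the last two on x is.

   Which of the six words occurs depends on the vacuum vectors that exist.  If V
   is not unitary, G is nonzero and one looks for x in G killed by X^* and Y^*
   (word s1 s2 s1), else by X^* (s1 s2), else by Y^* (s2 s1); if there is none of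
   these, X and Y are unitary on G (s2).  If V is unitary, then X, Y, z13, z31
   vanish and one looks for x killed by z11 (s1), or else W is unitary too (id).
   In each case two generators act on the vacuum space H0 as commuting unitaries.
   They are scalars there, by a Schur lemma ([corner_eigen]): a spectral subspace
   L of H0 generates an invariant subspace of H that meets H0 only in L.  The two
   scalars determine lambda and mu.

   The relations are homogeneous in each row, so rescaling the rows reduces the
   computation to lambda = mu = 1 ([oprel_gauge]).  Then the words applied to a
   unit vacuum vector form an orthonormal family, total by irreducibility, on which
   the generators act by the coordinate formulas of the limit representation
   ([word_model]).  By Riesz-Fischer ([onb_unitary]) the basis gives a unitary U
   onto l^2(N^k), and psi is defined as U pi U^-1; that its values on the
   generators are the required limits as q tends to 0 is [word_operators].

   Two points need the norm of the C*-algebra.  Continuity of a representation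
   and the positive and negative parts used in the Schur lemma both come from
   square roots of 1 - a for self-adjoint a of norm at most 1, obtained in
   [sqrt_exists] by the iteration b |-> (a + b^2) / 2. *)

(** * Complex normed spaces *)

Section ComplexNormed.
Variable R : realType.
Local Notation C := R[i].

Lemma posC_real (e : C) : 0 < e -> exists2 r : R, 0 < r & e = r%:C%C.
Proof.
case: e => a b; rewrite ltcE /= => /andP[/eqP -> a0].
by exists a.
Qed.

Lemma nnegC_real (e : C) : 0 <= e -> exists2 r : R, 0 <= r & e = r%:C%C.
Proof.
case: e => a b; rewrite lecE /= => /andP[/eqP -> a0].
by exists a.
Qed.

Lemma cauchy_seq_cvg (E : completeNormedModType C) (u : nat -> E) :
  (forall e : R, 0 < e -> exists N, forall n m, (N <= n)%N -> (N <= m)%N ->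
    `|u n - u m| <= e%:C%C) -> cvg (u @ \oo).
Proof.
move=> uC; apply: cauchy_cvg; apply/cauchyP => e /posC_real[r r0 ->].
have [|N uN] := uC (r / 2); first by rewrite divr_gt0.
exists (u N); exists N => // n /= Nn.
rewrite -ball_normE /=; apply: le_lt_trans (uN N n _ Nn) _ => //.
by rewrite ltcR ltr_pdivrMr// ltr_pMr// ltr1n.
Qed.

Lemma lipschitz_cont (E F : normedModType C) (f : E -> F) (M : C) : 0 <= M ->
  (forall x y, `|f x - f y| <= M * `|x - y|) -> continuous f.
Proof.
move=> M0 fM x; apply/cvgrPdist_le => e e0.
have M1 : 0 < M + 1 by rewrite ltr_wpDl.
near=> y; apply: le_trans (fM _ _) _.
have /le_trans -> // : M * `|x - y| <= (M + 1) * `|x - y|.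
  by rewrite ler_wpM2r// lerDl.
rewrite mulrC -ler_pdivlMr//.
near: y; apply: cvgr_dist_le; [exact: cvg_id | exact: divr_gt0].
Unshelve. all: by end_near.
Qed.

Lemma closed_eq_cont (T : topologicalType) (E : normedModType C) (f g : T -> E) :
  continuous f -> continuous g -> closed [set x | f x = g x].
Proof.
move=> fc gc; rewrite (_ : [set x | _] = (fun x => f x - g x) @^-1` [set 0]).
  apply: closed_comp => [x _|]; first by apply: continuousB; [exact: fc|exact: gc].
  exact/accessible_closed_set1/hausdorff_accessible/norm_hausdorff.
by apply/seteqP; split=> x /= => [->|/eqP]; rewrite ?subrr// subr_eq0 => /eqP.
Qed.

Lemma closed_unit_ball (E : normedModType C) : closed [set x : E | `|x| <= 1].
Proof.
move=> x /= xB; have [//|x1] := real_leP (normr_real x) (real1 _).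
have e0 : 0 < `|x| - 1 by rewrite subr_gt0.
have [y [/= y1]] := xB _ (nbhsx_ballx x _ e0); rewrite -ball_normE /= ltrBrDr => xy.
by have := le_lt_trans (ler_normD (x - y) y) (le_lt_trans (lerD (lexx _) y1) xy); rewrite subrK ltxx.
Qed.

End ComplexNormed.

(** * Square roots in a C*-algebra *)

Section SquareRoot.
Variables (R : realType) (A : cstarAlgebra R).
Local Notation C := R[i].
Local Open Scope cstar_scope.
Implicit Types a b x y : A.

Lemma camDl x y a : (x + y)%R ** a = (x ** a + y ** a)%R.
Proof. exact: linearDl. Qed.
Lemma camDr x y a : a ** (x + y)%R = (a ** x + a ** y)%R.
Proof. exact: linearDr. Qed.
Lemma camBl x y a : (x - y)%R ** a = (x ** a - y ** a)%R.
Proof. exact: linearBl. Qed.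
Lemma camBr x y a : a ** (x - y)%R = (a ** x - a ** y)%R.
Proof. exact: linearBr. Qed.
Lemma camZl (c : C) x a : (c *: x)%R ** a = (c *: (x ** a))%R.
Proof. exact: linearZl_LR. Qed.
Lemma camZr (c : C) x a : a ** (c *: x)%R = (c *: (a ** x))%R.
Proof. exact: linearZr_LR. Qed.
Lemma cam0l a : (0%R : A) ** a = 0%R.
Proof. exact: linear0l. Qed.

Lemma castarD x y : (x + y)%R^# = (x^# + y^#)%R.
Proof. by have := ca_starP 1%R x y; rewrite rmorph1 !scale1r. Qed.
Lemma castar0 : (0%R : A)^# = 0%R.
Proof.
by have := castarD (0%R : A) 0%R; rewrite addr0 => /eqP; rewrite -subr_eq0 opprD addNKr oppr_eq0 => /eqP.
Qed.
Lemma castarZ (c : C) x : (c *: x)%R^# = (Num.conj c *: x^#)%R.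
Proof. by have := ca_starP c x 0%R; rewrite castar0 !addr0. Qed.
Lemma castarN x : (- x)%R^# = (- x^#)%R.
Proof. by rewrite -scaleN1r castarZ rmorphN1 scaleN1r. Qed.
Lemma castarB x y : (x - y)%R^# = (x^# - y^#)%R.
Proof. by rewrite castarD castarN. Qed.
Lemma castar1 : (ca_one A)^# = 1.
Proof.
have := ca_starM (ca_one A)^# (ca_one A).
by rewrite ca_mul1r ca_starK ca_mul1r => /esym.
Qed.

(** The C*-identity gives [|y|^2 <= |y^#| |y|]; apply this to [x] and [x^#]. *)
Lemma castar_norm x : `|x^#| = `|x|.
Proof.
have le y : `|y| <= `|y^#|.
  have [->|y0] := eqVneq `|y| 0%R; first exact: normr_ge0.
  have yp : (0 < `|y|)%R by rewrite lt0r y0 /=.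
  by rewrite -(ler_pM2r yp) -expr2 -ca_normC ca_normM.
by apply/eqP; rewrite eq_le le andbT -{2}[x]ca_starK le.
Qed.

Lemma castar_cont : continuous (@ca_star R A).
Proof.
by apply: (@lipschitz_cont _ _ _ _ 1%R) => // x y; rewrite mul1r -castarB castar_norm.
Qed.

Lemma caml_cont a : continuous (fun x => a ** x).
Proof.
by apply: (@lipschitz_cont _ _ _ _ `|a|) => // x y; rewrite -camBr ca_normM.
Qed.
Lemma camr_cont a : continuous (fun x => x ** a).
Proof.
by apply: (@lipschitz_cont _ _ _ _ `|a|) => // x y; rewrite -camBl mulrC ca_normM.
Qed.

(** Functional calculus is tracked through these subalgebras: a limit of
   polynomials in [a] lies in each of them that contains [a]. *)
Record closed_subalg (D : set A) : Prop := {
  csub_closed : closed D;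
  csub1 : D 1;
  csubP : forall (c : C) x y, D x -> D y -> D (c *: x + y)%R;
  csubM : forall x y, D x -> D y -> D (x ** y) }.

Lemma csub0 (D : set A) : closed_subalg D -> D 0%R.
Proof. by move=> DS; have := csubP DS (-1) (csub1 DS) (csub1 DS); rewrite scaleN1r addNr. Qed.
Lemma csubZ (D : set A) (c : C) x : closed_subalg D -> D x -> D (c *: x)%R.
Proof. by move=> DS Dx; have := csubP DS c Dx (csub0 DS); rewrite addr0. Qed.
Lemma csubB (D : set A) x y : closed_subalg D -> D x -> D y -> D (x - y)%R.
Proof. by move=> DS Dx Dy; have := csubP DS (-1) Dy Dx; rewrite scaleN1r addrC. Qed.

(** The same recursion in the reals with [a = 1]: its increments dominate those of
   [sqrt_iter], and it converges because it is monotone and bounded. *)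
Fixpoint sqrt_bound (n : nat) : R :=
  if n is m.+1 then ((1 + sqrt_bound m ^+ 2) / 2)%R else 0%R.

Fixpoint sqrt_iter a (n : nat) : A :=
  if n is m.+1 then
    (2^-1 *: (a + sqrt_iter a m ** sqrt_iter a m))%R else 0%R.

Lemma sqrt_bound01 n : (0 <= sqrt_bound n <= 1)%R.
Proof. elim: n => [|n /andP[h0 h1]] /=; nra. Qed.

Lemma sqrt_boundS n : (sqrt_bound n <= sqrt_bound n.+1)%R.
Proof. have := sqrt_bound01 n => /andP[h0 h1] /=; nra. Qed.

Lemma sqrt_bound_mono m n : (m <= n)%N -> (sqrt_bound m <= sqrt_bound n)%R.
Proof.
move=> mn; rewrite -(subnK mn); elim: (n - m)%N => // k IH.
by rewrite addSn (le_trans IH)// sqrt_boundS.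
Qed.

Lemma sqrt_bound_cauchy (e : R) : (0 < e)%R -> exists N, forall n m,
  (N <= n)%N -> (n <= m)%N -> (sqrt_bound m - sqrt_bound n <= e)%R.
Proof.
move=> e0; have cv : sqrt_bound @ \oo --> sup (range sqrt_bound).
  apply: nondecreasing_cvgn; first exact: sqrt_bound_mono.
  by exists 1%R => _ [n _ <-]; have /andP[] := sqrt_bound01 n.
have /cvgrPdist_le/(_ _ e0)[N _ hN] := cv.
have ub n : (sqrt_bound n <= sup (range sqrt_bound))%R.
  apply: ub_le_sup; last by exists n.
  by exists 1%R => _ [k _ <-]; have /andP[] := sqrt_bound01 k.
exists N => n m Nn nm; have /= := hN n Nn; rewrite ger0_norm ?subr_ge0 ?ub//.
have := ub m; lra.
Qed.

Lemma half_norm x : `|(2^-1 *: x)%R| = (2^-1 * `|x|)%R :> C.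
Proof. by rewrite normrZ gtr0_norm// invr_gt0 ltr0n. Qed.

Lemma sqrt_bound_C n : ((sqrt_bound n.+1)%:C%C =
  2^-1 * (1 + (sqrt_bound n)%:C%C ^+ 2))%R.
Proof. by rewrite /= rmorphM rmorphD rmorphXn rmorph1 fmorphV rmorph_nat mulrC. Qed.

Section Iteration.
Variable a : A.
Hypothesis a1 : `|a| <= (1%R : C).

Lemma sqrt_iter_norm n : `|sqrt_iter a n| <= (sqrt_bound n)%:C%C :> C.
Proof.
elim: n => [|n IH]; first by rewrite normr0.
rewrite sqrt_bound_C /= half_norm ler_wpM2l ?invr_ge0//.
rewrite (le_trans (ler_normD _ _))// lerD// (le_trans (ca_normM _ _))//.
by rewrite expr2 ler_pM.
Qed.

(** [u^2 - v^2 = u (u - v) + (u - v) v] holds without commutativity. *)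
Lemma sqrt_iter_step n : `|sqrt_iter a n.+1 - sqrt_iter a n| <=
  (sqrt_bound n.+1 - sqrt_bound n)%:C%C :> C.
Proof.
elim: n => [|n IH].
  rewrite [X in X%:C%C](_ : _ = 2^-1)%R; last by rewrite /=; lra.
  rewrite /= subr0 cam0l addr0 half_norm fmorphV rmorph_nat.
  by rewrite ler_piMr ?invr_ge0.
have -> : ((sqrt_bound n.+2 - sqrt_bound n.+1)%:C%C = 2^-1 * (1 + (sqrt_bound n.+1)%:C%C ^+ 2)
  - 2^-1 * (1 + (sqrt_bound n)%:C%C ^+ 2))%R.
  by rewrite -!sqrt_bound_C -rmorphB.
rewrite [sqrt_iter a n.+2]/= -/(sqrt_iter a n.+1) [X in (_ - X)%R]/= -/(sqrt_iter a n).
set u := sqrt_iter a n.+1 in IH *; set v := sqrt_iter a n in IH *.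
have -> : (2^-1 *: (a + u ** u) - 2^-1 *: (a + v ** v) =
   2^-1 *: (u ** (u - v) + (u - v) ** v) :> A)%R.
  by rewrite -scalerBr camBr camBl addrA subrK opprD addrACA subrr add0r.
rewrite half_norm -mulrBr ler_wpM2l ?invr_ge0//.
rewrite opprD addrACA subrr add0r subr_sqr mulrC mulrDl.
have un := sqrt_iter_norm n.+1; have vn := sqrt_iter_norm n.
rewrite -/u -/v in un vn; rewrite rmorphB in IH.
rewrite (le_trans (ler_normD _ _))// lerD// (le_trans (ca_normM _ _))//.
  by rewrite ler_pM.
by rewrite mulrC ler_pM.
Qed.

Lemma sqrt_iter_dist n m : (n <= m)%N -> `|sqrt_iter a m - sqrt_iter a n| <=
  (sqrt_bound m - sqrt_bound n)%:C%C :> C.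
Proof.
move=> nm; rewrite -(subnK nm); elim: (m - n)%N => [|k IH].
  by rewrite !subrr normr0.
rewrite addSn -(subrKA (sqrt_iter a (k + n))) (le_trans (ler_normD _ _))//.
rewrite -[X in X%:C%C](subrKA (sqrt_bound (k + n))) rmorphD.
by rewrite lerD// sqrt_iter_step.
Qed.

Lemma sqrt_iter_cvg : cvg (sqrt_iter a @ \oo).
Proof.
apply: cauchy_seq_cvg => e e0; have [N hN] := sqrt_bound_cauchy e0.
exists N => n m Nn Nm; wlog nm : n m Nn Nm / (n <= m)%N.
  by move=> W; have [/W|/ltnW/W] := leqP n m; [|rewrite distrC]; apply.
by rewrite distrC (le_trans (sqrt_iter_dist nm))// lecR hN.
Qed.

End Iteration.

(** With [b] the limit of [sqrt_iter a] one has [b = (a + b^2) / 2], that is,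
   [(1 - b)^2 = 1 - a]. *)
Lemma sqrt_exists a : `|a| <= (1%R : C) -> a^# = a ->
  exists b, [/\ `|b| <= (1%R : C), b^# = b,
    (ca_one A - b)%R ** (ca_one A - b)%R = (ca_one A - a)%R &
    forall D, closed_subalg D -> D a -> D b].
Proof.
move=> a1 aS; have cv := sqrt_iter_cvg a1.
set b := lim (sqrt_iter a @ \oo) in cv.
have inD D : closed D -> (forall n, D (sqrt_iter a n)) -> D b.
  by move=> Dc Dn; apply: (closed_cvg _ Dc _ _ cv); near=> n; exact: Dn.
have bE : b = (2^-1 *: (a + b ** b))%R.
  have cvS : (fun n => sqrt_iter a n.+1) @ \oo --> b.
    by rewrite -(cvg_shiftS (sqrt_iter a)) in cv.
  apply: cvg_unique cvS _ => //=; apply: cvgZr; apply: cvgD; first exact: cvg_cst.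
  apply/cvgrPdist_le => e e0.
  near=> n.
  have bn1 : `|sqrt_iter a n| <= (1%R : C).
    rewrite (le_trans (sqrt_iter_norm a1 n))// -[1%R]/(1%:C%C) lecR.
    by have /andP[] := sqrt_bound01 n.
  have -> : (b ** b - sqrt_iter a n ** sqrt_iter a n =
     b ** (b - sqrt_iter a n) + (b - sqrt_iter a n) ** sqrt_iter a n)%R.
    by rewrite camBr camBl addrA subrK.
  rewrite (le_trans (ler_normD _ _))//.
  apply: (@le_trans _ _ ((`|b| + 1) * `|b - sqrt_iter a n|)).
    rewrite mulrDl mul1r lerD// ?ca_normM// (le_trans (ca_normM _ _))//.
    by rewrite ler_piMr.
  have b1 : (0 < `|b| + 1 :> C)%R by rewrite ltr_wpDl.
  rewrite mulrC -ler_pdivlMr//.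
  near: n; apply: cvgr_dist_le cv _ _; exact: divr_gt0.
exists b; split.
- apply: (inD [set x : A | `|x| <= (1%R : C)]) => [|n /=]; first exact: closed_unit_ball.
  rewrite (le_trans (sqrt_iter_norm a1 n))// -[1%R]/(1%:C%C) lecR.
  by have /andP[] := sqrt_bound01 n.
- apply: (inD [set x : A | x^# = x]) => [|n /=].
    by apply: closed_eq_cont; [exact: castar_cont|move=> ?; exact: cvg_id].
  elim: n => [|n IH] /=; first exact: castar0.
  by rewrite castarZ castarD aS ca_starM IH fmorphV rmorph_nat.
- rewrite camBl ca_mul1l camBr ca_mul1r.
  have -> : b ** b = (2 *: b - a)%R.
    by rewrite {3}bE scalerA divff ?pnatr_eq0// scale1r addrAC subrr add0r.
  rewrite scaler_nat mulr2n opprB (addrAC _ (- a)%R) addrK.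
  by rewrite addrA subrK.
- move=> D DS Da; apply: inD => [|n]; first exact: csub_closed DS.
  elim: n => [|n IH] /=; first exact: csub0.
  apply: csubZ => //; rewrite -[X in (X + _)%R]scale1r; apply: (csubP DS) => //.
  exact: (csubM DS).
Unshelve. all: by end_near.
Qed.

Lemma commutant_subalg h : closed_subalg [set x | h ** x = x ** h].
Proof.
split=> /=.
- by apply: closed_eq_cont; [exact: caml_cont|exact: camr_cont].
- by rewrite ca_mul1l ca_mul1r.
- by move=> c x y hx hy; rewrite camDr camDl camZr camZl hx hy.
- by move=> x y hx hy; rewrite ca_mulA hx -ca_mulA hy ca_mulA.
Qed.

(** The unitary [h + i sqrt (1 - h^2)] has norm one, so its imaginary part has norm
   at most one; square it. *)
Lemma norm_1_sub_sqr h : `|h| <= (1%R : C) -> h^# = h ->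
  `|(ca_one A - h ** h)%R| <= (1%R : C).
Proof.
move=> h1 hS.
have hh1 : `|h ** h| <= (1%R : C) by rewrite (le_trans (ca_normM _ _))// mulr_ile1.
have [|b [_ bS bE bD]] := sqrt_exists hh1; first by rewrite ca_starM hS.
rewrite -bE; set k := (ca_one A - b)%R.
have kS : k^# = k by rewrite castarB castar1 bS.
have hk : h ** k = k ** h.
  have hb : h ** b = b ** h.
    by apply: (bD _ (commutant_subalg h)); rewrite /= ca_mulA.
  by rewrite camBr camBl ca_mul1l ca_mul1r hb.
pose e := (h + 'i *: k)%R.
have eS : e^# = (h - 'i *: k)%R by rewrite castarD castarZ conjCi scaleNr hS kS.
have ee : e^# ** e = 1.
  rewrite eS camBl !camDr !camZl !camZr scalerA -expr2 sqrCi scaleN1r hk.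
  by rewrite opprD opprK addrA addrK bE addrC subrK.
have e1 : `|e| <= (1%R : C).
  have := ca_normC e; rewrite ee => /esym nE.
  have n1 : `|ca_one A| = 0%R \/ `|ca_one A| = (1%R : C).
    have := ca_normC (ca_one A); rewrite castar1 ca_mul1l.
    move: `|ca_one A| => n /eqP; rewrite -subr_eq0 -{1}[n]mulr1 -mulrBr mulf_eq0.
    by rewrite subr_eq0 => /orP[/eqP ->|/eqP <-]; [left|right].
  rewrite -(@ler_pXn2r _ 2)// ?nnegrE// expr1n nE.
  by case: n1 => ->.
have kE : k = ((2 * 'i)^-1 *: (e - e^#))%R.
  rewrite eS opprB addrCA addrAC subrr add0r -mulr2n -(scaler_nat _ ('i *: k)%R) !scalerA mulVf ?scale1r//.
  by rewrite mulf_neq0 ?pnatr_eq0// neq0Ci.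
have k1 : `|k| <= (1%R : C).
  rewrite kE normrZ normfV normrM normCi mulr1 gtr0_norm// mulrC ler_pdivrMr// mul1r.
  by rewrite (le_trans (ler_normB _ _))// castar_norm -[X in _ <= X](_ : 1 + 1 = _)%R// lerD.
by rewrite (le_trans (ca_normM _ _))// mulr_ile1.
Qed.

(** [k] is the absolute value of [h], and [m] its square root. *)
Lemma abs_exists h : `|h| <= (1%R : C) -> h^# = h ->
  exists k m, [/\ k^# = k /\ m^# = m, k ** k = h ** h, m ** m = k &
    forall D, closed_subalg D -> D h -> D k /\ D m].
Proof.
move=> h1 hS.
have hhS : (ca_one A - h ** h)%R^# = (ca_one A - h ** h)%R by rewrite castarB castar1 ca_starM hS.
have [b [b1 bS bE bD]] := sqrt_exists (norm_1_sub_sqr h1 hS) hhS.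
have [c [_ cS cE cD]] := sqrt_exists b1 bS.
exists (ca_one A - b)%R, (ca_one A - c)%R; split=> //.
- by rewrite !castarB castar1 bS cS.
- by rewrite bE opprB addrCA subrr addr0.
- move=> D DS Dh.
  have Db : D b by apply: bD => //; apply: csubB (csub1 DS) (csubM DS Dh Dh).
  by split; apply: csubB (csub1 DS) _ => //; exact: cD.
Qed.

End SquareRoot.

(** * Hilbert space basics *)

Section Hilbert.
Variables (R : realType) (H : hilbertSpace R).
Local Notation C := R[i].
Local Notation "''[' u , v ]" := (hdot H u v).
Implicit Types x y v : H.

Lemma hdotC x y : '[x, y] = Num.conj '[y, x].
Proof. by rewrite hermC expr0 mul1r. Qed.
Lemma hdotDl x y v : '[x + y, v] = '[x, v] + '[y, v].
Proof. exact: linearDl. Qed.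
Lemma hdotDr x y v : '[v, x + y] = '[v, x] + '[v, y].
Proof. exact: linearDr. Qed.
Lemma hdotBl x y v : '[x - y, v] = '[x, v] - '[y, v].
Proof. exact: linearBl. Qed.
Lemma hdotBr x y v : '[v, x - y] = '[v, x] - '[v, y].
Proof. exact: linearBr. Qed.
Lemma hdotZl (c : C) x v : '[c *: x, v] = c * '[x, v].
Proof. exact: linearZl_LR. Qed.
Lemma hdotZr (c : C) x v : '[v, c *: x] = Num.conj c * '[v, x].
Proof. exact: linearZr_LR. Qed.
Lemma hdot0l v : '[0, v] = 0.
Proof. exact: linear0l. Qed.
Lemma hdot0r v : '[v, 0] = 0.
Proof. exact: linear0r. Qed.

Lemma hdot_suml (I : Type) (r : seq I) (E : I -> H) v :
  '[\sum_(i <- r) E i, v] = \sum_(i <- r) '[E i, v].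
Proof. exact: linear_sumlz. Qed.
Lemma hdot_sumr (I : Type) (r : seq I) (E : I -> H) v :
  '[v, \sum_(i <- r) E i] = \sum_(i <- r) '[v, E i].
Proof. exact: linear_sumr. Qed.

Lemma hdot_eq0 x : '[x, x] = 0 -> x = 0.
Proof. by move/eqP; rewrite dnorm_eq0 => /eqP. Qed.

Lemma hdot_ge0 x : 0 <= '[x, x].
Proof. by rewrite -hnormE exprn_ge0. Qed.

Lemma hdot_ext x y : (forall v, '[x, v] = '[y, v]) -> x = y.
Proof.
move=> xy; apply/eqP; rewrite -subr_eq0; apply/eqP/hdot_eq0.
by rewrite hdotBl xy subrr.
Qed.

Lemma hdot_norm_le x y : `|'[x, y]| <= `|x| * `|y|.
Proof.
have nE (v : H) : `|v| = sqrtC '[v, v] by rewrite -hnormE sqrCK.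
by rewrite !nE; exact: dot_CauchySchwarz.
Qed.

Lemma hdotl_cont v : continuous (fun x => '[x, v] : C^o).
Proof.
apply: (@lipschitz_cont _ _ _ _ `|v|) => // x y.
by rewrite -hdotBl mulrC hdot_norm_le.
Qed.

Lemma norm_le_hdot x y (M : C) : 0 <= M ->
  '[x, x] <= M ^+ 2 * '[y, y] -> `|x| <= M * `|y|.
Proof.
move=> M0 xy; rewrite -(@ler_pXn2r _ 2)// ?nnegrE ?mulr_ge0//.
by rewrite exprMn !hnormE.
Qed.

Record closed_subspace (K : set H) : Prop := {
  cs_closed : closed K;
  cs0 : K 0;
  csP : forall (c : C) x y, K x -> K y -> K (c *: x + y) }.

Lemma csD K x y : closed_subspace K -> K x -> K y -> K (x + y).
Proof. by move=> KS Kx Ky; have := csP KS 1 Kx Ky; rewrite scale1r. Qed.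
Lemma csZ K (c : C) x : closed_subspace K -> K x -> K (c *: x).
Proof. by move=> KS Kx; have := csP KS c Kx (cs0 KS); rewrite addr0. Qed.
Lemma csB K x y : closed_subspace K -> K x -> K y -> K (x - y).
Proof. by move=> KS Kx Ky; have := csP KS (-1) Ky Kx; rewrite scaleN1r addrC. Qed.

Lemma closed_subspace_orth (S : set H) :
  closed_subspace [set x | forall v, S v -> '[x, v] = 0].
Proof.
split=> /= [|v _|c x y hx hy v Sv]; last 2 first.
- exact: hdot0l.
- by rewrite hdotDl hdotZl hx// hy// mulr0 addr0.
rewrite (_ : mkset _ = \bigcap_(v in S) [set x | '[x, v] = 0 :> C^o]) //.
apply: closed_bigI => v _; apply: closed_eq_cont; first exact: hdotl_cont.
by move=> ?; exact: cvg_cst.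
Qed.

Lemma closed_subspace_ker (T : {linear H -> H}) : continuous T ->
  closed_subspace [set x | T x = 0].
Proof.
move=> Tc; split=> /= [||c x y hx hy]; last 2 first.
- exact: linear0.
- by rewrite linearP hx hy scaler0 addr0.
by apply: closed_eq_cont => // ?; exact: cvg_cst.
Qed.

Lemma closed_subspaceI K L : closed_subspace K -> closed_subspace L ->
  closed_subspace (K `&` L).
Proof.
move=> KS LS; split; first by apply: closedI; [apply: cs_closed KS|apply: cs_closed LS].
  by split; [exact: cs0 KS|exact: cs0 LS].
by move=> c x y [? ?] [? ?]; split; [exact: (csP KS)|exact: (csP LS)].
Qed.

Lemma closed_subspaceT : closed_subspace setT.
Proof. by split=> //; exact: closedT. Qed.

Definition irr_family (I : Type) (Z : I -> H -> H) : Prop :=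
  forall K, closed_subspace K -> (forall i x, K x -> K (Z i x)) ->
  K = [set 0] \/ K = setT.

End Hilbert.

(** * Representations of C*-algebras *)

Section Representation.
Variables (R : realType) (A : cstarAlgebra R) (H : hilbertSpace R).
Variable pi : A -> {linear H -> H}.
Hypothesis hpi : is_representation pi.
Local Notation C := R[i].
Local Notation "''[' u , v ]" := (hdot H u v).
Local Open Scope cstar_scope.
Implicit Types (a b : A) (x y : H).

Lemma repD a b x : pi (a + b)%R x = (pi a x + pi b x)%R.
Proof. by have := rep_linear hpi 1%R a b x; rewrite !scale1r. Qed.
Lemma rep0 x : pi 0%R x = 0%R.
Proof. by have := repD 0%R 0%R x => /eqP; rewrite addr0 -subr_eq0 opprD addNKr oppr_eq0 => /eqP. Qed.
Lemma repZ (c : C) a x : pi (c *: a)%R x = (c *: pi a x)%R.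
Proof. by have := rep_linear hpi c a 0%R x; rewrite rep0 !addr0. Qed.
Lemma repB a b x : pi (a - b)%R x = (pi a x - pi b x)%R.
Proof. by rewrite repD -scaleN1r repZ scaleN1r. Qed.

Lemma rep_adj a x y : '[pi a x, y] = '[x, pi a^# y].
Proof. by rewrite -(rep_star hpi) ca_starK. Qed.

(** If [b] is self-adjoint of norm at most one, then [1 - b] is the square of
   a self-adjoint element, so its image is a positive operator. *)
Lemma rep_norm a x : `|pi a x| <= `|a| * `|x|.
Proof.
have [a0|a0] := eqVneq `|a| 0%R.
  by have /eqP := a0; rewrite normr_eq0 => /eqP ->; rewrite rep0 !normr0 mul0r.
have ap : (0 < `|a|)%R by rewrite lt0r a0 /=.
pose b : A := (`|a| ^- 2 *: (a^# ** a))%R.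
have b1 : `|b| <= (1%R : C).
  by rewrite normrZ ca_normC normfV normrX normr_id mulVf// expf_neq0.
have bS : b^# = b.
  by rewrite castarZ ca_starM ca_starK conj_Creal// ger0_real// invr_ge0 exprn_ge0.
have [c [_ cS cE _]] := sqrt_exists b1 bS.
apply: norm_le_hdot => //.
have kS : (ca_one A - c)%R^# = (ca_one A - c)%R by rewrite castarB castar1 cS.
have : (0 <= '[pi (ca_one A - b)%R x, x])%R.
  by rewrite -cE (repM hpi) rep_adj kS hdot_ge0.
rewrite repB (rep1 hpi) hdotBl subr_ge0 repZ hdotZl (repM hpi).
rewrite -[pi a^# _]/(pi a^# (pi a x)) (rep_star hpi).
by rewrite mulrC ler_pdivrMr ?exprn_gt0// mulrC.
Qed.

Lemma rep_contl x : continuous (fun a => pi a x).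
Proof.
apply: (@lipschitz_cont _ _ _ _ `|x|) => // a b.
by rewrite -repB mulrC rep_norm.
Qed.

(** The elements that leave [K] invariant together with their adjoints form a closed
   subalgebra, because [pi a x] depends continuously on [a]. *)
Lemma irreducible_generators (X : set A) : generates X -> irreducible pi ->
  forall K, closed_subspace K ->
    (forall a x, X a -> K x -> K (pi a x) /\ K (pi a^# x)) ->
  K = [set 0%R] \/ K = setT.
Proof.
move=> gX [_ irr] K KS KX; apply: irr; [exact: cs_closed KS|exact: cs0 KS|exact: csP KS|].
pose D := [set a | forall x, K x -> K (pi a x) /\ K (pi a^# x)].
suff DT : D = setT.
  move=> a x Kx; have Da : D a by rewrite DT.
  by have [] := Da x Kx.
apply: gX => //.
- rewrite (_ : D = \bigcap_(x in K) ((fun a => pi a x) @^-1` K `&`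
    ((fun a => pi a x) \o (@ca_star _ A)) @^-1` K))//.
  apply: closed_bigI => x Kx; apply: closedI; apply: closed_comp (cs_closed KS) => a _.
    exact: rep_contl.
  by apply: continuous_comp; [exact: castar_cont|exact: rep_contl].
- by move=> a Xa x Kx; exact: KX.
- by move=> x Kx; rewrite castar1 (rep1 hpi).
- move=> c a b Da Db x Kx; rewrite castarD castarZ !(rep_linear hpi).
  have [[? ?] [? ?]] := (Da x Kx, Db x Kx).
  by split; apply: (csP KS).
- move=> a b Da Db x Kx; rewrite ca_starM !(repM hpi).
  by split; [apply Da; apply Db|apply Db; apply Da].
- by move=> a Da x Kx; rewrite ca_starK; have [] := Da x Kx.
Qed.

(** A Schur lemma for a corner: [H0] is a space of vacuum vectors, and [F] a
   commuting self-adjoint family that acts on it.  [F_irr] says that a nonzero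
   [F]-stable subspace [L] of [H0] exhausts [H0]; in the applications this holds
   because [L] generates the Hilbert space. *)
Section Corner.
Variables (H0 : set H) (F : set A).
Hypothesis H0S : closed_subspace H0.
Hypothesis F_star : forall f, F f -> F f^#.
Hypothesis F_stab : forall f x, F f -> H0 x -> H0 (pi f x).
Hypothesis F_comm : forall f g x, F f -> F g -> H0 x ->
  pi f (pi g x) = pi g (pi f x).
Hypothesis F_irr : forall L, closed_subspace L -> L `<=` H0 ->
  (forall f x, F f -> L x -> L (pi f x)) -> (exists2 x, L x & x <> 0%R) ->
  forall y, H0 y -> (forall x, L x -> '[y, x] = 0%R) -> y = 0%R.

(** The elements that act on [H0] and commute with [F] there. *)
Let D := [set a | forall x, H0 x -> H0 (pi a x) /\
  forall f, F f -> pi a (pi f x) = pi f (pi a x)].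

Lemma corner_subalg : closed_subalg D.
Proof.
split.
- rewrite (_ : D = \bigcap_(x in H0) ((fun a => pi a x) @^-1` H0 `&`
    \bigcap_(f in F) [set a | pi a (pi f x) = pi f (pi a x)]))//.
  apply: closed_bigI => x H0x; apply: closedI.
    by apply: closed_comp (cs_closed H0S) => a _; exact: rep_contl.
  apply: closed_bigI => f Ff; apply: closed_eq_cont; first exact: rep_contl.
  move=> a; apply: (@continuous_comp _ _ _ (fun a => pi a x) (pi f)).
    exact: rep_contl.
  exact: (rep_bounded hpi).
- by move=> x H0x; rewrite (rep1 hpi); split=> // f _; rewrite (rep1 hpi).
- move=> c a b Da Db x H0x; rewrite !(rep_linear hpi).
  have [[? Daf] [? Dbf]] := (Da x H0x, Db x H0x).
  split; first exact: (csP H0S).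
  by move=> f Ff; rewrite !(rep_linear hpi) linearP Daf// Dbf.
- move=> a b Da Db x H0x; rewrite !(repM hpi).
  have [Hb Dbf] := Db x H0x; have [? Daf] := Da _ Hb.
  by split=> // f Ff; rewrite !(repM hpi) Dbf// Daf.
Qed.

(** The kernel of [|h| - h] on the corner is everything or zero; in the latter
   case [|h| + h], whose range it contains, vanishes there. *)
Lemma corner_abs h k : D h -> D k -> h^# = h -> k^# = k -> k ** k = h ** h ->
  h ** k = k ** h ->
  (forall x, H0 x -> pi k x = pi h x) \/
  (forall x, H0 x -> pi k x = (- pi h x)%R).
Proof.
move=> Dh Dk hS kS kk hk.
pose L := H0 `&` [set x | pi (k - h)%R x = 0%R].
have LS : closed_subspace L.
  apply: closed_subspaceI => //.
  by apply: closed_subspace_ker; exact: (rep_bounded hpi).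
have [[x Lx x0]|L0] := pselect (exists2 x, L x & x <> 0%R).
  left=> v H0v; apply/eqP; rewrite -subr_eq0 -repB; apply/eqP.
  have Dkh : D (k - h)%R by exact: (csubB corner_subalg).
  apply: (F_irr LS) => //.
  - by move=> ? [].
  - move=> f y Ff [H0y /= ky]; split; first exact: F_stab.
    by have [_ E] := Dkh y H0y; rewrite /= E// ky linear0.
  - by exists x.
  - by have [? _] := Dkh v H0v.
  - by move=> y [H0y /= ky]; rewrite rep_adj castarB hS kS ky hdot0r.
right=> v H0v; apply/eqP; rewrite -subr_eq0 opprK -repD.
apply/negP => /negP/eqP v0; apply: L0; exists (pi (k + h)%R v) => //.
split.
  by rewrite repD; apply: csD => //; [have [] := Dk v H0v|have [] := Dh v H0v].
rewrite /= -(repM hpi) camBl !camDr kk hk (addrC (h ** h)) subrr.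
exact: rep0.
Qed.

(** With [c] the mean value of [h] in the state [x], the mean value of [h - c] is 0.
   By [corner_abs] the operator [h - c] agrees on [H0] with its absolute value up
   to sign, so the square root [m] of the latter kills [x], and so does [h - c]. *)
Lemma corner_selfadjoint h : D h -> h^# = h ->
  forall x, H0 x -> exists c : C, pi h x = (c *: x)%R.
Proof.
move=> Dh hS x H0x; have [->|x0] := eqVneq x 0%R.
  by exists 0%R; rewrite linear0 scaler0.
have xx0 : '[x, x] != 0%R by rewrite dnorm_eq0.
pose c := ('[pi h x, x] / '[x, x])%R; exists c.
have cS : Num.conj c = c.
  have E u v : Num.conj '[u, v] = '[v, u] := esym (hdotC v u).
  by rewrite /c rmorphM fmorphV /= !E -(rep_star hpi) hS.
(* Scaling [h - c] to norm at most one, as [abs_exists] requires. *)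
pose t := (1 + `|(h - c *: ca_one A)%R|)%R.
have t0 : (0 < t)%R by rewrite ltr_pwDl.
pose g := (t^-1 *: (h - c *: ca_one A))%R.
have gS : g^# = g.
  have tS : Num.conj t^-1 = t^-1 by rewrite conj_Creal// gtr0_real// invr_gt0.
  by rewrite castarZ castarB castarZ castar1 hS cS tS.
have g1 : `|g| <= (1%R : C).
  by rewrite normrZ normfV gtr0_norm// mulrC ler_pdivrMr// mul1r lerDr.
have [k [m [[kS mS] kk mm kD]]] := abs_exists g1 gS.
have Dg : D g.
  have DS := corner_subalg.
  exact: (csubZ _ DS (csubB DS Dh (csubZ _ DS (csub1 DS)))).
have [Dk Dm] := kD _ corner_subalg Dg.
have gk : g ** k = k ** g by have [] := kD _ (commutant_subalg g) erefl.
have gx : '[pi g x, x] = 0%R.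
  rewrite repZ repB repZ (rep1 hpi) hdotZl hdotBl hdotZl /c divfK// subrr.
  by rewrite mulr0.
have kx : '[pi k x, x] = 0%R /\ (pi k x = 0 -> pi g x = 0)%R.
  have [E|E] := corner_abs Dg Dk gS kS kk gk; rewrite E//.
  split; first by rewrite -scaleN1r hdotZl gx mulr0.
  by move/eqP; rewrite oppr_eq0 => /eqP.
have mx : pi m x = 0%R.
  by apply: hdot_eq0; rewrite rep_adj mS -(repM hpi) mm hdotC; case: kx => -> _; rewrite rmorph0.
have : pi g x = 0%R.
  by apply kx; rewrite -mm (repM hpi) mx linear0.
rewrite repZ => /eqP; rewrite scaler_eq0 invr_eq0 gt_eqF//= repB repZ (rep1 hpi).
by rewrite subr_eq0 => /eqP.
Qed.

(** The real and imaginary parts of [r] both have [x] as an eigenvector. *)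
Lemma corner_eigen r x : F r -> H0 x -> exists c : C, pi r x = (c *: x)%R.
Proof.
move=> Fr H0x.
have DF f : F f -> D f.
  by move=> Ff y H0y; split; [exact: F_stab|move=> g Fg; exact: F_comm].
have Dr := DF _ Fr; have Drs := DF _ (F_star Fr).
have DS := corner_subalg.
have [||c1 E1] := @corner_selfadjoint (r + r^#)%R _ _ x H0x.
- by rewrite -[X in D (X + _)%R]scale1r; apply: (csubP DS).
- by rewrite castarD ca_starK addrC.
have [||c2 E2] := @corner_selfadjoint ('i *: (r - r^#))%R _ _ x H0x.
- exact: (csubZ _ DS (csubB DS Dr Drs)).
- by rewrite castarZ castarB ca_starK conjCi scaleNr -scalerN opprB.
exists (2^-1 * (c1 - 'i * c2))%R.
rewrite -scalerA scalerBl -scalerA -E1 -E2 -!repZ -repB -repZ.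
rewrite scalerA -expr2 sqrCi scaleN1r opprK addrCA addrK -mulr2n.
by rewrite -(scaler_nat _ r) scalerA mulVf ?pnatr_eq0// scale1r.
Qed.

End Corner.
End Representation.

(** * Orthonormal families *)

Section Polarization.
Variables (R : realType) (H K : hilbertSpace R).
Local Notation C := R[i].

(** The form [B] that measures the defect vanishes on the diagonal; expanding it at
   [u + v] and at [u + i v] gives [B x y = - B y x] and [B x y = B y x]. *)
Lemma polarization (U : {linear H -> K}) :
  (forall x, hdot K (U x) (U x) = hdot H x x) ->
  forall x y, hdot K (U x) (U y) = hdot H x y.
Proof.
move=> iso x y; pose B u v := hdot K (U u) (U v) - hdot H u v.
suff B0 : B x y = 0 by apply/eqP; rewrite -subr_eq0 -/(B x y) B0.
have sum0 u v : B u v + B v u = 0.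
  have := iso (u + v); rewrite linearD !hdotDl !hdotDr !iso /B.
  move: (hdot K (U u) (U v)) (hdot K (U v) (U u)) (hdot H u v) (hdot H v u).
  move: (hdot H u u) (hdot H v v) => p q a b c d E.
  have -> : a - c + (b - d) = (p + a + (b + q)) - (p + c + (d + q)) by ring.
  by rewrite E subrr.
have E1 := sum0 x y; have := sum0 x ('i *: y).
rewrite {1 2}/B linearZ !hdotZl !hdotZr conjCi.
rewrite (_ : _ + _ = 'i * (B y x - B x y)); last by rewrite /B; ring.
move/eqP; rewrite mulf_eq0 (negbTE (neq0Ci _))/= subr_eq0 => /eqP E2.
by move: E1; rewrite E2 -mulr2n => /eqP; rewrite -mulr_natr mulf_eq0 pnatr_eq0 orbF => /eqP.
Qed.

End Polarization.

Section RieszFischer.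
Variables (R : realType) (H : hilbertSpace R) (I : choiceType) (e : I -> H).
Local Notation C := R[i].
Local Notation "''[' u , v ]" := (hdot H u v).
Hypothesis ort : forall i j, '[e i, e j] = (i == j)%:R.
Implicit Types (J B : {fset I}) (f : I -> C).

Lemma csqE (c : C) : (csq c)%:C%C = c * Num.conj c.
Proof.
case: c => a b; rewrite /csq; apply/eqP; rewrite eq_complex /=.
by apply/andP; split; apply/eqP; ring.
Qed.

Lemma realC_conj (r : R) : Num.conj (r%:C%C) = r%:C%C.
Proof. exact: conjc_real. Qed.

Let v f J : H := \sum_(i <- J) f i *: e i.
Let sq f J : R := \sum_(i <- J) csq (f i).

Lemma dot_partial f J j : '[v f J, e j] = if j \in J then f j else 0.
Proof.
rewrite /v hdot_suml; under eq_bigr => i _ do rewrite hdotZl ort.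
case: ifPn => [jJ|jJ].
  rewrite (bigD1_seq j) //= eqxx mulr1 big1 ?addr0// => i /negbTE ->.
  by rewrite mulr0.
rewrite big_seq big1 // => i iJ; rewrite (_ : i == j = false) ?mulr0//.
by apply: contraNF jJ => /eqP <-.
Qed.

Lemma dot_partialr f x J : (forall i, i \in J -> '[x, e i] = f i) ->
  '[x, v f J] = (sq f J)%:C%C.
Proof.
move=> xf; rewrite /v hdot_sumr rmorph_sum big_seq [RHS]big_seq.
by apply: eq_bigr => i iJ; rewrite hdotZr xf// mulrC -csqE.
Qed.

Lemma partial_dist f J B : (J `<=` B)%fset ->
  '[v f B - v f J, v f B - v f J] = (sq f B - sq f J)%:C%C.
Proof.
move=> /fsubsetP JB; rewrite hdotBr !hdotBl.
have E (A D : {fset I}) : {subset A <= D} -> '[v f D, v f A] = (sq f A)%:C%C.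
  by move=> AD; apply: dot_partialr => i /AD iD; rewrite dot_partial iD.
rewrite [X in X - _](_ : _ = (sq f B)%:C - (sq f J)%:C)%C; last first.
  by rewrite [X in _ - X]hdotC (E J B)// (E B B)// realC_conj.
by rewrite (E J B)// (E J J)// subrr subr0 -rmorphB.
Qed.

Lemma bessel x J : (sq (fun i => '[x, e i]) J)%:C%C <= '[x, x].
Proof.
set f := fun i => _; have vx : '[x, v f J] = (sq f J)%:C%C by exact: dot_partialr.
have vv : '[v f J, v f J] = (sq f J)%:C%C.
  by apply: dot_partialr => i iJ; rewrite dot_partial iJ.
have := hdot_ge0 (x - v f J); rewrite hdotBr !hdotBl vv vx [X in _ - X - _]hdotC vx.
by rewrite realC_conj subrr subr0 subr_ge0.
Qed.

Lemma l2_of_coords x : (fun i => '[x, e i]) \in @sqsummable R I.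
Proof.
have [r r0 xr] := nnegC_real (hdot_ge0 x).
apply/asboolP; apply: (@le_lt_trans _ _ r%:E); last by rewrite ltry.
apply: ge_ereal_sup => _ [J [finJ _] <-].
rewrite fsbig_finite//= sumEFin lee_fin -lecR -xr.
exact: (bessel x (fset_set J)).
Qed.

Lemma sq_le (f : l2 R I) J : sq f J <= l2_sq f.
Proof.
have := @l2_sum_le R I f [set` J] (finite_fset J).
by rewrite fsbig_finite// set_fsetK.
Qed.

Lemma sq_adherent (f : l2 R I) (d : R) : 0 < d ->
  exists J : {fset I}, l2_sq f - d <= sq f J.
Proof.
move=> d0; pose S := \esum_(i in [set: I]) (csq (f i))%:E.
have Sfin : S \is a fin_num.
  rewrite ge0_fin_numE; first exact: l2_sqfin.
  by apply: esum_ge0 => i _; rewrite lee_fin csq_ge0.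
have [_ [J [finJ _] <-]] := ub_ereal_sup_adherent d0 Sfin.
rewrite fsbig_finite//= sumEFin => lt; exists (fset_set J).
have {lt}: (S - d%:E < (\sum_(i <- fset_set J) csq (f i))%:E)%E by [].
by rewrite -(fineK Sfin) -EFinB lte_fin => /ltW.
Qed.

(** The partial sums over finite sets that exhaust the norm of [f] up to [d n ^ 2]
   form a Cauchy sequence: compare two of them with the sum over the union. *)
Lemma riesz_fischer (f : l2 R I) :
  exists2 x, forall j, '[x, e j] = f j & '[x, x] = (l2_sq f)%:C%C.
Proof.
pose d n : R := n.+1%:R^-1.
have d0 n : 0 < d n by rewrite invr_gt0 ltr0n.
have dsmall (r : R) : 0 < r -> exists N, forall n, (N <= n)%N -> d n <= r.
  move=> r0; have /cvgrPdist_le/(_ _ r0)[N _ hN] := @cvg_harmonic R.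
  exists N => n Nn; have := hN n Nn; rewrite sub0r normrN ger0_norm//.
  exact: ltW (d0 n).
have /choice[J hJ] n : exists J : {fset I}, l2_sq f - d n ^+ 2 <= sq f J.
  by apply: sq_adherent; rewrite exprn_gt0.
pose u n := v f (J n).
have dist n B : (J n `<=` B)%fset -> `|v f B - u n| <= (d n)%:C%C.
  move=> JB; rewrite -(@ler_pXn2r _ 2)// ?nnegrE ?normr_ge0 ?ler0c ?(ltW (d0 n))//.
  have -> : (d n)%:C%C ^+ 2 = (d n ^+ 2)%:C%C by rewrite rmorphXn.
  have le : (sq f B - sq f (J n))%:C%C <= (d n ^+ 2)%:C%C :> C.
    by rewrite lecR; have := sq_le f B; have := hJ n; lra.
  rewrite hnormE (partial_dist f JB); exact: le.
have cv : cvg (u @ \oo).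
  apply: cauchy_seq_cvg => r r0; have [|N hN] := dsmall (r / 2); first by rewrite divr_gt0.
  exists N => n m Nn Nm; rewrite -(subrKA (v f (J n `|` J m)%fset)) (le_trans (ler_normD _ _))//.
  rewrite (splitr r) rmorphD lerD//.
    by rewrite distrC (le_trans (dist n _ _)) ?fsubsetUl// lecR hN.
  by rewrite (le_trans (dist m _ _)) ?fsubsetUr// lecR hN.
set x := lim (u @ \oo) in cv.
have xe j : '[x, e j] = f j.
  have c1 : (fun n => '[u n, e j] : C^o) @ \oo --> ('[x, e j] : C^o).
    exact: (@cvg_comp _ _ _ u (fun y => ('[y, e j] : C^o)) _ _ _ cv (@hdotl_cont _ _ (e j) x)).
  apply: (@cvg_unique C^o (@norm_hausdorff _ C^o) _ _ _ _ c1); apply/cvgrPdist_le => _ /posC_real[r r0 ->].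
  have [N hN] := dsmall r r0; exists N => // n Nn /=.
  (* [J n] need not contain [j]; adding [j] costs at most [d n] in norm. *)
  have -> : f j = '[v f (J n `|` [fset j])%fset, e j].
    by rewrite dot_partial !inE eqxx orbT.
  rewrite -hdotBl (le_trans (hdot_norm_le _ _))//.
  have -> : `|e j| = 1.
    by apply/eqP; rewrite -sqrp_eq1// hnormE ort eqxx.
  by rewrite mulr1 (le_trans (dist n _ _)) ?fsubsetUl// lecR hN.
exists x => //.
have c1 : (fun n => '[u n, x] : C^o) @ \oo --> ('[x, x] : C^o).
  exact: (@cvg_comp _ _ _ u (fun y => ('[y, x] : C^o)) _ _ _ cv (@hdotl_cont _ _ (x) x)).
apply: (@cvg_unique C^o (@norm_hausdorff _ C^o) _ _ _ _ c1); apply/cvgrPdist_le => _ /posC_real[r r0 ->].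
have [|N hN] := dsmall (Num.min 1 r); first by rewrite lt_min ltr01.
exists N => // n Nn /=; rewrite hdotC dot_partialr// realC_conj.
rewrite -rmorphB normc_def /= expr0n addr0 sqrtr_sqr lecR ger0_norm ?subr_ge0 ?sq_le//.
have := hJ n; have := hN n Nn; rewrite le_min => /andP[d1 dr]; have := d0 n.
by move: (d n) d1 dr (sq f (J n)) (l2_sq f) => t t1 tr p q t0; nra.
Qed.

(** The coordinates of [x] define, by [riesz_fischer], a vector with the same
   coordinates and the norm of the coordinate sequence; by totality it is [x]. *)
Lemma onb_unitary : (forall y, (forall i, '[y, e i] = 0) -> y = 0) ->
  exists U : {linear H -> ell2 R I}, [/\ forall y, exists x, U x = y,
    forall x y, hdot (ell2 R I) (U x) (U y) = '[x, y] &
    forall x i, (U x : l2 R I) i = '[x, e i]].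
Proof.
move=> tot; pose U0 x : l2 R I := MkL2 (l2_of_coords x).
have U0P : linear (U0 : H -> ell2 R I).
  move=> c x y; apply/val_inj/funext => i /=.
  by rewrite hdotDl hdotZl.
pose U1 := GRing.isLinear.Build _ _ _ _ (U0 : H -> ell2 R I) U0P.
pose U : {linear H -> ell2 R I} := HB.pack (U0 : H -> ell2 R I) U1.
exists U; split=> //.
- move=> y; have [x xe _] := riesz_fischer y; exists x.
  by apply/val_inj/funext => i /=; rewrite xe.
- apply: polarization => x.
  have [y ye yy] := riesz_fischer (U0 x).
  have xy : x = y.
    apply/eqP; rewrite -subr_eq0; apply/eqP/tot => i.
    by rewrite hdotBl ye subrr.
  have -> : '[x, x] = (l2_sq (U0 x))%:C%C by rewrite -yy -xy.
  by rewrite /l2_sq -l2_dotE.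
Qed.

End RieszFischer.

(** * Bounded operators in coordinates and their limits as q tends to 0 *)

Section CoordinateOperators.
Variable R : realType.
Local Notation C := R[i].

Section Bounds.
Variable I : choiceType.
Implicit Types (f g : I -> C) (F G : (I -> C) -> I -> C).

Definition sqnorm f : \bar R := \esum_(i in [set: I]) (csq (f i))%:E.

Lemma sqnorm_ge0 f : (0 <= sqnorm f)%E.
Proof. by apply: esum_ge0 => i _; rewrite lee_fin csq_ge0. Qed.

Lemma ge0_esumZ (a : I -> \bar R) (c : R) : 0 <= c -> (forall i, 0 <= a i)%E ->
  (\esum_(i in [set: I]) (c%:E * a i) = c%:E * \esum_(i in [set: I]) a i)%E.
Proof.
move=> c0 a0; rewrite /esum -ereal_supZl//; last first.
  by apply/set0P; exists (\sum_(x \in set0) a x)%E; exists set0 => //; exact: fsets_set0.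
congr ereal_sup; rewrite image_comp; apply: eq_imagel => J [finJ _] /=.
by rewrite ge0_mule_fsumr.
Qed.

Lemma csqM (c x : C) : csq (c * x) = csq c * csq x.
Proof. by case: c x => [a b] [u v]; rewrite /csq /=; ring. Qed.

Lemma csq_real (r : R) : csq r%:C%C = r ^+ 2.
Proof. by rewrite /csq /= expr0n addr0. Qed.

Lemma csqD_le (x y : C) : csq (x + y) <= 2 * csq x + 2 * csq y.
Proof.
case: x y => [a b] [u v]; rewrite /csq /=.
by have := sqr_ge0 (a - u); have := sqr_ge0 (b - v); nra.
Qed.

Definition linear_op F := forall (c : C) f g i,
  F (fun j => c * f j + g j) i = c * F f i + F g i.

(** [F] has norm at most [sqrt M] on l^2(I); since [sqnorm] is extended-valued
   nothing needs to be assumed on [f]. *)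
Definition bounded_op (M : R) F := 0 <= M /\
  forall f, (sqnorm (F f) <= M%:E * sqnorm f)%E.

Lemma bounded_op_le M M' F : M <= M' -> bounded_op M F -> bounded_op M' F.
Proof.
move=> MM [M0 bF]; split=> [|f]; first exact: le_trans MM.
by apply: le_trans (bF f) _; rewrite lee_wpmul2r ?sqnorm_ge0 ?lee_fin.
Qed.

Lemma bounded_opD M M' F G : bounded_op M F -> bounded_op M' G ->
  bounded_op (2 * M + 2 * M') (fun f i => F f i + G f i).
Proof.
move=> [M0 bF] [M0' bG]; split=> [|f]; first by rewrite addr_ge0 ?mulr_ge0.
apply: (@le_trans _ _ (2%:E * sqnorm (F f) + 2%:E * sqnorm (G f))%E).
  have h0 (h : I -> C) i : (0 <= 2%:E * (csq (h i))%:E :> \bar R)%E.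
    by rewrite mule_ge0// lee_fin csq_ge0.
  have hZ (h : I -> C) : (2%:E * sqnorm h = \esum_(i in [set: I]) (2%:E * (csq (h i))%:E))%E.
    by rewrite /sqnorm ge0_esumZ// => i; rewrite lee_fin csq_ge0.
  rewrite !hZ -esumD//.
  by apply: le_esum => i _; rewrite -!EFinM -EFinD lee_fin csqD_le.
have -> : ((2 * M + 2 * M')%:E * sqnorm f =
    2%:E * (M%:E * sqnorm f) + 2%:E * (M'%:E * sqnorm f))%E.
  by rewrite EFinD [LHS]ge0_muleDl ?lee_fin ?mulr_ge0// !EFinM !muleA.
by rewrite leeD// lee_wpmul2l ?lee_fin.
Qed.

Lemma bounded_op_scale (c : C) M F : bounded_op M F ->
  bounded_op (csq c * M) (fun f i => c * F f i).
Proof.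
move=> [M0 bF]; split=> [|f]; first by rewrite mulr_ge0 ?csq_ge0.
rewrite EFinM -muleA; apply: (@le_trans _ _ ((csq c)%:E * sqnorm (F f))%E).
  rewrite /sqnorm -ge0_esumZ ?csq_ge0//; last by move=> i; rewrite lee_fin csq_ge0.
  by apply: le_esum => i _; rewrite -EFinM lee_fin csqM.
by rewrite lee_wpmul2l ?lee_fin ?csq_ge0.
Qed.

Lemma eq_bounded_op M F G : (forall f i, F f i = G f i) ->
  bounded_op M F -> bounded_op M G.
Proof. by move=> FG; rewrite (_ : F = G)//; apply/funext => f; apply/funext => i. Qed.

(** Norm convergence as [q] tends to 0.  The bounds are for squares of norms, so the
   rate [M * q] means that the norm of the difference is at most [sqrt (M * q)];
   an explicit rate makes limits of sums and tensor products immediate. *)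
Definition op_lim (Fq : R -> (I -> C) -> I -> C) F := [/\ linear_op F,
  forall q, 0 < q < 1 -> linear_op (Fq q) &
  exists M, bounded_op M F /\ forall q, 0 < q < 1 -> bounded_op M (Fq q) /\
    bounded_op (M * q) (fun f i => Fq q f i - F f i)].

Lemma eq_op_lim Fq Gq F G :
  (forall q, 0 < q < 1 -> forall f i, Fq q f i = Gq q f i) ->
  (forall f i, F f i = G f i) -> op_lim Fq F -> op_lim Gq G.
Proof.
move=> FGq FG; have -> : G = F by apply/funext => f; apply/funext => i; rewrite FG.
move=> [lF lFq [M [bF bFq]]]; split=> //.
  by move=> q q01 c f g i; rewrite -!FGq//; exact: lFq.
exists M; split=> // q q01; have [b1 b2] := bFq q q01; split.
  exact: eq_bounded_op (FGq q q01) b1.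
by apply: eq_bounded_op b2 => f i; rewrite FGq.
Qed.

Lemma op_lim0 : op_lim (fun _ _ _ => 0) (fun _ _ => 0).
Proof.
split=> [c f g i|q _ c f g i|]; rewrite ?mulr0 ?addr0//.
have b0 : bounded_op 0 (fun _ _ => 0 : C).
  split=> // f; rewrite mul0e /sqnorm esum1// => i _.
  by rewrite (csq_real 0) expr0n.
exists 0; split=> // q _; split=> //; rewrite mul0r.
by apply: eq_bounded_op b0 => f i; rewrite subr0.
Qed.

Lemma op_limD Fq Gq F G : op_lim Fq F -> op_lim Gq G ->
  op_lim (fun q f i => Fq q f i + Gq q f i) (fun f i => F f i + G f i).
Proof.
move=> [lF lFq [M [bF bFq]]] [lG lGq [L [bG bGq]]]; split.
- by move=> c f g i; rewrite lF lG; ring.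
- by move=> q q01 c f g i; rewrite lFq// lGq//; ring.
exists (2 * M + 2 * L); split; first exact: bounded_opD.
move=> q q01; have [b1 b2] := bFq q q01; have [b3 b4] := bGq q q01.
split; first exact: bounded_opD.
rewrite mulrDl -!mulrA.
by apply: eq_bounded_op (bounded_opD b2 b4) => f i; ring.
Qed.

Lemma op_lim_sum (n : nat) (Fq : 'I_n -> R -> (I -> C) -> I -> C)
  (F : 'I_n -> (I -> C) -> I -> C) :
  (forall l, op_lim (Fq l) (F l)) ->
  op_lim (fun q f i => \sum_(l < n) Fq l q f i) (fun f i => \sum_(l < n) F l f i).
Proof.
elim: n Fq F => [|n IH] Fq F FqF.
  by apply: eq_op_lim op_lim0 => *; rewrite big_ord0.
have := op_limD (FqF ord0) (IH _ _ (fun l => FqF (lift ord0 l))).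
by apply: eq_op_lim => *; rewrite big_ord_recl.
Qed.

Lemma op_lim_pow (d : nat) Fq F : op_lim Fq F ->
  op_lim (fun q f i => ((- q) ^+ d)%:C%C * Fq q f i)
         (fun f i => (d == 0%N)%:R * F f i).
Proof.
move=> FqF; case: d => [|d].
  by apply: eq_op_lim FqF => *; rewrite mul1r.
have [lF lFq [M [bF bFq]]] := FqF.
apply: (@eq_op_lim (fun q f i => ((- q) ^+ d.+1)%:C%C * Fq q f i) _
  (fun _ _ => 0)) => //; first by move=> f i; rewrite mul0r.
have [l0 _ _] := op_lim0; split=> //.
  by move=> q q01 c f g i; rewrite lFq//; ring.
have M0 : 0 <= M by case: bF.
exists M; split.
  have [_ _ [L [[_ b0] _]]] := op_lim0; split=> // f.
  rewrite /sqnorm esum1 ?mule_ge0 ?sqnorm_ge0// => i _.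
  by rewrite (csq_real 0) expr0n.
move=> q q01; have [b1 _] := bFq q q01; have /andP[q0 q1] := q01.
have bq : bounded_op (M * q) (fun f i => ((- q) ^+ d.+1)%:C%C * Fq q f i).
  apply: bounded_op_le (bounded_op_scale _ b1); rewrite csq_real mulrC ler_wpM2l//.
  rewrite -exprM mulnC exprM sqrrN exprS.
  have x0 : 0 <= (q ^+ 2) ^+ d by rewrite exprn_ge0// exprn_ge0// ltW.
  have x1 : (q ^+ 2) ^+ d <= 1.
    by rewrite -exprM exprn_ile1 ?(ltW q0) ?(ltW q1).
  nra.
split; last by apply: eq_bounded_op bq => f i; rewrite subr0.
by apply: bounded_op_le bq; rewrite ler_piMr// ltW.
Qed.

End Bounds.

(** ** Tensor products *)

Section Tensor.
Variable n : nat.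
Local Notation opN := ((nat -> C) -> nat -> C).
Local Notation opT := ((n.-tuple nat -> C) -> n.-tuple nat -> C).

Lemma sqnorm_tuple (f : n.+1.-tuple nat -> C) :
  sqnorm f = \esum_(a in [set: nat]) sqnorm (fun t : n.-tuple nat => f [tuple of a :: t]).
Proof.
rewrite /sqnorm esum_esum; last by move=> *; rewrite lee_fin csq_ge0.
rewrite (@reindex_esum _ _ _ ([set: nat] `*`` (fun=> setT)) _
  (fun k : nat * n.-tuple nat => [tuple of k.1 :: k.2]))//.
split=> //.
- by move=> [a t] [b s] _ _ /= /(congr1 val)/= [-> ts]; congr (_, _); exact: val_inj.
- by move=> m _; exists (thead m, [tuple of behead m]) => //=; rewrite -tuple_eta.
Qed.

Lemma sqnorm_tupleC (f : n.+1.-tuple nat -> C) :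
  sqnorm f = \esum_(t in [set: n.-tuple nat]) sqnorm (fun a => f [tuple of a :: t]).
Proof.
rewrite /sqnorm esum_esum; last by move=> *; rewrite lee_fin csq_ge0.
rewrite (@reindex_esum _ _ _ ([set: n.-tuple nat] `*`` (fun=> setT)) _
  (fun k : n.-tuple nat * nat => [tuple of k.2 :: k.1]))//.
split=> //.
- by move=> [t a] [s b] _ _ /= /(congr1 val)/= [-> ts]; congr (_, _); exact: val_inj.
- by move=> m _; exists ([tuple of behead m], thead m) => //=; rewrite -tuple_eta.
Qed.

Lemma tensor_cons (T : opN) (T' : opT) f (a : nat) (t : n.-tuple nat) :
  tensor T T' f [tuple of a :: t] =
  T (fun b => T' (fun s => f [tuple of b :: s]) t) a.
Proof.
by rewrite /tensor theadE (_ : [tuple of behead [tuple of a :: t]] = t)//; exact: val_inj.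
Qed.

(** Apply the bound for [T] on each fibre over the last variables, then the one for
   [T'] on each fibre over the first variable, exchanging the sums in between. *)
Lemma bounded_tensor M M' (T : opN) (T' : opT) : bounded_op M T -> bounded_op M' T' ->
  bounded_op (M * M') (tensor T T').
Proof.
move=> [M0 bT] [M0' bT']; split=> [|f]; first exact: mulr_ge0.
rewrite sqnorm_tupleC.
pose g a t := T' (fun s => f [tuple of a :: s]) t.
apply: (@le_trans _ _ (\esum_(t in [set: n.-tuple nat]) (M%:E * sqnorm (g^~ t)))%E).
  apply: le_esum => t _; rewrite (_ : (fun a => _) = T (g^~ t))//.
  by apply/funext => a; rewrite tensor_cons.
rewrite ge0_esumZ//; last by move=> t; exact: sqnorm_ge0.
rewrite EFinM -muleA lee_wpmul2l ?lee_fin//.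
have -> : \esum_(t in [set: n.-tuple nat]) sqnorm (g^~ t) =
    \esum_(a in [set: nat]) sqnorm (g a).
  pose h (m : n.+1.-tuple nat) := g (thead m) [tuple of behead m].
  have hE (a : nat) (t : n.-tuple nat) : h [tuple of a :: t] = g a t.
    by rewrite /h theadE; congr (g _ _); exact: val_inj.
  transitivity (sqnorm h).
    rewrite sqnorm_tupleC; apply: eq_esum => t _; congr sqnorm.
    by apply/funext => a; rewrite hE.
  rewrite sqnorm_tuple; apply: eq_esum => a _; congr sqnorm.
  by apply/funext => t; rewrite hE.
rewrite sqnorm_tuple -ge0_esumZ//; last by move=> a; exact: sqnorm_ge0.
by apply: le_esum => a _; exact: bT'.
Qed.

Lemma linear_tensor (T : opN) (T' : opT) : linear_op T -> linear_op T' -> linear_op (tensor T T').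
Proof.
move=> lT lT' c f g m; rewrite /tensor -lT; congr T.
by apply/funext => a; rewrite lT'.
Qed.

(** [Tq (x) Tq' - T (x) T' = (Tq - T) (x) Tq' + T (x) (Tq' - T')]. *)
Lemma op_lim_tensor Tq (T : opN) Tq' (T' : opT) : op_lim Tq T -> op_lim Tq' T' ->
  op_lim (fun q => tensor (Tq q) (Tq' q)) (tensor T T').
Proof.
move=> [lT lTq [M [bT bTq]]] [lT' lTq' [M' [bT' bTq']]]; split.
- exact: linear_tensor.
- by move=> q q01; apply: linear_tensor; [exact: lTq|exact: lTq'].
have [M0 M0'] : 0 <= M /\ 0 <= M' by move: bT bT' => [? _] [? _].
have MM0 : 0 <= M * M' by exact: mulr_ge0.
exists (4 * (M * M')); split.
  by apply: bounded_op_le (bounded_tensor bT bT'); rewrite ler_peMl// ler1n.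
move=> q q01; have [b1 b2] := bTq q q01; have [b3 b4] := bTq' q q01.
split; first by apply: bounded_op_le (bounded_tensor b1 b3); rewrite ler_peMl// ler1n.
have := bounded_opD (bounded_tensor b2 b3) (bounded_tensor bT b4).
rewrite (_ : 2 * _ + _ = 4 * (M * M') * q); last by ring.
apply: eq_bounded_op => f m; rewrite /tensor.
have lB u v i : T (fun j => u j - v j) i = T u i - T v i.
  have := lT (-1) v u i; rewrite mulN1r addrC => <-; congr T.
  by apply/funext => j; rewrite mulN1r addrC.
by rewrite lB addrA subrK.
Qed.

End Tensor.

(** ** The letters *)

Lemma sqnorm_diag (c : nat -> R) (M : R) (f : nat -> C) : 0 <= M ->
  (forall m, c m ^+ 2 <= M) -> (sqnorm (diag c f) <= M%:E * sqnorm f)%E.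
Proof.
move=> M0 cM; rewrite /sqnorm -ge0_esumZ//; last by move=> i; rewrite lee_fin csq_ge0.
apply: le_esum => i _; rewrite -EFinM lee_fin /diag csqM csq_real.
by rewrite ler_wpM2r ?csq_ge0.
Qed.

Lemma esum_succ (a : nat -> \bar R) : (forall i, 0 <= a i)%E ->
  (\esum_(i in [set: nat]) a i.+1 <= \esum_(i in [set: nat]) a i)%E /\
  (a 0%N = 0 -> \esum_(i in [set: nat]) a i.+1 = \esum_(i in [set: nat]) a i)%E.
Proof.
move=> a0; rewrite -(@esum_image _ _ _ [set: nat] S a); last by move=> i j _ _ [].
rewrite esum_mkcond; split=> [|a00].
  by apply: le_esum => i _; case: ifP.
apply: eq_esum => i _; case: ifPn => //; case: i => [//|i].
by rewrite notin_setE /= => /(_ _)[]; exists i.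
Qed.

Lemma sqnorm_shift (f : nat -> C) : (sqnorm (uni_shift f) <= sqnorm f)%E.
Proof.
have [] := @esum_succ (fun i => (csq (f i))%:E) => // i.
by rewrite lee_fin csq_ge0.
Qed.

Lemma sqnorm_shift_adj (f : nat -> C) : (sqnorm (uni_shift_adj f) <= sqnorm f)%E.
Proof.
have [i|_ E] := @esum_succ (fun i => (csq (uni_shift_adj f i))%:E).
  by rewrite lee_fin csq_ge0.
by rewrite /sqnorm -E// /= (csq_real 0) expr0n.
Qed.

(** [q^N] tends to the projection onto [e_0]. *)
Definition vacuum_proj (f : nat -> C) : nat -> C :=
  fun m => if m is 0%N then f 0%N else 0.

(** The limit of [(-q)^(min (i - j) 0) psi_letter q k i j]. *)
Definition lim_letter (k : 'I_2) (i j : 'I_3) (f : nat -> C) : nat -> C :=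
  if (i == k :> nat) && (j == k :> nat) then uni_shift f
  else if (i == k.+1 :> nat) && (j == k.+1 :> nat) then uni_shift_adj f
  else if (i == k :> nat) && (j == k.+1 :> nat) then vacuum_proj f
  else if (i == k.+1 :> nat) && (j == k :> nat) then vacuum_proj f
  else if i == j then f else fun=> 0.

Definition scaled_letter (q : R) (k : 'I_2) (i j : 'I_3) (f : nat -> C) : nat -> C :=
  fun m => (((- q) ^+ (j - i))^-1)%:C%C * psi_letter q k i j f m.

Lemma sqrt_bounds (q : R) (m : nat) : 0 < q < 1 ->
  [/\ 0 <= Num.sqrt (1 - q ^+ (2 * m)) <= 1 &
   m != 0%N -> (Num.sqrt (1 - q ^+ (2 * m)) - 1) ^+ 2 <= q].
Proof.
move=> /andP[q0 q1]; set x := q ^+ (2 * m).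
have x01 : 0 <= x <= 1 by rewrite exprn_ge0 ?exprn_ile1 ?(ltW q0) ?(ltW q1).
have /andP[x0 x1] := x01.
have s0 := sqrtr_ge0 (1 - x); have ss : Num.sqrt (1 - x) ^+ 2 = 1 - x.
  by rewrite sqr_sqrtr// subr_ge0.
move: (Num.sqrt _) s0 ss => s s0 ss.
have s1 : s <= 1 by nra.
split; first by rewrite s0.
case: m @x x01 x0 x1 ss => [//|m] x x01 x0 x1 ss _.
have : x <= q.
  by rewrite /x mulnS addSn exprS ler_piMr ?(ltW q0)// exprn_ile1 ?(ltW q0) ?(ltW q1).
nra.
Qed.

Lemma pow_bounds (q : R) (m : nat) : 0 < q < 1 ->
  (q ^+ m) ^+ 2 <= 1 /\ (q ^+ m - (m == 0%N)%:R) ^+ 2 <= q.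
Proof.
move=> /andP[q0 q1].
have x0 n : 0 <= q ^+ n by rewrite exprn_ge0 ?(ltW q0).
have x1 n : q ^+ n <= 1 by rewrite exprn_ile1 ?(ltW q0) ?(ltW q1).
split; first by have := x0 m; have := x1 m; nra.
case: m => [|m]; first by rewrite subrr expr0n ltW.
rewrite subr0; have yq : q ^+ m.+1 <= q by rewrite exprS ler_piMr ?(ltW q0).
by have := x0 m.+1; move: (q ^+ m.+1) yq => y yq y0; nra.
Qed.

Lemma op_lim_diag_pow : op_lim (fun q => diag (fun m => q ^+ m)) vacuum_proj.
Proof.
split.
- by move=> c f g [|i] //=; rewrite mulr0 addr0.
- by move=> q _ c f g i; rewrite /diag; ring.
exists 1; split.
  split=> // f; rewrite (_ : vacuum_proj f = diag (fun m => (m == 0%N)%:R) f).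
    by apply: sqnorm_diag => // -[|m] /=; rewrite expr2 ?mulr1 ?mulr0.
  by apply/funext => -[|m]; rewrite /diag /= ?mul1r ?mul0r.
move=> q q01; split.
  by split=> // f; apply: sqnorm_diag => // m; have [] := pow_bounds m q01.
have q0 : 0 <= q by case/andP: q01 => /ltW.
rewrite mul1r; apply: (@eq_bounded_op _ _ (diag (fun m => q ^+ m - (m == 0%N)%:R))).
  move=> f [|m]; rewrite /diag /= ?subr0// rmorphB rmorph1 mulrBl mul1r.
  by [].
by split=> // f; apply: sqnorm_diag => // m; have [] := pow_bounds m q01.
Qed.

(** The error of [sqrt (1 - q^(2 m))] against 1 is small for positive [m] only; the
   shifts allow to replace the entry at 0 by 0. *)
Let root_err (q : R) m : R := if m is 0%N then 0 else Num.sqrt (1 - q ^+ (2 * m)) - 1.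

Lemma root_err_le q m : 0 < q < 1 -> root_err q m ^+ 2 <= q.
Proof.
case: m => [/andP[/ltW q0 _]|m q01]; first by rewrite expr0n.
by have [_ ->] := sqrt_bounds m.+1 q01.
Qed.

Lemma root_sqr_le (q : R) m : 0 < q < 1 -> Num.sqrt (1 - q ^+ (2 * m)) ^+ 2 <= 1.
Proof. by move=> /(sqrt_bounds m)[/andP[s0 s1] _]; rewrite exprn_ile1. Qed.

Lemma op_lim_shift : op_lim
  (fun q f => uni_shift (diag (fun m => Num.sqrt (1 - q ^+ (2 * m))) f)) (@uni_shift R).
Proof.
split.
- by move=> c f g i.
- by move=> q _ c f g i; rewrite /uni_shift /diag; ring.
exists 1; split.
  by split=> // f; rewrite mul1e; exact: sqnorm_shift.
move=> q q01; split.
  split=> // f; apply: le_trans (sqnorm_shift _) _.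
  by apply: sqnorm_diag => // m; exact: root_sqr_le.
have q0 : 0 <= q by case/andP: q01 => /ltW.
rewrite mul1r; apply: (@eq_bounded_op _ _ (fun f => uni_shift (diag (root_err q) f))).
  by move=> f m; rewrite /uni_shift /diag /= rmorphB rmorph1 mulrBl mul1r.
split=> // f; apply: le_trans (sqnorm_shift _) _.
by apply: sqnorm_diag => // m; exact: root_err_le.
Qed.

Lemma op_lim_shift_adj : op_lim
  (fun q f => diag (fun m => Num.sqrt (1 - q ^+ (2 * m))) (uni_shift_adj f)) (@uni_shift_adj R).
Proof.
have lin c f g i : uni_shift_adj (fun j => c * f j + g j) i =
    c * uni_shift_adj f i + uni_shift_adj g i :> C.
  by case: i => [|i] //=; rewrite mulr0 addr0.
split=> //.
- by move=> q _ c f g i; rewrite /diag lin; ring.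
exists 1; split.
  by split=> // f; rewrite mul1e; exact: sqnorm_shift_adj.
move=> q q01; split.
  split=> // f; apply: (@le_trans _ _ (1%:E * sqnorm (uni_shift_adj f))%E).
    by apply: sqnorm_diag => // m; exact: root_sqr_le.
  by rewrite !mul1e; exact: sqnorm_shift_adj.
have q0 : 0 <= q by case/andP: q01 => /ltW.
rewrite mul1r; apply: (@eq_bounded_op _ _ (fun f => diag (root_err q) (uni_shift_adj f))).
  by move=> f [|m]; rewrite /diag /= ?mulr0 ?subr0// rmorphB rmorph1 mulrBl mul1r.
split=> // f; apply: (@le_trans _ _ (q%:E * sqnorm (uni_shift_adj f))%E).
  by apply: sqnorm_diag => // m; exact: root_err_le.
by rewrite lee_wpmul2l ?lee_fin//; exact: sqnorm_shift_adj.
Qed.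

Lemma op_lim_letter k i j :
  op_lim (fun q => scaled_letter q k i j) (lim_letter k i j).
Proof.
have sc0 (q : R) (c : C) : (((- q) ^+ 0)^-1)%:C%C * c = c.
  by rewrite expr0 invr1 mul1r.
case b1: ((i == k :> nat) && (j == k :> nat)).
  apply: eq_op_lim op_lim_shift => [q _ f m|f m];
    rewrite /scaled_letter /psi_letter /lim_letter b1//.
  by move/andP: b1 => [/eqP -> /eqP ->]; rewrite subnn sc0.
case b2: ((i == k.+1 :> nat) && (j == k.+1 :> nat)).
  apply: eq_op_lim op_lim_shift_adj => [q _ f m|f m];
    rewrite /scaled_letter /psi_letter /lim_letter b1 b2//.
  by move/andP: b2 => [/eqP -> /eqP ->]; rewrite subnn sc0.
case b3: ((i == k :> nat) && (j == k.+1 :> nat)).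
  apply: eq_op_lim op_lim_diag_pow => [q /andP[q0 _] f m|f m];
    rewrite /scaled_letter /psi_letter /lim_letter b1 b2 b3//.
  move/andP: b3 => [/eqP -> /eqP ->]; rewrite subSnn expr1 /diag mulrA -rmorphM.
  by rewrite exprS -mulNr mulKf// oppr_eq0 gt_eqF.
case b4: ((i == k.+1 :> nat) && (j == k :> nat)).
  apply: eq_op_lim op_lim_diag_pow => [q _ f m|f m];
    rewrite /scaled_letter /psi_letter /lim_letter b1 b2 b3 b4//.
  move/andP: b4 => [/eqP -> /eqP ->].
  by rewrite (_ : k - k.+1 = 0)%N ?sc0//; apply/eqP; rewrite subn_eq0.
case b5: (i == j).
  apply: (@eq_op_lim _ (fun q f => f) _ (fun f => f)) => [q _ f m|f m|];
    rewrite /scaled_letter /psi_letter /lim_letter ?b1 ?b2 ?b3 ?b4 ?b5//.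
    by move/eqP: b5 => ->; rewrite subnn sc0.
  split=> //; exists 1; split; first by split=> // f; rewrite mul1e.
  move=> q /andP[/ltW q0 _]; split; first by split=> // f; rewrite mul1e.
  rewrite mul1r; split=> // f; rewrite /sqnorm esum1.
    by rewrite mule_ge0// ?lee_fin// sqnorm_ge0.
  by move=> m _; rewrite subrr (csq_real 0) expr0n.
apply: eq_op_lim (@op_lim0 _) => [q _ f m|f m];
  rewrite /scaled_letter /psi_letter /lim_letter b1 b2 b3 b4 b5//.
by rewrite mulr0.
Qed.

(** ** Words *)

(** The limit of [(-q)^(min (i - j) 0) psi_word q w i j].  By the recursion for
   [psi_word], the scaling of the term through [l] leaves the factor
   [(-q)^((l - i) + (j - l) - (j - i))] with truncated subtractions, so that in
   the limit only the [l] between [i] and [j] survive. *)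
Fixpoint lim_word (w : seq 'I_2) (i j : 'I_3) :
    ((size w).-tuple nat -> C) -> (size w).-tuple nat -> C :=
  match w with
  | [::] => fun f m => (i == j)%:R * f m
  | k :: w' => fun f m => \sum_(l < 3)
      ((l - i) + (j - l) - (j - i) == 0)%N%:R *
      tensor (lim_letter k i l) (@lim_word w' l j) f m
  end.
#[global] Arguments lim_word : clear implicits.

Definition scaled_word (q : R) (w : seq 'I_2) (i j : 'I_3)
    (f : (size w).-tuple nat -> C) (m : (size w).-tuple nat) : C :=
  (((- q) ^+ (j - i))^-1)%:C%C * psi_word q w i j f m.

Lemma op_lim_nil (a : C) : op_lim (fun _ (f : 0.-tuple nat -> C) m => a * f m)
  (fun f m => a * f m).
Proof.
have b : bounded_op (csq a * 1) (fun (f : 0.-tuple nat -> C) m => a * f m).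
  by apply: (@bounded_op_scale _ a 1 (fun f => f)); split=> // f; rewrite mul1e.
split.
- by move=> c f g i; ring.
- by move=> q _ c f g i; ring.
exists (csq a * 1); split=> // q /andP[/ltW q0 _]; split=> //.
apply: (@bounded_op_le _ 0); first by rewrite mulr1 mulr_ge0 ?csq_ge0.
have [_ _ [L [[_ b0] _]]] := op_lim0 (0.-tuple nat); split=> // f.
rewrite mul0e /sqnorm esum1// => m _.
by rewrite subrr (csq_real 0) expr0n.
Qed.

Lemma psi_letter_linear q k i j (c : C) f m :
  psi_letter q k i j (fun a => c * f a) m = c * psi_letter q k i j f m.
Proof.
rewrite /psi_letter; case: ifP => _; first by rewrite /uni_shift /diag; ring.
case: ifP => _; first by case: m => [|m]; rewrite /diag /=; ring.
case: ifP => _; first by rewrite /diag; ring.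
case: ifP => _; first by rewrite /diag; ring.
by case: ifP => _ //; rewrite mulr0.
Qed.

Lemma op_lim_word w i j : op_lim (fun q => scaled_word q i j) (lim_word w i j).
Proof.
elim: w i j => [|k w IH] i j.
  apply: eq_op_lim (op_lim_nil ((i == j)%:R)) => // q _ f m.
  rewrite /scaled_word /=; case: eqP => [->|_]; last by rewrite !mul0r mulr0.
  by rewrite subnn expr0 invr1 !mul1r.
rewrite /scaled_word /=.
have := op_lim_sum (fun l => op_lim_pow ((l - i) + (j - l) - (j - i))
  (op_lim_tensor (op_lim_letter k i l) (IH l j))).
apply: eq_op_lim => // q /andP[q0 q1] f m; rewrite mulr_sumr; apply: eq_bigr => l _.
have nq n : (- q) ^+ n != 0 by rewrite expf_neq0// oppr_eq0 gt_eqF.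
rewrite /tensor /scaled_letter /scaled_word psi_letter_linear !mulrA -!rmorphM.
congr (_%:C%C * _).
rewrite -mulrA -invfM -exprD.
have E : ((j - i) + ((l - i) + (j - l) - (j - i)) = (l - i) + (j - l))%N by lia.
by rewrite -[in X in _ * X]E exprD invfM mulrCA divff ?mulr1.
Qed.

(** ** Operators on l^2 from coordinate formulas *)

Section FromCoordinates.
Variable I : choiceType.
Implicit Types F : (I -> C) -> I -> C.

Lemma sqnorm_l2 (f : l2 R I) : sqnorm f = (l2_sq f)%:E.
Proof. by rewrite /l2_sq fineK// ge0_fin_numE ?sqnorm_ge0 ?l2_sqfin. Qed.

Lemma ell2_dotE (f : ell2 R I) : hdot (ell2 R I) f f = (l2_sq f)%:C%C.
Proof. by rewrite /l2_sq -l2_dotE. Qed.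

Lemma ell2_norm_le F M (f g : l2 R I) (r : R) : bounded_op M F -> 0 <= r ->
  M <= r ^+ 2 -> (forall i, g i = F f i) -> `|g : ell2 R I| <= r%:C%C * `|f : ell2 R I|.
Proof.
move=> [M0 bF] r0 Mr gF; apply: norm_le_hdot; first by rewrite ler0c.
rewrite !ell2_dotE.
have -> : r%:C%C ^+ 2 * (l2_sq f)%:C%C = (r ^+ 2 * l2_sq f)%:C%C by rewrite rmorphM rmorphXn.
have le : (l2_sq g)%:C%C <= (r ^+ 2 * l2_sq f)%:C%C :> C.
  rewrite lecR -lee_fin -sqnorm_l2 EFinM -sqnorm_l2.
  have -> : sqnorm g = sqnorm (F f) by congr sqnorm; apply/funext.
  by apply: le_trans (bF f) _; rewrite lee_wpmul2r ?sqnorm_ge0 ?lee_fin.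
exact: le.
Qed.

Lemma l2_operator F M : linear_op F -> bounded_op M F ->
  exists T : {linear ell2 R I -> ell2 R I}, continuous T /\
    forall (f : l2 R I) i, (T f : l2 R I) i = F f i.
Proof.
move=> lF bF; have [M0 bFf] := bF.
have sF (f : l2 R I) : F f \in @sqsummable R I.
  apply/asboolP; apply: le_lt_trans (bFf f) _.
  by rewrite sqnorm_l2 -EFinM ltry.
pose T0 (f : l2 R I) : l2 R I := MkL2 (sF f).
have T0P : linear (T0 : ell2 R I -> ell2 R I).
  move=> c f g; apply/val_inj/funext => i /=.
  exact: lF.
pose T1 := GRing.isLinear.Build _ _ _ _ (T0 : ell2 R I -> ell2 R I) T0P.
pose T : {linear ell2 R I -> ell2 R I} := HB.pack (T0 : ell2 R I -> ell2 R I) T1.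
exists T; split=> //.
apply: (@lipschitz_cont _ _ _ _ (Num.sqrt M)%:C%C).
  by rewrite ler0c sqrtr_ge0.
move=> f g; rewrite -linearB.
by apply: (ell2_norm_le bF); rewrite ?sqrtr_ge0 ?sqr_sqrtr.
Qed.

End FromCoordinates.

Lemma expr_min (q : R) (i j : 'I_3) :
  (- q) ^ Num.min (i%:Z - j%:Z) 0 = ((- q) ^+ (j - i))^-1.
Proof.
have [ij|ji] := leqP i j.
  rewrite (_ : Num.min _ _ = - ((j - i)%N)%:Z); last by lia.
  by rewrite -exprnN.
rewrite (_ : Num.min _ _ = 0); last by lia.
by rewrite (_ : (j - i)%N = 0%N) ?expr0 ?invr1//; lia.
Qed.

Lemma word_operators (w : seq 'I_2) (lambda mu : C) :
  exists2 u : R -> 'I_3 -> 'I_3 -> {linear ell2N R (size w) -> ell2N R (size w)},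
    forall q, 0 < q < 1 -> is_psi_q q lambda mu (u q) &
    forall i j (L : ell2N R (size w) -> ell2N R (size w)),
      (forall (f : l2 R _) m, (L f : l2 R _) m = phase lambda mu i * lim_word w i j f m) ->
      norm_limit0 (fun q f => ((- q) ^ Num.min (i%:Z - j%:Z) 0)%:C%C *: u q i j f) L.
Proof.
have ex q i j : exists T : {linear ell2N R (size w) -> ell2N R (size w)},
    0 < q < 1 -> continuous T /\ forall (f : l2 R _) m,
      (T f : l2 R _) m = phase lambda mu i * psi_word q w i j f m.
  have [q01|] := boolP (0 < q < 1); last by exists \0.
  have [_ /(_ q q01) lw [M [_ /(_ q q01)[bw _]]]] := op_lim_word w i j.
  have nq : (- q) ^+ (j - i) != 0 by case/andP: q01 => q0 _; rewrite expf_neq0// oppr_eq0 gt_eqF.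
  pose c : C := phase lambda mu i * ((- q) ^+ (j - i))%:C%C.
  have lc : linear_op (fun (f : (size w).-tuple nat -> C) m => c * scaled_word q i j f m).
    by move=> a f g m; rewrite lw; ring.
  have [T [Tc TE]] := l2_operator lc (bounded_op_scale c bw).
  exists T => _; split=> // f m; rewrite TE /c /scaled_word -mulrA; congr (_ * _).
  by rewrite mulrA -rmorphM divff// mul1r.
have [u uE] := choice (fun p : R * 'I_3 * 'I_3 => ex p.1.1 p.1.2 p.2).
exists (fun q i j => u (q, i, j)) => [q q01 i j|i j L LE e e0].
  exact: (uE (q, i, j) q01).
have [_ _ [M [[M0 _] bw]]] := op_lim_word w i j.
(* The rate is [csq (phase lambda mu i) * M * q]; the summand 1 makes [K] positive. *)
pose K := csq (phase lambda mu i) * M + 1.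
have K0 : 0 < K by rewrite ltr_wpDl// mulr_ge0// csq_ge0.
have r0 : 0 < Num.min 1 (e ^+ 2 / K) by rewrite lt_min ltr01 divr_gt0// exprn_gt0.
near=> q => f.
have q0 : 0 < q by near: q; exact: nbhs_right_gt.
have qr : q < Num.min 1 (e ^+ 2 / K) by near: q; exact: nbhs_right_lt.
have /andP[q1 qe] : (q < 1) && (q < e ^+ 2 / K) by rewrite -lt_min.
have q01 : 0 < q < 1 by rewrite q0.
have [_ b2] := bw q q01.
apply: (ell2_norm_le (bounded_op_scale (phase lambda mu i) b2)) (ltW e0) _ _.
  rewrite mulrA; apply: (@le_trans _ _ (K * q)).
    by rewrite ler_wpM2r ?(ltW q0)// lerDl.
  by rewrite mulrC -ler_pdivlMr// ltW.
move=> m; have [_ uf] := uE (q, i, j) q01.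
transitivity (((- q) ^ Num.min (i%:Z - j%:Z) 0)%:C%C * (u (q, i, j) f : l2 R _) m -
   (L f : l2 R _) m) => //.
by rewrite uf LE /= expr_min /scaled_word mulrCA -mulrBr.
Unshelve. all: by end_near.
Qed.

End CoordinateOperators.

(** ** Limits of words, on lists *)

Section LimitOnLists.
Variable R : realType.
Local Notation C := R[i].

Lemma ord3P (i : 'I_3) : [\/ i = o1, i = o2 | i = o3].
Proof.
case: i => [[|[|[|//]]] lt]; [apply: Or31|apply: Or32|apply: Or33]; exact: val_inj.
Qed.

Lemma sum3 (V : nmodType) (F : 'I_3 -> V) : \sum_(l < 3) F l = F o1 + (F o2 + F o3).
Proof.
rewrite !big_ord_recl big_ord0 addr0.
by congr (F _ + (F _ + F _)); exact: val_inj.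
Qed.

(** [lim_letter] and [lim_word] on plain numbers and lists, where they compute. *)
Definition letter_list (k i j : nat) (f : nat -> C) (m : nat) : C :=
  if eqn i k && eqn j k then f m.+1
  else if eqn i k.+1 && eqn j k.+1 then (if m is p.+1 then f p else 0)
  else if eqn i k && eqn j k.+1 then (if m is 0%N then f 0%N else 0)
  else if eqn i k.+1 && eqn j k then (if m is 0%N then f 0%N else 0)
  else if eqn i j then f m else 0.

Fixpoint lim_list (w : seq nat) (i j : nat) (f : seq nat -> C) (m : seq nat) : C :=
  match w, m with
  | k :: w', a :: t =>
      let term l :=
        if Nat.sub (Nat.add (Nat.sub l i) (Nat.sub j l)) (Nat.sub j i) is 0%N then
          letter_list k i l (fun b => lim_list w' l j (fun s => f (b :: s)) t) a
        else 0 in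
      term 0%N + (term 1%N + term 2%N)
  | _, _ => if eqn i j then f m else 0
  end.

Lemma lim_wordE (w : seq 'I_2) i j (f : seq nat -> C) (m : (size w).-tuple nat) :
  lim_word w i j (fun n => f (val n)) m = lim_list [seq val k | k <- w] i j f (val m).
Proof.
elim: w i j f m => [|k w IH] i j f m.
  rewrite tuple0 /= -[eqn i j]/(i == j :> nat) val_eqE.
  by case: eqP => _; rewrite ?mul1r ?mul0r.
rewrite [m]tuple_eta /= sum3.
have E (l : 'I_3) : ((l - i + (j - l) - (j - i) == 0)%N)%:R *
     tensor (lim_letter k i l) (lim_word w l j) (fun n => f (val n))
       [tuple of thead m :: [tuple of behead m]] =
   if Nat.sub (Nat.add (Nat.sub l i) (Nat.sub j l)) (Nat.sub j i) is 0%N then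
     letter_list k i l (fun b => lim_list [seq val k | k <- w] l j (fun s => f (b :: s)) (behead m)) (thead m)
   else 0.
  rewrite !minusE !plusE.
  case: (_ - (j - i))%N => [|n]; last by rewrite mul0r.
  rewrite mul1r tensor_cons.
  transitivity (lim_letter k i l (fun b => lim_list [seq val k | k <- w] l j
      (fun s => f (b :: s)) (behead m)) (thead m)).
    congr lim_letter; apply/funext => b.
    exact: (IH l j (fun s => f (b :: s)) [tuple of behead m]).
  have eE (u v : nat) : eqn u v = (u == v) by [].
  rewrite /lim_letter /letter_list !eE -(val_eqE i l).
  by do 5 (case: ifP => // _).
by rewrite !E.
Qed.

End LimitOnLists.

(** * The relations on a Hilbert space *)

Section OperatorRelations.
Variables (R : realType) (H : hilbertSpace R).
Local Notation C := R[i].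
Local Notation "''[' u , v ]" := (hdot H u v).
Implicit Types (Z : 'I_3 -> 'I_3 -> H -> H) (x y u v g : H).

(** All nine formulas for the adjoints have this shape: [z_ij^*] is the diagonal
   product of the minor complementary to [(i, j)]. *)
Definition minor_op Z (i j : 'I_3) x : H :=
  Z (lift i s1) (lift j s1) (Z (lift i s2) (lift j s2) x).

Record oprel Z : Prop := {
  op_lin : forall i j (c : C) x y, Z i j (c *: x + y) = c *: Z i j x + Z i j y;
  op_row : forall (i j l : 'I_3) x, (j < l)%N -> Z i j (Z i l x) = 0;
  op_col : forall (i j k : 'I_3) x, (i < k)%N -> Z i j (Z k j x) = 0;
  op_anti : forall (i j k l : 'I_3) x, (i < k)%N -> (j < l)%N ->
    Z i l (Z k j x) = Z k j (Z i l x);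
  op_anti0 : forall (i j k l : 'I_3) x, (i < k)%N -> (j < l)%N ->
    (maxn i j >= minn k l)%N -> Z i l (Z k j x) = 0;
  op_diag : forall (i j k l : 'I_3) x, (i < k)%N -> (j < l)%N ->
    ((maxn i j).+1 < minn k l)%N -> Z i j (Z k l x) = Z k l (Z i j x);
  op_diag1 : forall (i j k l : 'I_3) x, (i < k)%N -> (j < l)%N ->
    (maxn i j).+1 = minn k l ->
    Z i j (Z k l x) - Z k l (Z i j x) = Z i l (Z k j x);
  op_det : forall x, Z o1 o1 (Z o2 o2 (Z o3 o3 x)) = x;
  op_adj : forall i j x y, '[Z i j x, y] = '[x, minor_op Z i j y];
  op_star_comm : forall (i j r s : 'I_3) x, i != r -> j != s ->
    minor_op Z i j (Z r s x) = Z r s (minor_op Z i j x) }.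

(** The relations are homogeneous in each row; the conditions on the phases are
   those that the formulas for the adjoints and the determinant impose. *)
Lemma oprel_gauge Z (d : 'I_3 -> C) : oprel Z ->
  (forall i : 'I_3, d (lift i s1) * d (lift i s2) = Num.conj (d i)) ->
  d o1 * (d o2 * d o3) = 1 ->
  oprel (fun i j x => d i *: Z i j x).
Proof.
move=> O dd d1.
have ZZ i j (c : C) x : Z i j (c *: x) = c *: Z i j x.
  have Z0 : Z i j 0 = 0.
    have := op_lin O i j 1 0 0; rewrite !scale1r addr0 => /eqP.
    by rewrite -subr_eq0 opprD addNKr oppr_eq0 => /eqP.
  by have := op_lin O i j c x 0; rewrite Z0 !addr0.
split.
- by move=> i j c x y; rewrite (op_lin O) scalerDr !scalerA mulrC.
- by move=> i j l x jl; rewrite ZZ (op_row O)// !scaler0.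
- by move=> i j l x jl; rewrite ZZ (op_col O)// !scaler0.
- by move=> i j k l x ik jl; rewrite !ZZ (op_anti O)// !scalerA mulrC.
- by move=> i j k l x ik jl m; rewrite !ZZ (op_anti0 O)// !scaler0.
- by move=> i j k l x ik jl m; rewrite !ZZ (op_diag O)// !scalerA mulrC.
- move=> i j k l x ik jl m; rewrite !ZZ !scalerA (mulrC (d k)) -scalerBr.
  by rewrite (op_diag1 O).
- by move=> x; rewrite !ZZ !scalerA (op_det O) -mulrA d1 scale1r.
- move=> i j x y; rewrite /minor_op ZZ scalerA dd hdotZl hdotZr conjCK.
  by congr (_ * _); exact: (op_adj O).
- move=> i j r s x ir js; rewrite /minor_op !ZZ !scalerA -/(minor_op Z i j _).
  rewrite -/(minor_op Z i j (Z r s x)) (op_star_comm O)// /minor_op.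
  by congr (_ *: _); ring.
Qed.

Section Consequences.
Variable Z : 'I_3 -> 'I_3 -> H -> H.
Hypothesis O : oprel Z.
Local Notation D := (minor_op Z).
Local Notation z11 := (Z o1 o1).
Local Notation z12 := (Z o1 o2).
Local Notation z13 := (Z o1 o3).
Local Notation z21 := (Z o2 o1).
Local Notation z22 := (Z o2 o2).
Local Notation X := (Z o2 o3).
Local Notation z31 := (Z o3 o1).
Local Notation Y := (Z o3 o2).
Local Notation V := (Z o3 o3).
Local Notation W := (D o1 o1).
Local Notation Vs := (D o3 o3).
Local Notation Xs := (D o2 o3).
Local Notation Ys := (D o3 o2).

Lemma op0 i j : Z i j 0 = 0.
Proof.
have := op_lin O i j 1 0 0; rewrite !scale1r addr0 => /eqP.
by rewrite -subr_eq0 opprD addNKr oppr_eq0 => /eqP.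
Qed.
Lemma opZ i j (c : C) x : Z i j (c *: x) = c *: Z i j x.
Proof. by have := op_lin O i j c x 0; rewrite op0 !addr0. Qed.
Lemma opD i j x y : Z i j (x + y) = Z i j x + Z i j y.
Proof. by have := op_lin O i j 1 x y; rewrite !scale1r. Qed.
Lemma opB i j x y : Z i j (x - y) = Z i j x - Z i j y.
Proof. by rewrite opD -scaleN1r opZ scaleN1r. Qed.
Lemma minor0 i j : D i j 0 = 0.
Proof. by rewrite /minor_op !op0. Qed.
Lemma minorB i j x y : D i j (x - y) = D i j x - D i j y.
Proof. by rewrite /minor_op !opB. Qed.
Lemma minorZ i j (c : C) x : D i j (c *: x) = c *: D i j x.
Proof. by rewrite /minor_op !opZ. Qed.

Lemma minor_adj i j x y : '[D i j x, y] = '[x, Z i j y].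
Proof. by rewrite hdotC -(op_adj O) -hdotC. Qed.

Lemma lift3 : (lift o1 s1 = o2) * (lift o1 s2 = o3) * (lift o2 s1 = o1) *
  (lift o2 s2 = o3) * (lift o3 s1 = o1) * (lift o3 s2 = o2).
Proof. by do !split; apply/val_inj. Qed.

Lemma minorE x : (W x = z22 (V x)) * (D o1 o2 x = z21 (V x)) * (D o1 o3 x = z21 (Y x)) *
  (D o2 o1 x = z12 (V x)) * (D o2 o2 x = z11 (V x)) * (Xs x = z11 (Y x)) *
  (D o3 o1 x = z12 (X x)) * (Ys x = z11 (X x)) * (Vs x = z11 (z22 x)).
Proof. by rewrite /minor_op !lift3. Qed.

Lemma minor_mul0 i j r s : (forall x, Z i j (Z r s x) = 0) ->
  forall x, D r s (D i j x) = 0.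
Proof.
move=> E x; apply: hdot_ext => v; rewrite !minor_adj E.
by rewrite hdot0r hdot0l.
Qed.

Lemma minor_comm i j r s : (forall x, Z i j (Z r s x) = Z r s (Z i j x)) ->
  forall x, D i j (D r s x) = D r s (D i j x).
Proof. by move=> E x; apply: hdot_ext => v; rewrite !minor_adj E. Qed.

(** ** The isometry z33 and the kernel G of its adjoint *)

Lemma XsE x : Xs x = z11 (Y x). Proof. by rewrite minorE. Qed.
Lemma YsE x : Ys x = z11 (X x). Proof. by rewrite minorE. Qed.

Lemma VsV x : Vs (V x) = x.
Proof. by rewrite !minorE (op_det O). Qed.
Lemma z11V x : z11 (V x) = V (z11 x).
Proof. exact: (op_diag O). Qed.
Lemma WV x : W (V x) = V (W x).
Proof. exact: (op_star_comm O). Qed.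
Lemma VsW x : Vs (W x) = W (Vs x).
Proof. by rewrite (minor_comm (fun x => esym (z11V x))). Qed.
Lemma XY x : X (Y x) = Y (X x).
Proof. exact: (op_anti O). Qed.

Lemma XsX x : Xs (X x) = x - V (Vs x).
Proof.
rewrite minorE -XY -(@op_diag1 Z O o2 o2 o3 o3)// opB (op_det O) z11V.
by rewrite (minorE x).
Qed.
Lemma YsY x : Ys (Y x) = x - V (Vs x).
Proof. by rewrite -XsX !minorE XY. Qed.

Lemma XV x : X (V x) = 0. Proof. exact: (op_col O). Qed.
Lemma YV x : Y (V x) = 0. Proof. exact: (op_row O). Qed.
Lemma z13V x : z13 (V x) = 0. Proof. exact: (op_col O). Qed.
Lemma z31V x : z31 (V x) = 0. Proof. exact: (op_row O). Qed.
Lemma XsV x : Xs (V x) = 0. Proof. by rewrite minorE YV op0. Qed.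
Lemma YsV x : Ys (V x) = 0. Proof. by rewrite minorE XV op0. Qed.
Lemma z13sV x : D o1 o3 (V x) = 0. Proof. by rewrite minorE YV op0. Qed.
Lemma z31sV x : D o3 o1 (V x) = 0. Proof. by rewrite minorE XV op0. Qed.

Lemma VsX x : Vs (X x) = 0. Proof. by rewrite minorE (op_row O)// op0. Qed.
Lemma VsY x : Vs (Y x) = 0. Proof. by rewrite minorE (op_col O)// op0. Qed.
Lemma Vsz13 x : Vs (z13 x) = 0.
Proof. by rewrite minorE -(@op_anti Z O o1 o2 o2 o3)// (@op_anti0 Z O o1 o2 o2 o3)// op0. Qed.
Lemma Vsz31 x : Vs (z31 x) = 0.
Proof. by rewrite minorE (@op_anti0 Z O o2 o1 o3 o2)// op0. Qed.
Lemma VsXs x : Vs (Xs x) = 0. Proof. exact: minor_mul0 XV x. Qed.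
Lemma VsYs x : Vs (Ys x) = 0. Proof. exact: minor_mul0 YV x. Qed.
Lemma Vsz13s x : Vs (D o1 o3 x) = 0. Proof. exact: minor_mul0 z13V x. Qed.
Lemma Vsz31s x : Vs (D o3 o1 x) = 0. Proof. exact: minor_mul0 z31V x. Qed.

Lemma XsY x : Xs (Y x) = Y (Xs x). Proof. exact: (op_star_comm O). Qed.
Lemma YsX x : Ys (X x) = X (Ys x). Proof. exact: (op_star_comm O). Qed.
Lemma XsYs x : Xs (Ys x) = Ys (Xs x). Proof. exact: minor_comm XY x. Qed.

Lemma z13X x : z13 (X x) = 0. Proof. exact: (op_col O). Qed.
Lemma z31Y x : z31 (Y x) = 0. Proof. exact: (op_row O). Qed.
Lemma z13Y x : z13 (Y x) = Y (z13 x). Proof. exact: (op_anti O). Qed.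
Lemma z31X x : z31 (X x) = X (z31 x).
Proof. by rewrite (@op_anti Z O o2 o1 o3 o3). Qed.
Lemma z13sX x : D o1 o3 (X x) = 0. Proof. by rewrite minorE -XY (op_row O). Qed.
Lemma z31sY x : D o3 o1 (Y x) = 0. Proof. by rewrite minorE XY (op_col O). Qed.
Lemma z13sY x : D o1 o3 (Y x) = Y (D o1 o3 x). Proof. exact: (op_star_comm O). Qed.
Lemma z31sX x : D o3 o1 (X x) = X (D o3 o1 x). Proof. exact: (op_star_comm O). Qed.
Lemma Xsz13 x : Xs (z13 x) = 0.
Proof. by rewrite minorE -z13Y (op_row O). Qed.
Lemma Ysz31 x : Ys (z31 x) = 0.
Proof. by rewrite minorE -z31X (op_col O). Qed.
Lemma Xsz13s x : Xs (D o1 o3 x) = 0. Proof. exact: minor_mul0 z13X x. Qed.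
Lemma Ysz31s x : Ys (D o3 o1 x) = 0. Proof. exact: minor_mul0 z31Y x. Qed.

Lemma Ysz13 x : Ys (z13 x) = z13 (Ys x). Proof. exact: (op_star_comm O). Qed.
Lemma Xsz31 x : Xs (z31 x) = z31 (Xs x). Proof. exact: (op_star_comm O). Qed.
Lemma Ysz13s x : Ys (D o1 o3 x) = D o1 o3 (Ys x).
Proof. by rewrite (minor_comm z13Y). Qed.
Lemma Xsz31s x : Xs (D o3 o1 x) = D o3 o1 (Xs x).
Proof. by rewrite (minor_comm z31X). Qed.

Lemma z13z31 x : z13 (z31 x) = z31 (z13 x). Proof. exact: (op_anti O). Qed.
Lemma z31sz13 x : D o3 o1 (z13 x) = z13 (D o3 o1 x).
Proof. exact: (op_star_comm O). Qed.

(** The next six lemmas compute the supports of the normal operators [z13] and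
   [z31]: expand the adjoint as a product of two generators and use the
   commutation relations of [z11] with [X] and [Y]. *)
Lemma z13z21 x : z13 (z21 x) = z11 (X x) - X (z11 x).
Proof. by rewrite (@op_diag1 Z O o1 o1 o2 o3). Qed.
Lemma z12z31 x : z12 (z31 x) = z11 (Y x) - Y (z11 x).
Proof. by rewrite (@op_diag1 Z O o1 o1 o3 o2). Qed.

Lemma z13z13s x : z13 (D o1 o3 x) = x - V (Vs x) - X (Xs x).
Proof. by rewrite minorE z13z21 -XsX !minorE XY. Qed.
Lemma z13sz13 x : D o1 o3 (z13 x) = x - V (Vs x) - X (Xs x).
Proof. by rewrite -z13z13s !minorE -z13Y (@op_anti Z O o1 o1 o2 o3). Qed.
Lemma z31z31s x : z31 (D o3 o1 x) = x - V (Vs x) - Y (Ys x).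
Proof. by rewrite minorE -(@op_anti Z O o1 o1 o3 o2)// z12z31 -YsY !minorE XY. Qed.
Lemma z31sz31 x : D o3 o1 (z31 x) = x - V (Vs x) - Y (Ys x).
Proof. by rewrite -z31z31s !minorE -z31X (@op_anti Z O o1 o1 o3 o2). Qed.

Lemma z13_G g : Vs g = 0 -> z13 (D o1 o3 g) = g - X (Xs g).
Proof. by move=> Gg; rewrite z13z13s Gg op0 subr0. Qed.
Lemma z31_G g : Vs g = 0 -> z31 (D o3 o1 g) = g - Y (Ys g).
Proof. by move=> Gg; rewrite z31z31s Gg op0 subr0. Qed.

(** ** The generators on G *)

(** The component of [W g] outside the range of [X] is [z13 z13^* W g], which
   vanishes because [z11 z13 = 0].  The next three lemmas use the splittings
   [g = X X^* g + z13 z13^* g] and [g = Y Y^* g + z31 z31^* g]. *)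
Lemma W_G g : Vs g = 0 -> W g = X (Y g).
Proof.
move=> Gg; have XsW : Xs (W g) = Y g.
  by apply: hdot_ext => v; rewrite !minor_adj -YsE -(op_adj O).
have z13sW : D o1 o3 (W g) = 0.
  apply: hdot_ext => v; rewrite !minor_adj (op_row O)//.
  by rewrite hdot0r hdot0l.
have GW : Vs (W g) = 0 by rewrite VsW Gg minor0.
have := z13_G GW; rewrite z13sW op0 XsW => /esym/eqP.
by rewrite subr_eq0 => /eqP.
Qed.

Lemma z11_G g : Vs g = 0 -> z11 g = Ys (Xs g).
Proof.
move=> Gg; rewrite -{1}(subrK (X (Xs g)) g) -z13_G// opD.
by rewrite (@op_row Z O o1 o1 o3)// add0r YsE.
Qed.

Lemma z21_G g : Vs g = 0 -> z21 g = D o1 o3 (Ys g).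
Proof.
move=> Gg; rewrite -{1}(subrK (X (Xs g)) g) -z13_G// opD.
rewrite (@op_row Z O o2 o1 o3)// addr0 -(@op_anti Z O o1 o1 o2 o3)// z13z21.
have -> : z11 (D o1 o3 g) = 0 by rewrite minorE (@op_col Z O o1 o1 o2).
by rewrite op0 subr0 -YsE (minor_comm z13Y).
Qed.

Lemma z12_G g : Vs g = 0 -> z12 g = D o3 o1 (Xs g).
Proof.
move=> Gg; rewrite -{1}(subrK (Y (Ys g)) g) -z31_G// opD.
rewrite (@op_col Z O o1 o2 o3)// addr0 z12z31.
have -> : z11 (D o3 o1 g) = 0 by rewrite minorE (@op_row Z O o1 o1 o2).
by rewrite op0 subr0 -XsE (minor_comm z31X).
Qed.

Lemma z21V x : z21 (V x) = V (z21 x) + X (z31 x).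
Proof. by rewrite -(@op_diag1 Z O o2 o1 o3 o3)// addrC subrK. Qed.
Lemma z12V x : z12 (V x) = V (z12 x) + z13 (Y x).
Proof. by rewrite -(@op_diag1 Z O o1 o2 o3 o3)// addrC subrK. Qed.

(** ** Words in z33, z23 and z32 *)

Definition G_word (a c : nat) x : H := iter a X (iter c Y x).
Definition word (a b c : nat) x : H := iter b V (G_word a c x).

Lemma Vs_iter b g : Vs g = 0 ->
  Vs (iter b V g) = if b is b'.+1 then iter b' V g else 0.
Proof. by case: b => [//|b] _; rewrite /= VsV. Qed.

Lemma iter_V0 (T : H -> H) b g : (forall x, T (V x) = 0) ->
  T (iter b V g) = if b is b'.+1 then 0 else T g.
Proof. by case: b => [|b] TV //=. Qed.

Lemma iter_comm (T S : H -> H) n x : (forall y, T (S y) = S (T y)) ->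
  T (iter n S x) = iter n S (T x).
Proof. by move=> TS; elim: n => //= n <-. Qed.

Lemma W_iter b g : Vs g = 0 -> W (iter b V g) = iter b V (X (Y g)).
Proof. by move=> Gg; rewrite (iter_comm _ _ WV) W_G. Qed.

Lemma minor22_iter b g : Vs g = 0 ->
  D o2 o2 (iter b V g) = iter b.+1 V (Ys (Xs g)).
Proof. by move=> Gg; rewrite minorE z11V (iter_comm _ _ z11V) z11_G. Qed.

Lemma minor12_iter b g : Vs g = 0 -> D o1 o2 (iter b V g) =
  iter b.+1 V (D o1 o3 (Ys g)) + iter b V (X (z31 g)).
Proof.
move=> Gg; rewrite minorE; elim: b => [|b IH].
  by rewrite /= z21V z21_G.
rewrite iterS z21V IH z31V op0 addr0.
by rewrite opD.
Qed.

Lemma minor21_iter b g : Vs g = 0 -> D o2 o1 (iter b V g) =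
  iter b.+1 V (D o3 o1 (Xs g)) + iter b V (z13 (Y g)).
Proof.
move=> Gg; rewrite minorE; elim: b => [|b IH].
  by rewrite /= z12V z12_G.
rewrite iterS z12V IH YV op0 addr0.
by rewrite opD.
Qed.

Lemma iter_op0 i j n : iter n (Z i j) 0 = 0.
Proof. by elim: n => //= n ->; rewrite op0. Qed.

Lemma iter_opZ i j n (c : C) x : iter n (Z i j) (c *: x) = c *: iter n (Z i j) x.
Proof. by elim: n => //= n ->; rewrite opZ. Qed.

Lemma word0 a b c : word a b c 0 = 0.
Proof. by rewrite /word /G_word !iter_op0. Qed.

Lemma wordZ a b c (t : C) x : word a b c (t *: x) = t *: word a b c x.
Proof. by rewrite /word /G_word !iter_opZ. Qed.

Lemma G_iterY c x : Vs x = 0 -> Vs (iter c Y x) = 0.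
Proof. by case: c => [//|c] _; rewrite /= VsY. Qed.

Lemma G_G_word a c x : Vs x = 0 -> Vs (G_word a c x) = 0.
Proof. by move=> Gx; case: a => [|a]; [exact: G_iterY|rewrite /= VsX]. Qed.

Lemma YG_word a c x : Y (G_word a c x) = G_word a c.+1 x.
Proof. by rewrite /G_word (iter_comm _ _ (fun y => esym (XY y))). Qed.

Lemma XsX_G g : Vs g = 0 -> Xs (X g) = g.
Proof. by move=> Gg; rewrite XsX Gg op0 subr0. Qed.
Lemma YsY_G g : Vs g = 0 -> Ys (Y g) = g.
Proof. by move=> Gg; rewrite YsY Gg op0 subr0. Qed.

Lemma Xs_word a c x : Vs x = 0 ->
  Xs (G_word a c x) = if a is a'.+1 then G_word a' c x else G_word 0 c (Xs x).
Proof.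
move=> Gx; case: a => [|a]; first by rewrite /G_word /= (iter_comm _ _ XsY).
by rewrite /G_word /= XsX_G//; exact: G_G_word.
Qed.

Lemma Ys_word a c x : Vs x = 0 ->
  Ys (G_word a c x) = if c is c'.+1 then G_word a c' x else G_word a 0 (Ys x).
Proof.
move=> Gx; rewrite /G_word (iter_comm _ _ YsX); case: c => [//|c] /=.
by rewrite YsY_G//; exact: G_iterY.
Qed.

Lemma z13_word a c x : z13 (G_word a c x) = if a is a'.+1 then 0 else G_word 0 c (z13 x).
Proof. by case: a => [|a]; rewrite /G_word /= ?z13X ?(iter_comm _ _ z13Y). Qed.
Lemma z13s_word a c x :
  D o1 o3 (G_word a c x) = if a is a'.+1 then 0 else G_word 0 c (D o1 o3 x).
Proof. by case: a => [|a]; rewrite /G_word /= ?z13sX ?(iter_comm _ _ z13sY). Qed.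
Lemma z31_word a c x : z31 (G_word a c x) = if c is c'.+1 then 0 else G_word a 0 (z31 x).
Proof.
by rewrite /G_word (iter_comm _ _ z31X); case: c => [//|c] /=; rewrite z31Y iter_op0.
Qed.
Lemma z31s_word a c x :
  D o3 o1 (G_word a c x) = if c is c'.+1 then 0 else G_word a 0 (D o3 o1 x).
Proof.
by rewrite /G_word (iter_comm _ _ z31sX); case: c => [//|c] /=; rewrite z31sY iter_op0.
Qed.

Section MinorWord.
Variables (a b c : nat) (x : H).
Hypothesis Gx : Vs x = 0.
Let Gw := G_G_word a c Gx.

Lemma minor33_word : Vs (word a b c x) = if b is b'.+1 then word a b' c x else 0.
Proof. exact: Vs_iter. Qed.
Lemma minor23_word : Xs (word a b c x) =
  if b is b'.+1 then 0 else if a is a'.+1 then word a' 0 c x else word 0 0 c (Xs x).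
Proof. by rewrite iter_V0 ?Xs_word//; exact: XsV. Qed.
Lemma minor32_word : Ys (word a b c x) =
  if b is b'.+1 then 0 else if c is c'.+1 then word a 0 c' x else word a 0 0 (Ys x).
Proof. by rewrite iter_V0 ?Ys_word//; exact: YsV. Qed.
Lemma minor13_word : D o1 o3 (word a b c x) =
  if b is b'.+1 then 0 else if a is a'.+1 then 0 else word 0 0 c (D o1 o3 x).
Proof. by rewrite iter_V0 ?z13s_word//; exact: z13sV. Qed.
Lemma minor31_word : D o3 o1 (word a b c x) =
  if b is b'.+1 then 0 else if c is c'.+1 then 0 else word a 0 0 (D o3 o1 x).
Proof. by rewrite iter_V0 ?z31s_word//; exact: z31sV. Qed.
Lemma minor11_word : W (word a b c x) = word a.+1 b c.+1 x.
Proof. by rewrite W_iter// YG_word. Qed.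
Lemma minor22_word : D o2 o2 (word a b c x) =
  match a, c with
  | a'.+1, c'.+1 => word a' b.+1 c' x
  | a'.+1, 0%N => word a' b.+1 0 (Ys x)
  | 0%N, c'.+1 => word 0 b.+1 c' (Xs x)
  | 0%N, 0%N => word 0 b.+1 0 (Ys (Xs x))
  end.
Proof.
rewrite minor22_iter// Xs_word//; case: a => [|a'].
  by rewrite Ys_word ?VsXs//; case: c.
by rewrite Ys_word//; case: c.
Qed.
Lemma minor12_word : D o1 o2 (word a b c x) =
  (if a is a'.+1 then 0 else if c is c'.+1 then word 0 b.+1 c' (D o1 o3 x)
   else word 0 b.+1 0 (D o1 o3 (Ys x))) +
  (if c is c'.+1 then 0 else word a.+1 b 0 (z31 x)).
Proof.
rewrite minor12_iter// Ys_word// z31_word; case: c => [|c'].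
  by rewrite z13s_word; case: a => [|a'] //; rewrite iter_op0.
by rewrite z13s_word op0 iter_op0; case: a => [|a'] //; rewrite iter_op0.
Qed.
Lemma minor21_word : D o2 o1 (word a b c x) =
  (if c is c'.+1 then 0 else if a is a'.+1 then word a' b.+1 0 (D o3 o1 x)
   else word 0 b.+1 0 (D o3 o1 (Xs x))) +
  (if a is a'.+1 then 0 else word 0 b c.+1 (z13 x)).
Proof.
rewrite minor21_iter// Xs_word// YG_word z13_word; case: a => [|a'].
  by rewrite z31s_word; case: c => [|c'] //; rewrite iter_op0.
by rewrite z31s_word iter_op0; case: c => [|c'] //; rewrite iter_op0.
Qed.

End MinorWord.

Definition irreducible_ops : Prop :=
  irr_family (fun p : 'I_3 * 'I_3 => Z p.1 p.2).

(** The second hypothesis says, through double orthogonality, that the adjoints map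
   [S] into its closed span; so the orthogonal complement of [S] is invariant. *)
Lemma irreducible_total (S : set H) : irreducible_ops ->
  (forall i j v y, S v -> (forall u, S u -> '[y, u] = 0) -> '[y, D i j v] = 0) ->
  (exists2 v, S v & v <> 0) ->
  forall y, (forall v, S v -> '[y, v] = 0) -> y = 0.
Proof.
move=> irr SD [v Sv v0] y yS.
pose N := [set y | forall v, S v -> '[y, v] = 0].
have [] := irr N (closed_subspace_orth S).
- by move=> [i j] u uN w Sw; rewrite /= (op_adj O); exact: SD.
- by move=> NE; have : N y := yS; rewrite NE.
- move=> NE; have Nv : N v by rewrite NE.
  by case: v0; exact: hdot_eq0 (Nv v Sv).
Qed.

(** The adjoints of the generators map words on [L] to sums of words on [L]. *)
Lemma total_words (L : set H) : irreducible_ops ->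
  (forall l, L l -> Vs l = 0) ->
  (forall l, L l -> [/\ L (Xs l), L (Ys l) & L (D o1 o3 l)] /\
     [/\ L (D o3 o1 l), L (z13 l) & L (z31 l)]) ->
  (exists2 l, L l & l <> 0) ->
  forall y, (forall a b c l, L l -> '[y, word a b c l] = 0) -> y = 0.
Proof.
move=> irr LG Lst [l0 Ll0 l00] y yL.
pose S := [set v | exists a b c l, L l /\ v = word a b c l].
apply: (@irreducible_total S irr) => [i j _ u [a [b [c [l [Ll ->]]]]] uS||_ [a [b [c [l [Ll ->]]]]]].
- have uW a' b' c' l' : L l' -> '[u, word a' b' c' l'] = 0.
    by move=> Ll'; apply: uS; exists a', b', c', l'.
  have Gl := LG l Ll; have [[L1 L2 L3] [L4 L5 L6]] := Lst l Ll.
  have [[L7 L8 _] _] := Lst _ L1; have [_ [L9 _ _]] := Lst _ L1.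
  have [[_ _ L10] _] := Lst _ L2.
  by case: (ord3P i) => ->; case: (ord3P j) => ->;
    rewrite ?(minor11_word, minor12_word, minor13_word, minor21_word, minor22_word,
      minor23_word, minor31_word, minor32_word, minor33_word)//;
    move: a b c => [|a] [|b] [|c]; rewrite ?hdotDr ?hdot0r ?uW ?addr0.
- by exists l0 => //; exists 0%N, 0%N, 0%N, l0.
- exact: yL.
Qed.

(** A vector [y] of [G] orthogonal to [L] is orthogonal to all words on [L], because
   for each letter either its adjoint kills [y] or the letter stays in [L]. *)
Lemma corner_words (L : set H) : irreducible_ops ->
  (forall l, L l -> Vs l = 0) ->
  (forall l, L l -> [/\ L (Xs l), L (Ys l) & L (D o1 o3 l)] /\
     [/\ L (D o3 o1 l), L (z13 l) & L (z31 l)]) ->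
  (exists2 l, L l & l <> 0) ->
  forall y, Vs y = 0 -> Xs y = 0 \/ (forall l, L l -> L (X l)) ->
    Ys y = 0 \/ (forall l, L l -> L (Y l)) ->
    (forall l, L l -> '[y, l] = 0) -> y = 0.
Proof.
move=> irr LG Lst Lne y Gy hX hY yL; apply: (total_words irr LG Lst Lne).
have yY c l : L l -> '[y, iter c Y l] = 0.
  case: hY => [Y0|LY] Ll.
    by case: c => [|c]; [exact: yL|rewrite /= -minor_adj Y0 hdot0l].
  by apply: yL; elim: c => //= c; exact: LY.
move=> a [|b] c l Ll; last by rewrite /word /= -minor_adj Gy hdot0l.
rewrite /word /G_word /=; case: hX => [X0|LX].
  by case: a => [|a]; [exact: yY|rewrite /= -minor_adj X0 hdot0l].
rewrite (iter_comm _ _ (fun y => esym (iter_comm a y (fun z => esym (XY z))))).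
by apply: yY; elim: a => //= a; exact: LX.
Qed.

(** Lowering both exponents: for mutually adjoint [T] and [Ts], powers of [T]
   applied to vectors that [Ts] kills are orthogonal. *)
Lemma ladder (T Ts : H -> H) m n u v :
  (forall x y, '[T x, y] = '[x, Ts y]) ->
  (forall k, Ts (iter k.+1 T v) = iter k T v) ->
  Ts u = 0 -> Ts v = 0 ->
  '[iter m T u, iter n T v] = (m == n)%:R * '[u, v].
Proof.
move=> adj lv u0 v0; elim: m n => [|m IH] [|n].
- by rewrite mul1r.
- by rewrite hdotC /= adj u0 hdot0r rmorph0 mul0r.
- by rewrite /= adj v0 hdot0r mul0r.
- by rewrite [iter m.+1 _ _]/= adj lv IH.
Qed.

Lemma word_dot a b c a' b' c' x y : Vs x = 0 -> Vs y = 0 ->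
  '[word a b c x, word a' b' c' y] =
  (b == b')%:R * '[G_word a c x, G_word a' c' y].
Proof.
move=> Gx Gy; rewrite /word (ladder _ _ (op_adj O o3 o3)) ?G_G_word// => k.
exact: VsV.
Qed.

Lemma G_word_dot a c a' c' x y : Vs x = 0 -> Vs y = 0 -> Xs x = 0 -> Xs y = 0 ->
  '[G_word a c x, G_word a' c' y] = (a == a')%:R * '[iter c Y x, iter c' Y y].
Proof.
move=> Gx Gy X0 Y0; rewrite /G_word (ladder _ _ (op_adj O o2 o3)) ?(iter_comm _ _ XsY) ?X0 ?Y0 ?iter_op0// => k.
by rewrite -/(G_word k.+1 c' y) Xs_word.
Qed.

Lemma iterY_dot c c' x y : Vs x = 0 -> Vs y = 0 -> Ys x = 0 -> Ys y = 0 ->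
  '[iter c Y x, iter c' Y y] = (c == c')%:R * '[x, y].
Proof.
move=> Gx Gy X0 Y0; rewrite (ladder _ _ (op_adj O o3 o2))// => k.
exact: (Ys_word 0 k.+1 Gy).
Qed.

(** The basis is indexed by lists rather than tuples, so that it can be given by
   pattern matching. *)
Definition word_model (w : seq 'I_2) (E : seq nat -> H) : Prop := [/\
  forall m n : (size w).-tuple nat, '[E m, E n] = (m == n)%:R,
  forall y, (forall m : (size w).-tuple nat, '[y, E m] = 0) -> y = 0 &
  forall i j x (m : (size w).-tuple nat),
    '[Z i j x, E m] = lim_word w i j (fun n => '[x, E n]) m].

Lemma word_modelI (w : seq 'I_2) (E : seq nat -> H) :
  (forall m n : (size w).-tuple nat, '[E m, E n] = (m == n)%:R) ->
  (forall y, (forall m : (size w).-tuple nat, '[y, E m] = 0) -> y = 0) ->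
  (forall i j x f, (forall s, size s = size w -> '[x, E s] = f s) ->
    forall m : (size w).-tuple nat,
    '[x, D i j (E m)] = lim_list [seq val k | k <- w] i j f m) ->
  word_model w E.
Proof.
move=> ort tot DE; split=> // i j x m.
by rewrite (op_adj O) (DE _ _ _ (fun n => '[x, E n]))// (lim_wordE i j (fun n => '[x, E n])).
Qed.

Ltac by_cases_ij i j := case: (ord3P i) => ->; case: (ord3P j) => ->;
  [rewrite minor11_word|rewrite minor12_word|rewrite minor13_word
  |rewrite minor21_word|rewrite minor22_word|rewrite minor23_word
  |rewrite minor31_word|rewrite minor32_word|rewrite minor33_word] => //.
Ltac compute_list := rewrite /= /letter_list /= ?(add0r, addr0).

Section Vacuum.
Variable om : H.
Hypothesis irr : irreducible_ops.
Hypothesis om1 : '[om, om] = 1.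
Hypothesis Gom : Vs om = 0.

Lemma om_neq0 : om <> 0.
Proof. by move=> o0; move: om1; rewrite o0 hdot0l => /esym/eqP; rewrite oner_eq0. Qed.

(** The line through the vacuum vector [om] is stable under the operators of
   [total_words] when [om] is an eigenvector of each of them. *)
Lemma line_total (t1 t2 t3 t4 t5 t6 : C) :
  Xs om = t1 *: om -> Ys om = t2 *: om -> D o1 o3 om = t3 *: om ->
  D o3 o1 om = t4 *: om -> z13 om = t5 *: om -> z31 om = t6 *: om ->
  forall y, (forall a b c, '[y, word a b c om] = 0) -> y = 0.
Proof.
move=> e1 e2 e3 e4 e5 e6 y yw.
apply: (@total_words [set l | exists t : C, l = t *: om] irr).
- by move=> _ [t ->]; rewrite minorZ Gom scaler0.
- move=> _ [t ->]; rewrite !minorZ !opZ e1 e2 e3 e4 e5 e6 !scalerA.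
  by split; split; eexists.
- by exists om; [exists 1; rewrite scale1r|exact: om_neq0].
- by move=> a b c _ [t ->]; rewrite wordZ hdotZr yw mulr0.
Qed.

Let zero_line (x : H) : x = 0 -> x = (0 : C) *: om.
Proof. by rewrite scale0r. Qed.
Let one_line (x : H) : x = om -> x = (1 : C) *: om.
Proof. by rewrite scale1r. Qed.

Lemma iter_fix (T : H -> H) n x : T x = x -> iter n T x = x.
Proof. by move=> Tx; elim: n => //= n ->. Qed.

Lemma word_fixX a b c : X om = om -> word a.+1 b c om = word 0 b c om.
Proof.
move=> Xx; rewrite /word /G_word; congr (iter b V _).
by apply: (iter_fix a.+1); rewrite (iter_comm _ _ XY) Xx.
Qed.

Lemma word_fixY a b c : Y om = om -> word a b c.+1 om = word a b 0 om.
Proof. by move=> Yx; rewrite /word /G_word !(iter_fix _ Yx). Qed.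

(** In the four models with a non-unitary [V], the relations determine the values on
   [om] of the operators that the hypotheses do not mention; a letter that fixes
   [om] disappears from the words. *)
Lemma model_s1s2s1 : Xs om = 0 -> Ys om = 0 -> z13 om = om -> z31 om = om ->
  word_model [:: s1; s2; s1]
    (fun m => if m is [:: a; b; c] then word a b c om else 0).
Proof.
move=> eX eY e13 e31.
have e13s : D o1 o3 om = om by rewrite -[in LHS]e13 z13sz13 Gom eX !op0 !subr0.
have e31s : D o3 o1 om = om by rewrite -[in LHS]e31 z31sz31 Gom eY !op0 !subr0.
apply: word_modelI.
- move=> m n; case/tupleP: m => a m; case/tupleP: m => b m; case/tupleP: m => c m.
  case/tupleP: n => a' n; case/tupleP: n => b' n; case/tupleP: n => c' n.
  rewrite (tuple0 m) (tuple0 n) /= word_dot// G_word_dot// iterY_dot// om1 mulr1.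
  rewrite -val_eqE /= !eqseq_cons eqxx andbT.
  by case: eqP; case: eqP; case: eqP; rewrite ?mul1r ?mul0r ?mulr0.
- move=> y yE; apply: (line_total (zero_line eX) (zero_line eY) (one_line e13s)
    (one_line e31s) (one_line e13) (one_line e31)) => a b c.
  exact: (yE [tuple a; b; c]).
- move=> i j x f fE m; have {}fE a b c : '[x, word a b c om] = f [:: a; b; c].
    exact: (fE [:: a; b; c]).
  case/tupleP: m => a m; case/tupleP: m => b m; case/tupleP: m => c m.
  rewrite (tuple0 m) [val _]/= [[seq _ | _ <- _]]/=.
  by_cases_ij i j; case: a => [|a]; case: b => [|b]; case: c => [|c];
    lazy beta iota; rewrite ?hdotDr ?(eX, eY, e13, e31, e13s, e31s) ?(minor0, word0)
      ?hdot0r ?fE; by compute_list.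
Qed.

Lemma model_s1s2 : Xs om = 0 -> Y om = om -> z13 om = om ->
  word_model [:: s1; s2] (fun m => if m is [:: a; b] then word a b 0 om else 0).
Proof.
move=> eX eY e13.
have eYs : Ys om = om by rewrite -[in LHS]eY YsY_G.
have e13s : D o1 o3 om = om by rewrite -[in LHS]e13 z13sz13 Gom eX !op0 !subr0.
have e31 : z31 om = 0 by rewrite -eY z31Y.
have e31s : D o3 o1 om = 0 by rewrite -eY z31sY.
apply: word_modelI.
- move=> m n; case/tupleP: m => a m; case/tupleP: m => b m.
  case/tupleP: n => a' n; case/tupleP: n => b' n.
  rewrite (tuple0 m) (tuple0 n) /= word_dot// G_word_dot//= om1 mulr1.
  rewrite -val_eqE /= !eqseq_cons eqxx andbT.
  by case: eqP; case: eqP; rewrite ?mul1r ?mul0r ?mulr0.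
- move=> y yE; apply: (line_total (zero_line eX) (one_line eYs) (one_line e13s)
    (zero_line e31s) (one_line e13) (zero_line e31)) => a b c.
  have -> : word a b c om = word a b 0 om by case: c => // c; rewrite word_fixY.
  exact: (yE [tuple a; b]).
- move=> i j x f fE m; have {}fE a b : '[x, word a b 0 om] = f [:: a; b].
    exact: (fE [:: a; b]).
  case/tupleP: m => a m; case/tupleP: m => b m.
  rewrite (tuple0 m) [val _]/= [[seq _ | _ <- _]]/=.
  by_cases_ij i j; case: a => [|a]; case: b => [|b];
    lazy beta iota; rewrite ?hdotDr ?(eX, eYs, e13, e31, e13s, e31s) ?(minor0, word0)
      ?hdot0r ?(word_fixY _ _ _ eY) ?fE; by compute_list.
Qed.

Lemma model_s2s1 : X om = om -> Ys om = 0 -> z31 om = om ->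
  word_model [:: s2; s1] (fun m => if m is [:: b; c] then word 0 b c om else 0).
Proof.
move=> eX eY e31.
have eXs : Xs om = om by rewrite -[in LHS]eX XsX_G.
have e31s : D o3 o1 om = om by rewrite -[in LHS]e31 z31sz31 Gom eY !op0 !subr0.
have e13 : z13 om = 0 by rewrite -eX z13X.
have e13s : D o1 o3 om = 0 by rewrite -eX z13sX.
apply: word_modelI.
- move=> m n; case/tupleP: m => b m; case/tupleP: m => c m.
  case/tupleP: n => b' n; case/tupleP: n => c' n.
  rewrite (tuple0 m) (tuple0 n) /= word_dot// iterY_dot// om1 mulr1.
  rewrite -val_eqE /= !eqseq_cons eqxx andbT.
  by case: eqP; case: eqP; rewrite ?mul1r ?mul0r ?mulr0.
- move=> y yE; apply: (line_total (one_line eXs) (zero_line eY) (zero_line e13s)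
    (one_line e31s) (zero_line e13) (one_line e31)) => a b c.
  have -> : word a b c om = word 0 b c om by case: a => // a; rewrite word_fixX.
  exact: (yE [tuple b; c]).
- move=> i j x f fE m; have {}fE b c : '[x, word 0 b c om] = f [:: b; c].
    exact: (fE [:: b; c]).
  case/tupleP: m => b m; case/tupleP: m => c m.
  rewrite (tuple0 m) [val _]/= [[seq _ | _ <- _]]/=.
  by_cases_ij i j; case: b => [|b]; case: c => [|c];
    lazy beta iota; rewrite ?hdotDr ?(eXs, eY, e13, e31, e13s, e31s) ?(minor0, word0)
      ?hdot0r ?(word_fixX _ _ _ eX) ?fE; by compute_list.
Qed.

Lemma model_s2 : X om = om -> Y om = om ->
  word_model [:: s2] (fun m => if m is [:: b] then word 0 b 0 om else 0).
Proof.
move=> eX eY.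
have eXs : Xs om = om by rewrite -[in LHS]eX XsX_G.
have eYs : Ys om = om by rewrite -[in LHS]eY YsY_G.
have e31 : z31 om = 0 by rewrite -eY z31Y.
have e31s : D o3 o1 om = 0 by rewrite -eY z31sY.
have e13 : z13 om = 0 by rewrite -eX z13X.
have e13s : D o1 o3 om = 0 by rewrite -eX z13sX.
apply: word_modelI.
- move=> m n; case/tupleP: m => b m; case/tupleP: n => b' n.
  rewrite (tuple0 m) (tuple0 n) /= word_dot//= om1 mulr1.
  by rewrite -val_eqE /= !eqseq_cons eqxx andbT.
- move=> y yE; apply: (line_total (one_line eXs) (one_line eYs) (zero_line e13s)
    (zero_line e31s) (zero_line e13) (zero_line e31)) => a b c.
  have -> : word a b c om = word 0 b 0 om.
    by case: a => [|a]; case: c => [|c]; rewrite ?word_fixX ?word_fixY.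
  exact: (yE [tuple b]).
- move=> i j x f fE m; have {}fE b : '[x, word 0 b 0 om] = f [:: b].
    exact: (fE [:: b]).
  case/tupleP: m => b m; rewrite (tuple0 m) [val _]/= [[seq _ | _ <- _]]/=.
  by_cases_ij i j; case: b => [|b];
    lazy beta iota; rewrite ?hdotDr ?(eXs, eYs, e13, e31, e13s, e31s) ?(minor0, word0)
      ?hdot0r ?(word_fixX _ _ _ eX) ?(word_fixY _ _ _ eY) ?fE; by compute_list.
Qed.

End Vacuum.

(** ** The case of a unitary z33 *)

Section UnitaryV.
Hypothesis V_unitary : forall x, Vs x = 0 -> x = 0.

Lemma VVs x : V (Vs x) = x.
Proof.
apply/eqP; rewrite eq_sym -subr_eq0; apply/eqP/V_unitary.
by rewrite minorB VsV subrr.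
Qed.

Lemma X_eq0 x : X x = 0.
Proof. by apply: hdot_eq0; rewrite (op_adj O) XsX VVs subrr hdot0r. Qed.
Lemma Y_eq0 x : Y x = 0.
Proof. by apply: hdot_eq0; rewrite (op_adj O) YsY VVs subrr hdot0r. Qed.
Lemma z13_eq0 x : z13 x = 0.
Proof.
by apply: hdot_eq0; rewrite (op_adj O) z13sz13 X_eq0 VVs subrr subr0 hdot0r.
Qed.
Lemma z31_eq0 x : z31 x = 0.
Proof.
by apply: hdot_eq0; rewrite (op_adj O) z31sz31 Y_eq0 VVs subrr subr0 hdot0r.
Qed.

Lemma minor_eq0 i j x : (forall y, Z i j y = 0) -> D i j x = 0.
Proof. by move=> Z0; apply: hdot_ext => v; rewrite minor_adj Z0 hdot0r hdot0l. Qed.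

Lemma z12_V x : z12 (V x) = V (z12 x).
Proof. by rewrite z12V z13_eq0 addr0. Qed.
Lemma z21_V x : z21 (V x) = V (z21 x).
Proof. by rewrite z21V X_eq0 addr0. Qed.
Lemma z11W x : z11 (W x) = x. Proof. by rewrite minorE (op_det O). Qed.
Lemma z21W x : z21 (W x) = 0. Proof. by rewrite minorE (op_row O). Qed.
Lemma z12W x : z12 (W x) = 0. Proof. by rewrite minorE (op_col O). Qed.

Section MinorIterW.
Variables (n : nat) (x : H).

Lemma minor33_iterW : Vs (iter n W x) = iter n W (Vs x).
Proof. exact: iter_comm VsW. Qed.
Lemma minor22_iterW : D o2 o2 (iter n W x) = if n is n'.+1 then iter n' W (V x) else z11 (V x).
Proof.
rewrite minorE; case: n => [//|n'].
by rewrite /= -WV z11W (iter_comm _ _ (fun y => esym (WV y))).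
Qed.
Lemma minor12_iterW : D o1 o2 (iter n W x) = if n is n'.+1 then 0 else D o1 o2 x.
Proof. by case: n => [//|n']; rewrite minorE z21_V z21W op0. Qed.
Lemma minor21_iterW : D o2 o1 (iter n W x) = if n is n'.+1 then 0 else D o2 o1 x.
Proof. by case: n => [//|n']; rewrite minorE z12_V z12W op0. Qed.
Lemma minor_iterW0 : (D o1 o3 (iter n W x) = 0) * (D o3 o1 (iter n W x) = 0) *
  (Xs (iter n W x) = 0) * (Ys (iter n W x) = 0).
Proof.
by do !split; apply: minor_eq0; [exact: z13_eq0|exact: z31_eq0|exact: X_eq0|exact: Y_eq0].
Qed.

End MinorIterW.

Lemma total_wordsW (L : set H) : irreducible_ops ->
  (forall l, L l -> [/\ L (V l), L (Vs l), L (z11 l), L (D o1 o2 l) & L (D o2 o1 l)]) ->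
  (exists2 l, L l & l <> 0) ->
  forall y, (forall n l, L l -> '[y, iter n W l] = 0) -> y = 0.
Proof.
move=> irr Lst [l0 Ll0 l00] y yL.
pose S := [set v | exists n l, L l /\ v = iter n W l].
apply: (@irreducible_total S irr) => [i j _ u [n [l [Ll ->]]] uS||_ [n [l [Ll ->]]]].
- have uW n' l' : L l' -> '[u, iter n' W l'] = 0.
    by move=> Ll'; apply: uS; exists n', l'.
  have uL l' : L l' -> '[u, l'] = 0 by exact: (uW 0%N).
  have [L1 L2 L3 L4 L5] := Lst l Ll; have [_ _ L6 _ _] := Lst _ L1.
  case: (ord3P i) => ->; case: (ord3P j) => ->;
    rewrite ?(minor12_iterW, minor21_iterW, minor22_iterW, minor33_iterW, minor_iterW0);
    rewrite ?hdot0r ?(uW n)//; first exact: (uW n.+1).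
  + by case: n => [|n]; rewrite ?hdot0r ?uL.
  + by case: n => [|n]; rewrite ?hdot0r ?uL.
  + by case: n => [|n]; rewrite ?uW ?uL.
- by exists l0 => //; exists 0%N, l0.
- exact: yL.
Qed.

Lemma corner_wordsW (L : set H) : irreducible_ops ->
  (forall l, L l -> [/\ L (V l), L (Vs l), L (z11 l), L (D o1 o2 l) & L (D o2 o1 l)]) ->
  (exists2 l, L l & l <> 0) ->
  forall y, z11 y = 0 \/ (forall l, L l -> L (W l)) ->
    (forall l, L l -> '[y, l] = 0) -> y = 0.
Proof.
move=> irr Lst Lne y hW yL; apply: (total_wordsW irr Lst Lne) => n l Ll.
case: hW => [W0|LW].
  by case: n => [|n]; [exact: yL|rewrite /= -(op_adj O) W0 hdot0l].
by apply: yL; elim: n => //= n; exact: LW.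
Qed.

Section VacuumW.
Variable om : H.
Hypothesis irr : irreducible_ops.
Hypothesis om1 : '[om, om] = 1.
Hypothesis Vom : V om = om.

Let Vsom : Vs om = om. Proof. by rewrite -[in LHS]Vom VsV. Qed.

Lemma line_totalW (t1 t2 t3 : C) :
  z11 om = t1 *: om -> D o1 o2 om = t2 *: om -> D o2 o1 om = t3 *: om ->
  forall y, (forall n, '[y, iter n W om] = 0) -> y = 0.
Proof.
move=> e1 e2 e3 y yw.
apply: (@total_wordsW [set l | exists t : C, l = t *: om] irr).
- move=> _ [t ->]; rewrite !minorZ !opZ Vom Vsom e1 e2 e3 !scalerA.
  by split; eexists.
- by exists om; [exists 1; rewrite scale1r|exact: om_neq0].
- move=> n _ [t ->]; have -> : iter n W (t *: om) = t *: iter n W om.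
    by elim: n => //= n ->; rewrite minorZ.
  by rewrite hdotZr yw mulr0.
Qed.

Lemma model_s1 : z11 om = 0 -> z12 om = om ->
  word_model [:: s1] (fun m => if m is [:: n] then iter n W om else 0).
Proof.
move=> e11 e12.
have e21 : D o2 o1 om = om by rewrite minorE Vom.
have e12s : D o1 o2 om = om.
  rewrite minorE Vom -[in LHS]e12 -(@op_anti Z O o1 o1 o2 o2)//.
  by rewrite -(@op_diag1 Z O o1 o1 o2 o2)// e11 op0 subr0 -[z11 _](minorE om) Vsom.
apply: word_modelI.
- move=> m n; case/tupleP: m => a m; case/tupleP: n => b n.
  rewrite (tuple0 m) (tuple0 n) /= (ladder _ _ (minor_adj o1 o1))// => [|k].
    by rewrite om1 mulr1 -val_eqE /= !eqseq_cons eqxx andbT.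
  exact: z11W.
- move=> y yE; have z0 : z11 om = (0 : C) *: om by rewrite scale0r.
  have one x : x = om -> x = (1 : C) *: om by rewrite scale1r.
  apply: (line_totalW z0 (one _ e12s) (one _ e21)) => n.
  exact: (yE [tuple n]).
- move=> i j x f fE m; have {}fE n : '[x, iter n W om] = f [:: n].
    exact: (fE [:: n]).
  have fE0 : '[x, om] = f [:: 0%N] := fE 0%N.
  case/tupleP: m => a m; rewrite (tuple0 m) [val _]/= [[seq _ | _ <- _]]/=.
  case: (ord3P i) => ->; case: (ord3P j) => ->;
    rewrite -?[W (iter a W om)]/(iter a.+1 W om)
      ?(minor12_iterW, minor21_iterW, minor22_iterW, minor33_iterW, minor_iterW0);
    case: a => [|a]; lazy beta iota;
    rewrite ?(Vom, Vsom, e11, e12, e21, e12s) ?hdot0r ?fE ?fE0; by compute_list.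
Qed.

Lemma model_id : z11 om = om -> W om = om -> word_model [::] (fun=> om).
Proof.
move=> e11 eW.
have e12s : D o1 o2 om = 0 by rewrite minorE Vom -eW z21W.
have e21s : D o2 o1 om = 0 by rewrite minorE Vom -eW z12W.
apply: word_modelI.
- by move=> m n; rewrite (tuple0 m) (tuple0 n) om1 eqxx.
- move=> y yE; have z0 x : x = 0 -> x = (0 : C) *: om by rewrite scale0r.
  have one x : x = om -> x = (1 : C) *: om by rewrite scale1r.
  apply: (line_totalW (one _ e11) (z0 _ e12s) (z0 _ e21s)) => n.
  by rewrite iter_fix//; exact: (yE [tuple]).
- move=> i j x f fE m; have {}fE : '[x, om] = f [::] by exact: (fE [::]).
  rewrite (tuple0 m) [val _]/= [[seq _ | _ <- _]]/=.
  have e22 : D o2 o2 om = om by rewrite minorE Vom.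
  have e0 := minor_iterW0 0 om; rewrite /= in e0.
  case: (ord3P i) => ->; case: (ord3P j) => ->;
    rewrite ?(e12s, e21s, e22, e0, Vsom, eW) ?hdot0r ?fE; by compute_list.
Qed.

End VacuumW.
End UnitaryV.

End Consequences.
End OperatorRelations.

(** * Irreducible representations of A_2(0) *)

Section Classification.
Variables (R : realType) (A : cstarAlgebra R) (z : 'I_3 -> 'I_3 -> A).
Hypothesis hA : is_A2_0 z.
Variables (H : hilbertSpace R) (pi : A -> {linear H -> H}).
Hypothesis hpi : is_representation pi.
Hypothesis hirr : irreducible pi.
Local Notation C := R[i].
Local Notation "''[' u , v ]" := (hdot H u v).
Implicit Types x y : H.

Definition gen (i j : 'I_3) : H -> H := pi (z i j).
Local Notation D := (minor_op gen).

Let rel := A2_0_rel hA.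

Lemma minor_gen i j x : D i j x = pi (z i j)^#%cstar x.
Proof.
rewrite /minor_op /gen -(repM hpi).
by case: (ord3P i) => ->; case: (ord3P j) => ->; rewrite !lift3
  ?(rel_star11 rel, rel_star12 rel, rel_star13 rel, rel_star21 rel, rel_star22 rel,
    rel_star23 rel, rel_star31 rel, rel_star32 rel, rel_star33 rel).
Qed.

Lemma oprel_gen : oprel gen.
Proof.
split; rewrite /gen.
- by move=> i j c x y; rewrite linearP.
- by move=> i j l x jl; rewrite -(repM hpi) (rel_row rel)// (rep0 hpi).
- by move=> i j k x ik; rewrite -(repM hpi) (rel_col rel)// (rep0 hpi).
- by move=> i j k l x ik jl; rewrite -!(repM hpi) (rel_anti rel ik jl).
- by move=> i j k l x ik jl m; rewrite -!(repM hpi) (rel_anti0 rel ik jl m) (rep0 hpi).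
- by move=> i j k l x ik jl m; rewrite -!(repM hpi) (rel_diag rel ik jl m).
- by move=> i j k l x ik jl m; rewrite -!(repM hpi) -(repB hpi) (rel_diag1 rel ik jl m).
- by move=> x; rewrite -!(repM hpi) (rel_det rel) (rep1 hpi).
- by move=> i j x y; rewrite -/gen minor_gen (rep_adj hpi).
- move=> i j r s x ir js; rewrite -/gen !minor_gen /gen -!(repM hpi).
  by rewrite (rel_star_comm rel ir js).
Qed.

Let O := oprel_gen.

Lemma irreducible_gen : irreducible_ops gen.
Proof.
move=> K KS KZ.
apply: (irreducible_generators hpi (A2_0_gen hA) hirr KS) => _ x [i [j ->]] Kx.
split; first exact: (KZ (i, j)).
by rewrite -minor_gen /minor_op; apply: (KZ (_, _)); apply: (KZ (_, _)).
Qed.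

Lemma closed_subspace_minor i j : closed_subspace [set x | D i j x = 0].
Proof.
rewrite (_ : mkset _ = [set x | pi (z i j)^#%cstar x = 0]).
  by apply: closed_subspace_ker; exact: (rep_bounded hpi).
by apply/seteqP; split=> x /=; rewrite minor_gen.
Qed.

Lemma closed_subspace_gen i j : closed_subspace [set x | gen i j x = 0].
Proof. by apply: closed_subspace_ker; exact: (rep_bounded hpi). Qed.

Section Eigenvectors.
Variables (H0 : set H) (i j r s : 'I_3).
Hypothesis H0S : closed_subspace H0.
Let stab (L : set H) := forall x, L x ->
  [/\ L (gen i j x), L (D i j x), L (gen r s x) & L (D r s x)].
Hypothesis H0_stab : stab H0.
Hypothesis H0_comm : forall x, H0 x -> [/\ gen i j (D i j x) = D i j (gen i j x),
  gen r s (D r s x) = D r s (gen r s x), gen i j (gen r s x) = gen r s (gen i j x) &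
  gen i j (D r s x) = D r s (gen i j x)].
Hypothesis H0_irr : forall L, closed_subspace L -> L `<=` H0 -> stab L ->
  (exists2 x, L x & x <> 0) ->
  forall y, H0 y -> (forall x, L x -> '[y, x] = 0) -> y = 0.

Let F : set A := [set a | [\/ a = z i j, a = (z i j)^#%cstar, a = z r s | a = (z r s)^#%cstar]].

Lemma adj_comm_on (a b : A) : (forall x, H0 x -> [/\ H0 (pi a x), H0 (pi b x),
    H0 (pi a^#%cstar x) & H0 (pi b^#%cstar x)]) ->
  (forall x, H0 x -> pi a (pi b x) = pi b (pi a x)) ->
  forall x, H0 x -> pi a^#%cstar (pi b^#%cstar x) = pi b^#%cstar (pi a^#%cstar x).
Proof.
move=> st ab x H0x; apply/eqP; rewrite -subr_eq0; apply/eqP.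
set w := _ - _; have H0w : H0 w.
  have [_ _ ax bx] := st x H0x.
  by apply: csB => //; [have [] := st _ bx|have [] := st _ ax].
by apply: hdot_eq0; rewrite {1}/w hdotBl !(rep_star hpi) ab// subrr.
Qed.

Lemma vacuum_eigen x : H0 x ->
  exists a b : C, gen i j x = a *: x /\ gen r s x = b *: x.
Proof.
have st y : H0 y -> [/\ H0 (pi (z i j) y), H0 (pi (z i j)^#%cstar y),
    H0 (pi (z r s) y) & H0 (pi (z r s)^#%cstar y)].
  by move=> H0y; rewrite -!minor_gen; exact: H0_stab.
have cm y : H0 y -> [/\ pi (z i j) (pi (z i j)^#%cstar y) = pi (z i j)^#%cstar (pi (z i j) y),
    pi (z r s) (pi (z r s)^#%cstar y) = pi (z r s)^#%cstar (pi (z r s) y),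
    pi (z i j) (pi (z r s) y) = pi (z r s) (pi (z i j) y) &
    pi (z i j) (pi (z r s)^#%cstar y) = pi (z r s)^#%cstar (pi (z i j) y)].
  by move=> H0y; rewrite -!minor_gen; exact: H0_comm.
have cm1 : forall y, H0 y -> pi (z i j)^#%cstar (pi (z r s)^#%cstar y) =
    pi (z r s)^#%cstar (pi (z i j)^#%cstar y).
  apply: adj_comm_on => y H0y; first by have [] := st y H0y.
  by have [] := cm y H0y.
have cm2 : forall y, H0 y -> pi (z i j)^#%cstar (pi (z r s) y) =
    pi (z r s) (pi (z i j)^#%cstar y).
  move=> y H0y; have := @adj_comm_on (z i j) (z r s)^#%cstar; rewrite ca_starK.
  apply=> // v H0v; first by have [] := st v H0v.
  by have [] := cm v H0v.
have ev f : F f -> H0 x -> exists c : C, pi f x = c *: x.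
  apply: (corner_eigen hpi H0S) => //.
  - by move=> _ [] ->; rewrite ?ca_starK; [apply: Or42|apply: Or41|apply: Or44|apply: Or43].
  - by move=> _ y [] -> H0y; have [] := st y H0y.
  - move=> _ _ y [] -> [] -> H0y //; have [c1 c2 c3 c4] := cm y H0y;
      rewrite ?c1 ?c2 ?c3 ?c4 ?cm1 ?cm2 //.
  - move=> L LS LH Lst; apply: H0_irr => // y Ly; rewrite !minor_gen.
    by split; apply: Lst => //; [apply: Or41|apply: Or42|apply: Or43|apply: Or44].
move=> H0x; have [a Ea] := ev (z i j) (Or41 _ _ _ erefl) H0x.
have [b Eb] := ev (z r s) (Or43 _ _ _ erefl) H0x.
by exists a, b.
Qed.

End Eigenvectors.

Lemma normalize x : x <> 0 -> exists2 t : C, t != 0 & '[t *: x, t *: x] = 1.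
Proof.
move=> /eqP x0; exists `|x|^-1; first by rewrite invr_eq0 normr_eq0.
rewrite hdotZl hdotZr conj_Creal ?ger0_real ?invr_ge0// mulrA -expr2 exprVn -hnormE.
by rewrite mulVf// expf_neq0// normr_eq0.
Qed.

Lemma eigen_unimodular i j x (a : C) : '[x, x] = 1 -> gen i j x = a *: x ->
  D i j (gen i j x) = x -> Num.conj a * a = 1.
Proof.
move=> x1 ax Dx; have := op_adj O i j x (gen i j x); rewrite Dx x1 ax.
by rewrite hdotZl hdotZr x1 mulr1 mulrC.
Qed.

(** ** From a model to the representation psi *)

Section Gauge.
Variables lambda mu : C.
Hypothesis lambda1 : Num.conj lambda * lambda = 1.
Hypothesis mu1 : Num.conj mu * mu = 1.

Definition gauge (i j : 'I_3) x : H := Num.conj (phase lambda mu i) *: gen i j x.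

Let phase_conj : Num.conj (Num.conj lambda * mu) = lambda * Num.conj mu.
Proof. by rewrite rmorphM; congr (_ * _); exact: conjCK. Qed.

Lemma phase1 i : phase lambda mu i * Num.conj (phase lambda mu i) = 1.
Proof.
have := lambda1; have := mu1; case: (ord3P i) => ->; rewrite /phase /= ?phase_conj ?conjCK;
  move: (Num.conj lambda) (Num.conj mu) => l m ml ll.
- by rewrite mulrC.
- by rewrite mulrACA ll mul1r mulrC.
- by [].
Qed.

Lemma oprel_gauged : oprel gauge.
Proof.
apply: oprel_gauge; first exact: O.
- move=> i; rewrite conjCK; have := lambda1; have := mu1.
  case: (ord3P i) => ->; rewrite !lift3 /phase /= ?phase_conj ?conjCK;
    move: (Num.conj lambda) (Num.conj mu) => l m ml ll.
  + by rewrite -mulrA ml mulr1.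
  + by [].
  + by rewrite mulrA ll mul1r.
- have := lambda1; have := mu1; rewrite /phase /= ?phase_conj ?conjCK.
  move: (Num.conj lambda) (Num.conj mu) => l m ml ll.
  by rewrite -mulrA ml mulr1.
Qed.

Lemma minor_gauge i j x : minor_op gauge i j x = phase lambda mu i *: D i j x.
Proof.
apply: hdot_ext => y; rewrite (minor_adj oprel_gauged) hdotZl (minor_adj O).
by rewrite /gauge hdotZr conjCK.
Qed.

Lemma irreducible_gauge : irreducible_ops gauge.
Proof.
move=> K KS KZ; apply: (irreducible_gen KS) => -[i j] x Kx.
have := csZ (phase lambda mu i) KS (KZ (i, j) x Kx).
by rewrite /= /gauge scalerA phase1 scale1r.
Qed.

Lemma gauge_eq (i j : 'I_3) x y (a : C) : gen i j x = a *: y ->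
  Num.conj (phase lambda mu i) * a = 1 -> gauge i j x = y.
Proof. by move=> E E1; rewrite /gauge E scalerA E1 scale1r. Qed.

Lemma gauge0 (i j : 'I_3) x : gen i j x = 0 -> gauge i j x = 0.
Proof. by move=> E; rewrite /gauge E scaler0. Qed.

Lemma minor_gauge0 (i j : 'I_3) x : D i j x = 0 -> minor_op gauge i j x = 0.
Proof. by move=> E; rewrite minor_gauge E scaler0. Qed.

(** Transport [pi] along the unitary given by the basis; the action on the generators
   is then the limit that defines psi. *)
Lemma psi_of_model (w : seq 'I_2) (E : seq nat -> H) : word_model gauge w E ->
  exists psi : A -> {linear ell2N R (size w) -> ell2N R (size w)},
    is_psi z lambda mu psi /\ unitarily_equivalent pi psi.
Proof.
move=> [ort tot act].
have [U [Us Ui Uc]] := @onb_unitary _ _ _ (fun m : (size w).-tuple nat => E m) ort tot.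
have /choice[V UV] := Us.
have VU x : V (U x) = x.
  apply/eqP; rewrite -subr_eq0; apply/eqP/hdot_eq0.
  by rewrite -Ui linearB UV subrr hdot0l.
have Uinj x y : U x = U y -> x = y by move=> /(congr1 V); rewrite !VU.
have Vlin : linear V.
  by move=> c x y; apply: Uinj; rewrite linearP !UV.
pose V1 := GRing.isLinear.Build _ _ _ _ V Vlin.
pose V' : {linear ell2N R (size w) -> H} := HB.pack V V1.
have Un x : `|U x| = `|x|.
  by apply/eqP; rewrite -(@eqrXn2 _ 2)// ?normr_ge0// !hnormE Ui.
have Ucont : continuous U.
  by apply: (@lipschitz_cont _ _ _ _ 1) => // x y; rewrite -linearB Un mul1r.
have Vcont : continuous V'.
  apply: (@lipschitz_cont _ _ _ _ 1) => // x y.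
  by rewrite -linearB -Un mul1r /= UV.
pose psi a : {linear ell2N R (size w) -> ell2N R (size w)} := (U \o pi a \o V')%FUN.
exists psi; split; last first.
  exists U; split=> // a x; by rewrite /= VU.
split.
  split.
  - move=> a x; apply: (@continuous_comp _ _ _ (pi a \o V') U).
      by apply: (@continuous_comp _ _ _ V' (pi a)); [exact: Vcont|exact: (rep_bounded hpi)].
    exact: Ucont.
  - by move=> c a b x; rewrite /= (rep_linear hpi) linearP.
  - by move=> x; rewrite /= (rep1 hpi) UV.
  - by move=> a b x; rewrite /= (repM hpi) VU.
  - move=> a x y /=.
    have -> : hdot (ell2N R (size w)) (U (pi a^#%cstar (V x))) y = '[pi a^#%cstar (V x), V y].
      by rewrite -{1}(UV y) Ui.
    rewrite (rep_star hpi).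
    by rewrite -[in RHS](UV x) Ui.
have [u uq lim] := word_operators w lambda mu.
exists u => // i j; apply: lim => f m /=; rewrite Uc.
have -> : (f : l2 R _) = (fun n => '[V f, E n]) :> (_ -> C).
  by apply/funext => n; rewrite -Uc UV.
by rewrite -act /gauge hdotZl mulrA phase1 mul1r.
Qed.

End Gauge.
(** ** The vacuum vectors *)

Local Notation z11 := (gen o1 o1).
Local Notation z12 := (gen o1 o2).
Local Notation z13 := (gen o1 o3).
Local Notation X := (gen o2 o3).
Local Notation z31 := (gen o3 o1).
Local Notation Y := (gen o3 o2).
Local Notation V := (gen o3 o3).
Local Notation W := (D o1 o1).
Local Notation Vs := (D o3 o3).
Local Notation Xs := (D o2 o3).
Local Notation Ys := (D o3 o2).

Definition in_series : Prop :=
  exists lambda mu : C, exists w : seq 'I_2,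
    [/\ `|lambda| = 1, `|mu| = 1,
        w \in [:: [::]; [:: s1]; [:: s2]; [:: s1; s2]; [:: s2; s1];
                  [:: s1; s2; s1]] &
        exists psi : A -> {linear ell2N R (size w) -> ell2N R (size w)},
          is_psi z lambda mu psi /\ unitarily_equivalent pi psi].

Lemma in_series_of_model lambda mu w E : Num.conj lambda * lambda = 1 ->
  Num.conj mu * mu = 1 ->
  w \in [:: [::]; [:: s1]; [:: s2]; [:: s1; s2]; [:: s2; s1]; [:: s1; s2; s1]] ->
  word_model (gauge lambda mu) w E -> in_series.
Proof.
move=> l1 m1 wP mod; exists lambda, mu, w; split=> //; last exact: psi_of_model mod.
  by apply/eqP; rewrite -sqrp_eq1// normCK mulrC l1.
by apply/eqP; rewrite -sqrp_eq1// normCK mulrC m1.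
Qed.

(** The phases for which the second row is normalized by an eigenvalue [a] of
   [X] and the third row by an eigenvalue [b]. *)
Lemma row2_phases (a b : C) : Num.conj a * a = 1 -> Num.conj b * b = 1 ->
  Num.conj (Num.conj b * Num.conj a) * (Num.conj b * Num.conj a) = 1 /\
  Num.conj (Num.conj b) * Num.conj b = 1.
Proof.
move=> a1 b1; have -> : Num.conj (Num.conj b * Num.conj a) = b * a.
  by rewrite rmorphM; congr (_ * _); exact: conjCK.
by rewrite conjCK mulrACA !(mulrC _ (Num.conj _)) b1 mul1r.
Qed.

Lemma row2_phase (a b : C) : Num.conj a * a = 1 -> Num.conj b * b = 1 ->
  Num.conj (phase (Num.conj b * Num.conj a) (Num.conj b) o2) * a = 1.
Proof.
move=> a1 b1; rewrite /phase /=.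
have -> : Num.conj (Num.conj b * Num.conj a) = b * a.
  by rewrite rmorphM; congr (_ * _); exact: conjCK.
by rewrite mulrAC (mulrC b) b1 mul1r.
Qed.

Lemma vacuum_s1s2s1 x : x <> 0 -> Vs x = 0 -> Xs x = 0 -> Ys x = 0 -> in_series.
Proof.
move=> /normalize[t _ om1] Vx Xx Yx.
have [Vo Xo Yo] : [/\ Vs (t *: x) = 0, Xs (t *: x) = 0 & Ys (t *: x) = 0].
  by rewrite !(minorZ O) Vx Xx Yx !scaler0.
move: (t *: x) om1 Vo Xo Yo => om om1 Vo Xo Yo {t x Vx Xx Yx}.
pose H0 : set H := [set x | Vs x = 0] `&` ([set x | Xs x = 0] `&` [set x | Ys x = 0]).
have H0S : closed_subspace H0.
  by do ! (apply: closed_subspaceI); exact: closed_subspace_minor.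
have [||||a [b [Ea Eb]]] := @vacuum_eigen H0 o1 o3 o3 o1 H0S _ _ _ om.
- move=> y [/= Vy [Xy Yy]]; split; split;
    rewrite /= ?(Vsz13 O, Vsz31 O, Vsz13s O, Vsz31s O)//;
    split; rewrite ?(Xsz13 O, Xsz13s O, Ysz31 O, Ysz31s O)//
      ?(Ysz13 O, Ysz13s O, Xsz31 O, Xsz31s O) ?Xy ?Yy ?(op0 O) ?(minor0 O)//.
- move=> y [/= Vy [Xy Yy]]; rewrite (z13z13s O) (z13sz13 O) (z31z31s O) (z31sz31 O).
  by split=> //; [exact: z13z31|rewrite (z31sz13 O)].
- move=> L LS LH Lst Lne y [/= Vy [Xy Yy]] yL.
  apply: (corner_words O irreducible_gen _ _ Lne) => //; try by left.
    by move=> l /LH[].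
  move=> l Ll; have [_ [Xl Yl]] := LH l Ll; have [? ? ? ?] := Lst l Ll.
  by rewrite /= in Xl Yl; rewrite Xl Yl; split; split=> //; exact: cs0 LS.
- by split.
have a1 : Num.conj a * a = 1.
  by apply: (eigen_unimodular om1 Ea); rewrite (z13sz13 O) Vo Xo !(op0 O) !subr0.
have b1 : Num.conj b * b = 1.
  by apply: (eigen_unimodular om1 Eb); rewrite (z31sz31 O) Vo Yo !(op0 O) !subr0.
have b1' : Num.conj (Num.conj b) * Num.conj b = 1 by rewrite conjCK mulrC.
apply: (@in_series_of_model a (Num.conj b)) => //; last first.
  apply: (model_s1s2s1 (oprel_gauged a1 b1') (irreducible_gauge a1 b1') om1);
    try (exact: minor_gauge0); [exact: (gauge_eq Ea)|apply: (gauge_eq Eb)].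
  by rewrite /phase /= !conjCK.
by [].
Qed.

(** [Ys] kills [l - Y (Ys l)]; so where [Ys] is injective [Y] is unitary, and [z31]
   and its adjoint vanish because they kill the range of [Y]. *)
Lemma YYs_fix l : Vs l = 0 -> (Ys (l - Y (Ys l)) = 0 -> l - Y (Ys l) = 0) ->
  [/\ Y (Ys l) = l, z31 l = 0 & D o3 o1 l = 0].
Proof.
move=> Vl inj; have E : l = Y (Ys l).
  apply/eqP; rewrite -subr_eq0; apply/eqP/inj.
  by rewrite (minorB O) (YsY_G O) ?subrr// (VsYs O).
by rewrite -E E (z31Y O) (z31sY O).
Qed.

Lemma XXs_fix l : Vs l = 0 -> (Xs (l - X (Xs l)) = 0 -> l - X (Xs l) = 0) ->
  [/\ X (Xs l) = l, z13 l = 0 & D o1 o3 l = 0].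
Proof.
move=> Vl inj; have E : l = X (Xs l).
  apply/eqP; rewrite -subr_eq0; apply/eqP/inj.
  by rewrite (minorB O) (XsX_G O) ?subrr// (VsXs O).
by rewrite -E E (z13X O) (z13sX O).
Qed.

Lemma vacuum_s1s2 x : (forall y, Vs y = 0 -> Xs y = 0 -> Ys y = 0 -> y = 0) ->
  x <> 0 -> Vs x = 0 -> Xs x = 0 -> in_series.
Proof.
move=> no /normalize[t _ om1] Vx Xx.
have [Vo Xo] : Vs (t *: x) = 0 /\ Xs (t *: x) = 0.
  by rewrite !(minorZ O) Vx Xx !scaler0.
move: (t *: x) om1 Vo Xo => om om1 Vo Xo {t x Vx Xx}.
pose H0 : set H := [set x | Vs x = 0] `&` [set x | Xs x = 0].
have H0S : closed_subspace H0.
  by apply: closed_subspaceI; exact: closed_subspace_minor.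
have fix_H0 l : H0 l -> [/\ Y (Ys l) = l, z31 l = 0 & D o3 o1 l = 0].
  move=> [/= Vl Xl]; apply: YYs_fix => // Yl; apply: no => //.
    by rewrite (minorB O) (VsY O) Vl subrr.
  by rewrite (minorB O) (XsY O) (XsYs O) Xl (minor0 O) (op0 O) subrr.
have [||||a [b [Ea Eb]]] := @vacuum_eigen H0 o1 o3 o3 o2 H0S _ _ _ om.
- move=> y [/= Vy Xy]; split; split;
    rewrite /= ?(Vsz13 O, Vsz13s O, VsY O, VsYs O, Xsz13 O, Xsz13s O, XsY O, XsYs O)//
      ?Xy ?(op0 O) ?(minor0 O)//.
- move=> y H0y; have [Yy _ _] := fix_H0 y H0y; have [/= Vy Xy] := H0y.
  rewrite (z13z13s O) (z13sz13 O) Yy (YsY_G O)//.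
  by split=> //; [exact: z13Y|rewrite (Ysz13 O)].
- move=> L LS LH Lst Lne y [/= Vy Xy] yL.
  apply: (corner_words O irreducible_gen _ _ Lne) => //.
  + by move=> l /LH[].
  + move=> l Ll; have [_ z0 zs0] := fix_H0 l (LH l Ll); have [_ Xl] := LH l Ll.
    rewrite /= in Xl; have [? ? ? ?] := Lst l Ll.
    by rewrite Xl z0 zs0; split; split=> //; exact: cs0 LS.
  + by left.
  + by right=> l /Lst[].
- by split.
have a1 : Num.conj a * a = 1.
  by apply: (eigen_unimodular om1 Ea); rewrite (z13sz13 O) Vo Xo !(op0 O) !subr0.
have b1 : Num.conj b * b = 1.
  by apply: (eigen_unimodular om1 Eb); rewrite (YsY_G O).
have b1' : Num.conj (Num.conj b) * Num.conj b = 1 by rewrite conjCK mulrC.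
apply: (@in_series_of_model a (Num.conj b)) => //; last first.
  apply: (model_s1s2 (oprel_gauged a1 b1') (irreducible_gauge a1 b1') om1);
    try (exact: minor_gauge0); [apply: (gauge_eq Eb)|exact: (gauge_eq Ea)].
  by rewrite /phase /= !conjCK.
by [].
Qed.

Lemma vacuum_s2s1 x : (forall y, Vs y = 0 -> Xs y = 0 -> Ys y = 0 -> y = 0) ->
  x <> 0 -> Vs x = 0 -> Ys x = 0 -> in_series.
Proof.
move=> no /normalize[t _ om1] Vx Yx.
have [Vo Yo] : Vs (t *: x) = 0 /\ Ys (t *: x) = 0.
  by rewrite !(minorZ O) Vx Yx !scaler0.
move: (t *: x) om1 Vo Yo => om om1 Vo Yo {t x Vx Yx}.
pose H0 : set H := [set x | Vs x = 0] `&` [set x | Ys x = 0].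
have H0S : closed_subspace H0.
  by apply: closed_subspaceI; exact: closed_subspace_minor.
have fix_H0 l : H0 l -> [/\ X (Xs l) = l, z13 l = 0 & D o1 o3 l = 0].
  move=> [/= Vl Yl]; apply: XXs_fix => // Xl; apply: no => //.
    by rewrite (minorB O) (VsX O) Vl subrr.
  by rewrite (minorB O) (YsX O) -(XsYs O) Yl (minor0 O) (op0 O) subrr.
have [||||b [a [Eb Ea]]] := @vacuum_eigen H0 o3 o1 o2 o3 H0S _ _ _ om.
- move=> y [/= Vy Yy]; split; split;
    rewrite /= ?(Vsz31 O, Vsz31s O, VsX O, VsXs O, Ysz31 O, Ysz31s O, YsX O) -?(XsYs O)//
      ?Yy ?(op0 O) ?(minor0 O)//.
- move=> y H0y; have [Xy _ _] := fix_H0 y H0y; have [/= Vy Yy] := H0y.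
  rewrite (z31z31s O) (z31sz31 O) Xy (XsX_G O)//.
  by split=> //; [exact: z31X|rewrite (Xsz31 O)].
- move=> L LS LH Lst Lne y [/= Vy Yy] yL.
  apply: (corner_words O irreducible_gen _ _ Lne) => //.
  + by move=> l /LH[].
  + move=> l Ll; have [_ z0 zs0] := fix_H0 l (LH l Ll); have [_ Yl] := LH l Ll.
    rewrite /= in Yl; have [? ? ? ?] := Lst l Ll.
    by rewrite Yl z0 zs0; split; split=> //; exact: cs0 LS.
  + by right=> l /Lst[].
  + by left.
- by split.
have a1 : Num.conj a * a = 1.
  by apply: (eigen_unimodular om1 Ea); rewrite (XsX_G O).
have b1 : Num.conj b * b = 1.
  by apply: (eigen_unimodular om1 Eb); rewrite (z31sz31 O) Vo Yo !(op0 O) !subr0.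
have [l1 m1] := row2_phases a1 b1.
apply: (in_series_of_model l1 m1) => //; last first.
  apply: (model_s2s1 (oprel_gauged l1 m1) (irreducible_gauge l1 m1) om1);
    try (exact: minor_gauge0); [apply: (gauge_eq Ea)|apply: (gauge_eq Eb)].
    exact: row2_phase.
  by rewrite /phase /= !conjCK.
by [].
Qed.

Lemma vacuum_s2 x :
  (forall y, Vs y = 0 -> Xs y = 0 -> y = 0) ->
  (forall y, Vs y = 0 -> Ys y = 0 -> y = 0) ->
  x <> 0 -> Vs x = 0 -> in_series.
Proof.
move=> noX noY /normalize[t _ om1] Vx.
have Vo : Vs (t *: x) = 0 by rewrite (minorZ O) Vx scaler0.
move: (t *: x) om1 Vo => om om1 Vo {t x Vx}.
pose H0 : set H := [set x | Vs x = 0].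
have H0S : closed_subspace H0 by exact: closed_subspace_minor.
have fixX l : H0 l -> [/\ X (Xs l) = l, z13 l = 0 & D o1 o3 l = 0].
  move=> /= Vl; apply: XXs_fix => // Xl; apply: noX => //.
  by rewrite (minorB O) (VsX O) Vl subrr.
have fixY l : H0 l -> [/\ Y (Ys l) = l, z31 l = 0 & D o3 o1 l = 0].
  move=> /= Vl; apply: YYs_fix => // Yl; apply: noY => //.
  by rewrite (minorB O) (VsY O) Vl subrr.
have [||||a [b [Ea Eb]]] := @vacuum_eigen H0 o2 o3 o3 o2 H0S _ _ _ om.
- by move=> y Vy; split; rewrite /H0 /= ?(VsX O, VsXs O, VsY O, VsYs O).
- move=> y H0y; have [Xy _ _] := fixX y H0y; have [Yy _ _] := fixY y H0y.
  rewrite Xy Yy (XsX_G O)// (YsY_G O)//.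
  by split=> //; [exact: XY|rewrite (YsX O)].
- move=> L LS LH Lst Lne y Vy yL.
  apply: (corner_words O irreducible_gen _ _ Lne) => //.
  + move=> l Ll; have [_ z0 zs0] := fixX l (LH l Ll).
    have [_ z0' zs0'] := fixY l (LH l Ll); have [? ? ? ?] := Lst l Ll.
    by rewrite z0 zs0 z0' zs0'; split; split=> //; exact: cs0 LS.
  + by right=> l /Lst[].
  + by right=> l /Lst[].
- by [].
have a1 : Num.conj a * a = 1.
  by apply: (eigen_unimodular om1 Ea); rewrite (XsX_G O).
have b1 : Num.conj b * b = 1.
  by apply: (eigen_unimodular om1 Eb); rewrite (YsY_G O).
have [l1 m1] := row2_phases a1 b1.
apply: (in_series_of_model l1 m1) => //; last first.
  apply: (model_s2 (oprel_gauged l1 m1) (irreducible_gauge l1 m1) om1);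
    try (exact: minor_gauge0); [apply: (gauge_eq Ea)|apply: (gauge_eq Eb)].
    exact: row2_phase.
  by rewrite /phase /= !conjCK.
by [].
Qed.

Lemma vacuum_s1 x : (forall y, Vs y = 0 -> y = 0) -> x <> 0 -> z11 x = 0 -> in_series.
Proof.
move=> VU /normalize[t _ om1] Wx.
have Wo : z11 (t *: x) = 0 by rewrite (opZ O) Wx scaler0.
move: (t *: x) om1 Wo => om om1 Wo {t x Wx}.
pose H0 : set H := [set x | z11 x = 0].
have H0S : closed_subspace H0 by exact: closed_subspace_gen.
have z11Vs y : z11 (Vs y) = Vs (z11 y) by rewrite (op_star_comm O).
have z12sE y : D o1 o2 (z12 y) = z12 (D o1 o2 y).
  by rewrite !(minorE gen) -(z12_V O VU) (@op_anti _ _ _ O o1 o1 o2 o2).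
have [||||a [b [Ea Eb]]] := @vacuum_eigen H0 o1 o2 o3 o3 H0S _ _ _ om.
- move=> y /= Wy; split; rewrite /H0 /= ?(z11V O) ?z11Vs ?Wy ?(op0 O) ?(minor0 O)//.
    by rewrite (op_row O).
  by rewrite minorE (op_col O).
- move=> y _; rewrite z12sE (VVs O VU) (VsV O); split=> //; first exact: z12_V.
  by rewrite (op_star_comm O).
- move=> L LS LH Lst Lne y Wy yL.
  apply: (corner_wordsW O VU irreducible_gen _ Lne) => //; last by left.
  move=> l Ll; have [L1 L2 L3 L4] := Lst l Ll; have := LH l Ll; rewrite /H0 /= => ->.
  split=> //; first exact: cs0 LS.
  by rewrite minorE; have [] := Lst _ L3.
- by [].
have a1 : Num.conj a * a = 1.
  apply: (eigen_unimodular om1 Ea).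
  rewrite z12sE minorE (@op_anti _ _ _ O o1 o1 o2 o2)// -(@op_anti _ _ _ O o1 o1 o2 o2)//.
  rewrite -(@op_diag1 _ _ _ O o1 o1 o2 o2)// (z11V O) Wo !(op0 O) subr0.
  by rewrite -[RHS](VsV O om) (minorE gen (V om)).
have b1 : Num.conj b * b = 1 by apply: (eigen_unimodular om1 Eb); rewrite (VsV O).
have b1' : Num.conj (Num.conj b) * Num.conj b = 1 by rewrite conjCK mulrC.
have VU' y : minor_op (gauge a (Num.conj b)) o3 o3 y = 0 -> y = 0.
  rewrite minor_gauge// => E; apply: VU.
  by rewrite -[LHS]scale1r -(phase1 a1 b1' o3) mulrC -scalerA E scaler0.
apply: (@in_series_of_model a (Num.conj b)) => //; last first.
  apply: (model_s1 (oprel_gauged a1 b1') VU' (irreducible_gauge a1 b1') om1).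
  - by apply: (gauge_eq Eb); rewrite /phase /= !conjCK.
  - exact: gauge0.
  - exact: (gauge_eq Ea).
by [].
Qed.

Lemma vacuum_id : (forall y, Vs y = 0 -> y = 0) -> (forall y, z11 y = 0 -> y = 0) ->
  in_series.
Proof.
move=> VU WU; have [x0 /eqP/normalize[t _ om1]] := proj1 hirr.
move: (t *: x0) om1 => om om1 {t x0}.
have Wz11 y : W (z11 y) = y.
  by apply/eqP; rewrite -subr_eq0; apply/eqP/WU; rewrite (opB O) (z11W O) subrr.
have z12_0 y : z12 y = 0 by rewrite -[y]Wz11 (z12W O).
have z21_0 y : gen o2 o1 y = 0 by rewrite -[y]Wz11 (z21W O).
have [||||a [b [Ea Eb]]] := @vacuum_eigen setT o1 o1 o3 o3 (closed_subspaceT H) _ _ _ om.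
- by [].
- move=> y _; rewrite Wz11 (z11W O) (VVs O VU) (VsV O) (z11V O).
  by rewrite (op_star_comm O).
- move=> L LS LH Lst Lne y _ yL.
  apply: (corner_wordsW O VU irreducible_gen _ Lne) => //; last by right=> l /Lst[].
  move=> l Ll; have [L1 L2 L3 L4] := Lst l Ll.
  have -> : D o1 o2 l = 0 by rewrite minorE z21_0.
  have -> : D o2 o1 l = 0 by rewrite minorE z12_0.
  by split=> //; exact: cs0 LS.
- by [].
have a1 : Num.conj a * a = 1 by exact: (eigen_unimodular om1 Ea).
have b1 : Num.conj b * b = 1 by apply: (eigen_unimodular om1 Eb); rewrite (VsV O).
have b1' : Num.conj (Num.conj b) * Num.conj b = 1 by rewrite conjCK mulrC.
have VU' y : minor_op (gauge a (Num.conj b)) o3 o3 y = 0 -> y = 0.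
  rewrite minor_gauge// => E; apply: VU.
  by rewrite -[LHS]scale1r -(phase1 a1 b1' o3) mulrC -scalerA E scaler0.
apply: (@in_series_of_model a (Num.conj b)) => //; last first.
  apply: (model_id (oprel_gauged a1 b1') VU' (irreducible_gauge a1 b1') om1).
  - by apply: (gauge_eq Eb); rewrite /phase /= !conjCK.
  - exact: (gauge_eq Ea).
  - rewrite minor_gauge//; have := congr1 W Ea; rewrite Wz11 (minorZ O) => E.
    by rewrite /phase /= -E.
by [].
Qed.

(** Each case uses that the vacuum spaces considered before it are zero. *)
Lemma irreducible_in_series : in_series.
Proof.
have [VU|] := pselect (forall y, Vs y = 0 -> y = 0).
  have [WU|] := pselect (forall y, z11 y = 0 -> y = 0); first exact: vacuum_id.
  by move=> /existsNP[x /not_implyP[x0 /(vacuum_s1 VU)]]; exact.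
move=> /existsNP[x /not_implyP[Vx x0]].
have [no|] := pselect (forall y, Vs y = 0 -> Xs y = 0 -> Ys y = 0 -> y = 0); last first.
  move=> /existsNP[y /not_implyP[Vy /not_implyP[Xy /not_implyP[Yy y0]]]].
  exact: vacuum_s1s2s1 Vy Xy Yy.
have [noX|] := pselect (forall y, Vs y = 0 -> Xs y = 0 -> y = 0); last first.
  by move=> /existsNP[y /not_implyP[Vy /not_implyP[Xy y0]]]; exact: vacuum_s1s2 Vy Xy.
have [noY|] := pselect (forall y, Vs y = 0 -> Ys y = 0 -> y = 0); last first.
  by move=> /existsNP[y /not_implyP[Vy /not_implyP[Yy y0]]]; exact: vacuum_s2s1 Vy Yy.
exact: (vacuum_s2 noX noY x0 Vx).
Qed.

End Classification.

Theorem theorem3p1p2 (R : realType) (A : cstarAlgebra R)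
    (z : 'I_3 -> 'I_3 -> A) (hA : is_A2_0 z)
    (H : hilbertSpace R) (pi : A -> {linear H -> H})
    (hpi : is_representation pi) (hirr : irreducible pi) :
  exists lambda mu : R[i], exists w : seq 'I_2,
    [/\ `|lambda| = 1, `|mu| = 1,
        w \in [:: [::]; [:: s1]; [:: s2]; [:: s1; s2]; [:: s2; s1];
                  [:: s1; s2; s1]] &
        exists psi : A -> {linear ell2N R (size w) -> ell2N R (size w)},
          is_psi z lambda mu psi /\ unitarily_equivalent pi psi].
Proof. exact: (irreducible_in_series hA hpi hirr). Qed.
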